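(* Let $n\ge1$ be an integer, fix $T\in(0,\infty)$ and $\boldsymbol\theta_0\in\mathcal T_n$. Let $\mathcal U$ be a Dyson-type potential on $\mathcal T_n$, set $\varphi^j=-\partial_j\mathcal U$, and for $\kappa>0$ let $\mathbf U^\kappa=(U^1,\dots,U^n)$ be the associated unique strong solution, started at $\mathbf U^\kappa_0=\boldsymbol\theta_0$, to $$\mathrm dU^j_t=\varphi^j(\mathbf U^\kappa_t)\,\mathrm dt+\sqrt\kappa\,\mathrm dW^j_t,\qquad j\in\{1,\dots,n\},$$ where $W^1,\dots,W^n$ are independent standard Brownian motions. Let $\mathsf P^\kappa$ be its law. Then the family $(\mathsf P^\kappa)_{\kappa>0}$ satisfies the following large deviation principle as $\kappa\to0+$ in $C_{\boldsymbol\theta_0}([0,T],\mathcal T_n)$ with good rate function $J_T$ (the truncated Dyson-Dirichlet energy): for any closed subset $F$ and open subset $O$ of $C_{\boldsymbol\theta_0}([0,T],\mathcal T_n)$, $$\limsup_{\kappa\to0+}\kappa\log\mathsf P^\kappa[\mathbf U^\kappa\in F]\le-\inf_{\boldsymbol\theta\in F}J_T(\boldsymbol\theta),\qquad \liminf_{\kappa\to0+}\kappa\log\mathsf P^\kappa[\mathbf U^\kappa\in O]\ge-\inf_{\boldsymbol\theta\in O}J_T(\boldsymbol\theta).$$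
   Context: $\mathcal T_n$ is the set of points $\boldsymbol\theta=(\theta^1,\dots,\theta^n)$ of the torus $(\mathbb R/2\pi\mathbb Z)^n$ that admit representatives with $\theta^1<\theta^2<\dots<\theta^n<\theta^1+2\pi$; by convention $\theta^{n+j}=\theta^j+2\pi$. $C_{\boldsymbol\theta_0}([0,T],\mathcal T_n)$ is the space of continuous functions $\boldsymbol\theta:[0,T]\to\mathcal T_n$ with value $\boldsymbol\theta_0$ at time $0$, identified with their continuous lifts to $\mathbb R^n$ started at a fixed representative of $\boldsymbol\theta_0$, with the metric $\sup_{t\in[0,T]}|\boldsymbol\theta_t-\boldsymbol\omega_t|$ (Euclidean norm). A function $\mathcal U\in C^2(\mathcal T_n,[0,\infty))$ is a Dyson-type potential if: (1) $\lim_{\epsilon\to0}\inf_{\boldsymbol\theta\in\partial\mathcal T_n^\epsilon}\mathcal U(\boldsymbol\theta)=+\infty$, where $\mathcal T_n^\epsilon=\{\boldsymbol\theta\in\mathcal T_n:\delta_{\boldsymbol\theta}>\epsilon\}$ and $\delta_{\boldsymbol\theta}=\min_{1\le j\le n}|\theta^{j+1}-\theta^j|$; and (2) there are constants $\mathtt a>0$, $\mathtt B\ge0$ such that $-\mathtt B\le\mathtt a\,\Delta\mathcal U(\boldsymbol\theta)\le|\nabla\mathcal U(\boldsymbol\theta)|^2+\mathtt B$ for all $\boldsymbol\theta\in\mathcal T_n$. The truncated Dyson-Dirichlet energy is $$J_T(\boldsymbol\theta)=\tfrac12\int_0^T\sum_{j=1}^n\big|\tfrac{\mathrm d}{\mathrm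 ds}\theta^j_s-\varphi^j(\boldsymbol\theta_s)\big|^2\,\mathrm ds$$ if $\boldsymbol\theta$ is absolutely continuous on $[0,T]$, and $J_T(\boldsymbol\theta)=+\infty$ otherwise. A good rate function is a function with values in $[0,+\infty]$ all of whose level sets $J_T^{-1}[0,c]$, $c\in[0,\infty)$, are compact. Only small $\kappa$ matter in the limit; for $\kappa\in(0,2\mathtt a]$ the solution exists in $\mathcal T_n$ for all time almost surely. *)

(* Defs.v *)
From HB Require Import structures.
From mathcomp Require Import all_boot all_order all_algebra.
From mathcomp Require Import all_classical all_reals all_analysis.
From mathcomp Require Import ring.

Set Implicit Arguments.
Unset Strict Implicit.
Unset Printing Implicit Defensive.

Import Order.TTheory GRing.Theory Num.Theory.
Import numFieldNormedType.Exports.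

Local Open Scope classical_set_scope.
Local Open Scope ring_scope.

(** * The configuration space

   There are n.+1 >= 1 angles, indexed from 0.  A point of the torus
   (R / 2 pi Z)^(n+1) is given by any of its representatives in R^(n+1), so a
   subset of the torus is a (2 pi Z)^(n+1)-invariant set of vectors, and a
   function on it is a (2 pi Z)^(n+1)-periodic function of vectors, whose
   values outside of the set are irrelevant. *)

Definition lattice_shift (R : realType) (n : nat) (k : 'rV[int]_n.+1)
  (x : 'rV[R]_n.+1) : 'rV[R]_n.+1 := \row_j (x 0 j + 2 * pi * (k 0 j)%:~R).

(* [angle x j] is the j-th angle for an arbitrary index j, according to the
   convention theta^{(n+1) + j} = theta^j + 2 pi. *)
Definition angle (R : realType) (n : nat) (x : 'rV[R]_n.+1) (j : nat) : R :=
  x 0 (inord (j %% n.+1)) + 2 * pi * (j %/ n.+1)%:R.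

Definition ordered_rep (R : realType) (n : nat) : set 'rV[R]_n.+1 :=
  [set x | forall j : 'I_n.+1, angle x j < angle x j.+1].
Arguments ordered_rep {R n}.

Definition torus_conf (R : realType) (n : nat) : set 'rV[R]_n.+1 :=
  [set x | exists k, ordered_rep (lattice_shift k x)].
Arguments torus_conf {R n}.

Definition gap (R : realType) (n : nat) (x : 'rV[R]_n.+1) (j : nat) : R :=
  `|angle x j.+1 - angle x j|.

(* Only meant for ordered representatives, which are unique up to a common
   shift of all the angles; the gaps do not depend on this shift. *)
Definition min_gap (R : realType) (n : nat) (x : 'rV[R]_n.+1) : R :=
  \big[Num.min/gap x 0]_(j < n.+1) gap x j.

Definition torus_conf_eps (R : realType) (n : nat) (e : R) : set 'rV[R]_n.+1 :=
  [set x | exists k, ordered_rep (lattice_shift k x) /\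
                     e < min_gap (lattice_shift k x)].
Arguments torus_conf_eps {R n}.

Definition boundary (X : topologicalType) (A : set X) : set X :=
  closure A `\` interior A.

(** * Dyson-type potentials *)

Definition partial (R : realType) (n : nat) (j : 'I_n.+1)
  (f : 'rV[R]_n.+1 -> R) (x : 'rV[R]_n.+1) : R := 'D_(delta_mx 0 j) f x.

Definition laplacian (R : realType) (n : nat) (f : 'rV[R]_n.+1 -> R)
  (x : 'rV[R]_n.+1) : R := \sum_j partial j (partial j f) x.

Definition grad_norm2 (R : realType) (n : nat) (f : 'rV[R]_n.+1 -> R)
  (x : 'rV[R]_n.+1) : R := \sum_j (partial j f x) ^+ 2.

(* Class C^2 on an open set [A]. *)
Definition C2_on (R : realType) (n : nat) (A : set 'rV[R]_n.+1)
    (f : 'rV[R]_n.+1 -> R) : Prop :=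
  forall x, A x ->
  [/\ {for x, continuous f},
      (forall j, derivable f x (delta_mx 0 j) /\
                 {for x, continuous (partial j f)}) &
      (forall i j, derivable (partial j f) x (delta_mx 0 i) /\
                   {for x, continuous (partial i (partial j f))})].

Definition dyson_type_potential (R : realType) (n : nat)
    (U : 'rV[R]_n.+1 -> R) : Prop :=
  [/\ (forall x, torus_conf x -> forall k, U (lattice_shift k x) = U x),
      (forall x, torus_conf x -> 0 <= U x),
      C2_on torus_conf U,
      ereal_inf [set (U x)%:E | x in boundary (torus_conf_eps e)]
        @[e --> 0^'+] --> +oo%E &
      exists a B : R, [/\ 0 < a, 0 <= B &
        forall x, torus_conf x ->
          - B <= a * laplacian U x <= grad_norm2 U x + B]].

Definition drift (R : realType) (n : nat) (U : 'rV[R]_n.+1 -> R)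
  (j : 'I_n.+1) (x : 'rV[R]_n.+1) : R := - partial j U x.

(** * The path space

   The paths on [0, T] are extended to constants before 0 and after T.  This
   makes a path determined by its restriction to [0, T], and continuity on the
   whole line equivalent to continuity on [0, T].  They are the continuous
   lifts to R^(n+1) started at the representative [theta0]. *)

Record torus_path (R : realType) (n : nat) (T : R) (theta0 : 'rV[R]_n.+1) :=
  TorusPath {
    path_fun :> R -> 'rV[R]_n.+1 ;
    path_stopped : forall t, path_fun t = path_fun (Num.max 0 (Num.min t T)) ;
    path_continuous : continuous path_fun ;
    path_start : path_fun 0 = theta0 ;
    path_conf : forall t, torus_conf (path_fun t) }.

Definition enorm (R : realType) (n : nat) (x : 'rV[R]_n.+1) : R :=
  Num.sqrt (\sum_j x 0 j ^+ 2).

Definition path_dist (R : realType) (n : nat) (T : R) (theta0 : 'rV[R]_n.+1)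
  (f g : torus_path T theta0) : R :=
  sup [set enorm (f t - g t) | t in `[0, T]].

Lemma enorm_ge0 (R : realType) (n : nat) (x : 'rV[R]_n.+1) : 0 <= enorm x.
Proof. exact: sqrtr_ge0. Qed.

Lemma enorm_sqr (R : realType) (n : nat) (x : 'rV[R]_n.+1) :
  enorm x ^+ 2 = \sum_j x 0 j ^+ 2.
Proof. by rewrite sqr_sqrtr// sumr_ge0// => j _; exact: sqr_ge0. Qed.

Lemma enorm0 (R : realType) (n : nat) : enorm (0 : 'rV[R]_n.+1) = 0.
Proof.
by rewrite /enorm big1 ?sqrtr0// => j _; rewrite mxE expr0n.
Qed.

Lemma enorm_eq0 (R : realType) (n : nat) (x : 'rV[R]_n.+1) :
  enorm x = 0 -> x = 0.
Proof.
move=> x0; have := enorm_sqr x; rewrite x0 expr0n/= => /esym/psumr_eq0P h.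
apply/rowP => j; rewrite mxE; apply/eqP; rewrite -sqrf_eq0; apply/eqP.
by apply: h => // i _; exact: sqr_ge0.
Qed.

Lemma enormN (R : realType) (n : nat) (x : 'rV[R]_n.+1) : enorm (- x) = enorm x.
Proof. by congr Num.sqrt; apply: eq_bigr => j _; rewrite mxE sqrrN. Qed.

Lemma enorm_cauchy_schwarz (R : realType) (n : nat) (x y : 'rV[R]_n.+1) :
  \sum_j x 0 j * y 0 j <= enorm x * enorm y.
Proof.
have [x0|xN0] := eqVneq (enorm x) 0.
  by rewrite x0 mul0r (enorm_eq0 x0) big1// => j _; rewrite mxE mul0r.
have [y0|yN0] := eqVneq (enorm y) 0.
  by rewrite y0 mulr0 (enorm_eq0 y0) big1// => j _; rewrite mxE mulr0.
set a := enorm x; set b := enorm y; set s := (X in X <= _).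
have a0 : 0 < a by rewrite lt_neqAle eq_sym xN0 enorm_ge0.
have b0 : 0 < b by rewrite lt_neqAle eq_sym yN0 enorm_ge0.
have : 0 <= \sum_j (b * x 0 j - a * y 0 j) ^+ 2.
  by apply: sumr_ge0 => j _; exact: sqr_ge0.
under eq_bigr => j _.
  rewrite (_ : _ ^+ 2 = b ^+ 2 * (x 0 j ^+ 2) + a ^+ 2 * (y 0 j ^+ 2)
                        - (2 * a * b) * (x 0 j * y 0 j)); last by ring.
  over.
rewrite sumrB big_split/= -!mulr_sumr -!enorm_sqr -/a -/b -/s.
rewrite (_ : _ - _ = (2 * a * b) * (a * b - s)); last by ring.
by rewrite pmulr_rge0 ?subr_ge0// !mulr_gt0.
Qed.

Lemma enormD (R : realType) (n : nat) (x y : 'rV[R]_n.+1) :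
  enorm (x + y) <= enorm x + enorm y.
Proof.
rewrite -(@ler_pXn2r _ 2)// ?nnegrE ?addr_ge0 ?enorm_ge0//.
rewrite enorm_sqr; under eq_bigr do rewrite mxE sqrrD.
rewrite !big_split/= -!enorm_sqr sqrrD lerD2r lerD2l.
by rewrite -mulr2n ler_wMn2r// enorm_cauchy_schwarz.
Qed.

Lemma enorm_continuous (R : realType) (n : nat) :
  continuous (@enorm R n).
Proof.
move=> x; apply: (@continuous_comp _ _ _
  (fun x : 'rV[R]_n.+1 => \sum_j x 0 j ^+ 2) Num.sqrt);
  last exact: sqrt_continuous.
apply: (@continuous_big _ _ +%R 0 _ _ _ _
  (fun j (x : 'rV[R]_n.+1) => x 0 j ^+ 2)); first exact: add_continuous.
move=> j _ {}x.
apply: (@continuous_comp _ _ _ (fun x : 'rV[R]_n.+1 => x 0 j) (fun r => r ^+ 2)).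
  exact: coord_continuous.
exact: exprn_continuous.
Qed.

Lemma path_dist_has_ubound (R : realType) (n : nat) (T : R)
    (theta0 : 'rV[R]_n.+1) (f g : torus_path T theta0) :
  has_ubound [set enorm (f t - g t) | t in `[0, T]].
Proof.
have [T0|T0] := leP 0 T; last first.
  exists 0 => y [t /= tT _]; move: tT; rewrite in_itv/= => /andP[t0 tT].
  by have := le_trans t0 tT; rewrite leNgt T0.
have cont : {within `[0, T], continuous (fun t => enorm (f t - g t))}.
  apply: continuous_subspaceT => t.
  apply: (@continuous_comp _ _ _ (fun t => f t - g t) (@enorm R n));
    last exact: enorm_continuous.
  by apply: cvgB; exact: path_continuous.
have [c _ h] := EVT_max T0 cont.
by exists (enorm (f c - g c)) => _ [t tT <-]; exact: h.
Qed.

Lemma path_dist_ge (R : realType) (n : nat) (T : R) (theta0 : 'rV[R]_n.+1)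
    (f g : torus_path T theta0) (t : R) :
  t \in `[0, T] -> enorm (f t - g t) <= path_dist f g.
Proof.
by move=> tT; apply: ub_le_sup; [exact: path_dist_has_ubound|exists t].
Qed.

Lemma path_dist_le (R : realType) (n : nat) (T : R) (theta0 : 'rV[R]_n.+1)
    (f g : torus_path T theta0) (M : R) : 0 <= M ->
  (forall t, t \in `[0, T] -> enorm (f t - g t) <= M) -> path_dist f g <= M.
Proof.
move=> M0 h; rewrite /path_dist; set A := image _ _.
have [->|/set0P A0] := eqVneq A set0; first by rewrite sup0.
by apply: ge_sup => // _ [t tT <-]; exact: h.
Qed.

Lemma path_dist_ge0 (R : realType) (n : nat) (T : R) (theta0 : 'rV[R]_n.+1)
    (f g : torus_path T theta0) : 0 <= path_dist f g.
Proof.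
have [T0|T0] := leP 0 T.
  apply: le_trans (enorm_ge0 (f 0 - g 0)) (path_dist_ge _ _ _).
  by rewrite in_itv/= lexx.
rewrite /path_dist (_ : image _ _ = set0) ?sup0//.
apply/seteqP; split => [y [t /= tT _]|//]; move: tT.
rewrite in_itv/= => /andP[t0 tT].
by have := le_trans t0 tT; rewrite leNgt T0.
Qed.

Lemma path_distxx (R : realType) (n : nat) (T : R) (theta0 : 'rV[R]_n.+1)
  (f : torus_path T theta0) : path_dist f f = 0.
Proof.
apply/eqP; rewrite eq_le path_dist_ge0 andbT; apply: path_dist_le => // t _.
by rewrite subrr enorm0.
Qed.

Lemma path_dist_sym (R : realType) (n : nat) (T : R) (theta0 : 'rV[R]_n.+1)
  (f g : torus_path T theta0) : path_dist f g = path_dist g f.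
Proof.
by rewrite /path_dist; congr sup; apply: eq_imagel => t _; rewrite -enormN opprB.
Qed.

Lemma path_dist_triangle (R : realType) (n : nat) (T : R)
    (theta0 : 'rV[R]_n.+1) (g f h : torus_path T theta0) :
  path_dist f h <= path_dist f g + path_dist g h.
Proof.
apply: path_dist_le => [|t tT]; first by rewrite addr_ge0 ?path_dist_ge0.
rewrite (_ : f t - h t = (f t - g t) + (g t - h t)); last by rewrite addrA subrK.
by rewrite (le_trans (enormD _ _))// lerD ?path_dist_ge.
Qed.

Lemma path_ext (R : realType) (n : nat) (T : R) (theta0 : 'rV[R]_n.+1)
  (f g : torus_path T theta0) : path_fun f = path_fun g -> f = g.
Proof.
case: f g => [f f1 f2 f3 f4] [g g1 g2 g3 g4] /= fg; subst g.
by congr TorusPath; exact: Prop_irrelevance.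
Qed.

Lemma path_dist_eq0 (R : realType) (n : nat) (T : R) (theta0 : 'rV[R]_n.+1)
  (f g : torus_path T theta0) : path_dist f g = 0 -> f = g.
Proof.
move=> fg; apply: path_ext; apply/funext => t.
rewrite (path_stopped f) (path_stopped g); set s := Num.max _ _.
have [T0|T0] := leP 0 T; last first.
  suff -> : s = 0 by rewrite !path_start.
  by apply/max_idPl; rewrite ge_min (ltW T0) orbT.
apply/eqP; rewrite -subr_eq0; apply/eqP; apply: enorm_eq0; apply/eqP.
rewrite eq_le enorm_ge0 andbT -fg path_dist_ge// in_itv/= le_max lexx/=.
by rewrite ge_max T0 ge_min lexx orbT.
Qed.

HB.instance Definition _ (R : realType) (n : nat) (T : R)
  (theta0 : 'rV[R]_n.+1) := gen_eqMixin (torus_path T theta0).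
HB.instance Definition _ (R : realType) (n : nat) (T : R)
  (theta0 : 'rV[R]_n.+1) := gen_choiceMixin (torus_path T theta0).
HB.instance Definition _ (R : realType) (n : nat) (T : R)
  (theta0 : 'rV[R]_n.+1) :=
  @isMetric.Build R (torus_path T theta0) (@path_dist R n T theta0)
    (@path_distxx R n T theta0) (@path_dist_eq0 R n T theta0)
    (@path_dist_sym R n T theta0) (@path_dist_triangle R n T theta0).

(** * The truncated Dyson-Dirichlet energy *)

Definition absolutely_continuous (R : realType) (a b : R) (g : R -> R) : Prop :=
  forall e, 0 < e -> exists2 d, 0 < d &
    forall (m : nat) (u v : 'I_m -> R),
      (forall i, a <= u i /\ u i <= v i /\ v i <= b) ->
      (forall i j, i != j -> v i <= u j \/ v j <= u i) ->
      \sum_i (v i - u i) < d ->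
      \sum_i `|g (v i) - g (u i)| < e.

(* The derivative of an absolutely continuous path only exists almost
   everywhere; the integral does not depend on its values elsewhere. *)
Definition dirichlet_energy (R : realType) (n : nat)
    (phi : 'I_n.+1 -> 'rV[R]_n.+1 -> R) (T : R) (theta0 : 'rV[R]_n.+1)
    (theta : torus_path T theta0) : \bar R :=
  if `[< forall j, absolutely_continuous 0 T (fun s => theta s 0 j) >] then
    ((2^-1)%:E * \int[lebesgue_measure]_(s in `[0%R, T])
      (\sum_j `|derive1 (fun r => theta r 0 j) s - phi j (theta s)| ^+ 2)%:E)%E
  else +oo%E.

(** * Brownian motion and the stochastic differential equation *)

(* As the index type is finite and every [A i] may be the full space, this is
   the product rule over every subfamily. *)
Definition independent_sigma (R : realType) (d : measure_display)
    (Omega : measurableType d) (P : probability Omega R) (I : finType)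
    (G : I -> set (set Omega)) : Prop :=
  forall A : I -> set Omega, (forall i, G i (A i)) ->
    P (\bigcap_(i in setT) A i) = (\prod_i P (A i))%E.

Definition sigma_rv (R : realType) (d : measure_display)
    (Omega : measurableType d) (X : Omega -> R) : set (set Omega) :=
  [set X @^-1` B | B in measurable].

Definition standard_brownian (R : realType) (d : measure_display)
    (Omega : measurableType d) (P : probability Omega R)
    (B : R -> Omega -> R) : Prop :=
  [/\ (forall t, 0 <= t -> measurable_fun setT (B t)),
      {ae P, forall w, B 0 w = 0},
      (forall (m : nat) (t : nat -> R), 0 <= t 0%N ->
         {homo t : i j / (i <= j)%N >-> i <= j} ->
         independent_sigma P (fun i : 'I_m =>
           sigma_rv (fun w => B (t i.+1) w - B (t i) w))),
      (forall s t, 0 <= s -> s < t -> forall A, measurable A ->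
         P ((fun w => B t w - B s w) @^-1` A) =
         normal_prob 0 (Num.sqrt (t - s)) A) &
      {ae P, forall w, {within `[0, +oo[, continuous (fun t => B t w)}}].

Definition independent_brownians (R : realType) (n : nat)
    (d : measure_display) (Omega : measurableType d) (P : probability Omega R)
    (W : 'I_n.+1 -> R -> Omega -> R) : Prop :=
  (forall j, standard_brownian P (W j)) /\
  independent_sigma P (fun j =>
    <<s \bigcup_(t in `[0, +oo[) sigma_rv (W j t) >>).

(* The filtration of [W], completed by the negligible sets. *)
Definition brownian_filtration (R : realType) (n : nat)
    (d : measure_display) (Omega : measurableType d) (P : probability Omega R)
    (W : 'I_n.+1 -> R -> Omega -> R) (t : R) : set (set Omega) :=
  [set A | exists2 A',
     <<s \bigcup_(j in setT) \bigcup_(s in `[0, t]) sigma_rv (W j s) >> A' &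
     P.-negligible (A `+` A')].

(* [X] is a random element of the path space; the noise being additive, the
   stochastic differential equation is an integral equation for almost every
   sample path. *)
Definition strong_solution (R : realType) (n : nat) (T : R)
    (theta0 : 'rV[R]_n.+1) (d : measure_display) (Omega : measurableType d)
    (P : probability Omega R) (W : 'I_n.+1 -> R -> Omega -> R)
    (phi : 'I_n.+1 -> 'rV[R]_n.+1 -> R) (kappa : R)
    (X : Omega -> torus_path T theta0) : Prop :=
  [/\ (forall A : set (torus_path T theta0), <<s open >> A ->
         measurable (X @^-1` A)),
      (forall t : R, t \in `[0, T] -> forall j,
         sigma_rv (fun w => X w t 0 j) `<=` brownian_filtration P W t) &
      {ae P, forall w, forall t : R, t \in `[0, T] -> forall j,
         X w t 0 j = theta0 0 j
           + (\int[lebesgue_measure]_(s in `[0, t]) phi j (X w s))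
           + Num.sqrt kappa * W j t w}].

(** * Large deviation principles *)

Definition law (R : realType) (d : measure_display) (Omega : measurableType d)
  (P : probability Omega R) (E : Type) (X : Omega -> E) : set E -> \bar R :=
  fun A => P (X @^-1` A).

Definition good_rate_function (R : realType) (E : topologicalType)
    (J : E -> \bar R) : Prop :=
  (forall x, (0 <= J x)%E) /\
  (forall c : R, 0 <= c -> compact [set x | (J x <= c%:E)%E]).

(* The conventions are log 0 = -oo and inf of the empty set = +oo. *)
Definition large_deviation_principle (R : realType) (E : topologicalType)
    (mu : R -> set E -> \bar R) (J : E -> \bar R) : Prop :=
  [/\ good_rate_function J,
      (forall F : set E, closed F ->
         (limf_esup (fun kappa : R => kappa%:E * lne (mu kappa F)) 0^'+
          <= - ereal_inf [set J x | x in F])%E) &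
      (forall O : set E, open O ->
         (- ereal_inf [set J x | x in O]
          <= limf_einf (fun kappa : R => kappa%:E * lne (mu kappa O)) 0^'+)%E)].

(* Main.v *)
(** Subtracting the drift from a path X gives its noise, X - theta0 - int b(X),
    which is sqrt kappa W along the solution.  Let I_N be the energy
    sum |increment|^2 / (2 h) of the noise over the dyadic grid of mesh
    h = T / 2^N.  It increases with N, and its supremum is the Dyson-Dirichlet
    energy: Cauchy-Schwarz gives one inequality, Fatou's lemma applied to the
    difference quotients the other.

    For fixed N, I_N is a function of finitely many independent Gaussian
    variables along the solution, so that P (I_N >= c) decays like exp (- c / kappa),
    while the oscillation of the noise inside the cells of the grid is
    negligible at this scale when N is large, by dyadic chaining.

    The rest is deterministic.  If I_N <= c and the noise oscillates little
    inside the cells, the gradient structure of the drift bounds U along the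
    path, which keeps it away from the collisions and makes it equicontinuous;
    limits of such paths as the mesh goes to 0 have energy at most c.  Hence the
    level sets are compact, and a closed set on which the energy exceeds c
    contains no such path for some small mesh: this is the upper bound.
    For the lower bound, the path is a continuous function of its noise by
    Gronwall's inequality, so that it suffices to force the finitely many
    increments of sqrt kappa W to follow those of a given noise. *)
Require Import Defs.
From HB Require Import structures.
From mathcomp Require Import all_boot all_order all_algebra.
From mathcomp Require Import all_classical all_reals all_analysis.
From mathcomp Require Import measurable_realfun.
From mathcomp Require Import ring lra zify.

Set Implicit Arguments.
Unset Strict Implicit.
Unset Printing Implicit Defensive.

Import Order.TTheory GRing.Theory Num.Theory.
Import numFieldNormedType.Exports.

Local Open Scope classical_set_scope.
Local Open Scope ring_scope.

(** * Absolutely continuous functions *)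

(** The drift can blow up at the collisions, so no global Lipschitz bound turns the noise into the
    path, and the large deviations of Brownian motion cannot simply be transported by a continuous
    map. Estimates on paths are therefore made on a sublevel set of U, where U has uniform first and
    second order bounds, and membership in it has to come from the noise alone. For a random path
    the energy can be bounded on one grid at a time only, since the energies of a Brownian path grow
    without bound as the mesh shrinks; what the grid does not see is the oscillation inside the
    cells. [regular] combines the two with a single small parameter, and all deterministic arguments
    start from it. The other difficulty is the energy itself: the pointwise derivative of a path
    exists only almost everywhere, and its default values elsewhere leave the integrand without
    evident measurability. It is replaced by a measurable density, obtained from Lebesgue-Stieltjes
    measures and the Radon-Nikodym theorem. *)

Definition nonoverlapping (R : realType) (a b : R) (I : finType)
    (u v : I -> R) : Prop :=
  (forall i, a <= u i /\ u i <= v i /\ v i <= b) /\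
  (forall i j, i != j -> v i <= u j \/ v j <= u i).

(** Arbitrary finite index types are convenient because refining each interval by its own partition
    yields a family indexed by dependent pairs. *)
Lemma absolutely_continuous_fin (R : realType) (a b : R) (g : R -> R) :
  absolutely_continuous a b g -> forall e, 0 < e -> exists2 d, 0 < d &
    forall (I : finType) (u v : I -> R), nonoverlapping a b u v ->
      \sum_i (v i - u i) < d -> \sum_i `|g (v i) - g (u i)| < e.
Proof.
move=> ac e e0; have [d d0 H] := ac e e0; exists d => // I u v [h1 h2].
rewrite (reindex (@enum_val I predT))/=; last exact/onW_bij/enum_val_bij.
rewrite [X in _ -> X < _](reindex (@enum_val I predT))/=;
  last exact/onW_bij/enum_val_bij.
apply: H => [i|i j ij]; first exact: h1.
by apply: h2; apply: contra_neq ij => /enum_val_inj.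
Qed.

Lemma itv_partition_nonoverlapping (R : realType) (a b : R) (s : seq R) :
  itv_partition a b s ->
  nonoverlapping a b (fun k : 'I_(size s) => nth b (a :: s) k)
    (fun k : 'I_(size s) => nth b (a :: s) k.+1).
Proof.
move=> [ps /eqP lasts].
have srt : sorted <=%R (a :: s) by apply: (sub_path _ ps) => x y /ltW.
have le m k : (m <= k)%N -> (k < (size s).+1)%N ->
    nth b (a :: s) m <= nth b (a :: s) k.
  by move=> mk ks; apply: (sorted_leq_nth le_trans lexx) => //;
    rewrite inE//= (leq_ltn_trans mk).
have E : nth b (a :: s) (size s) = b by rewrite -last_nth.
split=> [i|i j].
  split; first by apply: (le 0%N) => //; rewrite ltnS ltnW.
  split; first by apply: le => //; rewrite ltnS.
  by rewrite -[leRHS]E; apply: le.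
rewrite neq_ltn => /orP[] ij; [left|right]; apply: le => //; by rewrite ltnS ltnW.
Qed.

Lemma itv_partition_length (R : realType) (a b : R) (s : seq R) :
  itv_partition a b s ->
  \sum_(k < size s) (nth b (a :: s) k.+1 - nth b (a :: s) k) = b - a.
Proof.
move=> [ps /eqP lasts].
rewrite -(big_mkord xpredT (fun k => nth b (a :: s) k.+1 - nth b (a :: s) k)).
rewrite telescope_sumr//=; congr (_ - _).
by rewrite -last_nth.
Qed.

Lemma absolutely_continuousN (R : realType) (a b : R) (f : R -> R) :
  absolutely_continuous a b f -> absolutely_continuous a b (fun x => - f x).
Proof.
move=> F e e0; have [d d0 H] := F e e0; exists d => // m u v h1 h2 h3.
under eq_bigr do rewrite -opprD normrN; exact: H.
Qed.

Lemma absolutely_continuousD (R : realType) (a b : R) (f g : R -> R) :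
  absolutely_continuous a b f -> absolutely_continuous a b g ->
  absolutely_continuous a b (fun x => f x + g x).
Proof.
move=> F G e e0; have e20 : 0 < e / 2 by rewrite divr_gt0.
have [d d0 H] := F _ e20; have [d' d'0 H'] := G _ e20.
exists (Num.min d d'); first by rewrite lt_min d0.
move=> m u v h1 h2; rewrite lt_min => /andP[h3 h4].
rewrite (splitr e); apply: le_lt_trans (ltrD (H _ _ _ h1 h2 h3) (H' _ _ _ h1 h2 h4)).
rewrite -big_split/=; apply: ler_sum => i _.
by rewrite opprD addrACA ler_normD.
Qed.

(** * Total variation of an absolutely continuous function *)

Section ac_variation.
Context {R : realType} (a b : R) (g : R -> R).
Hypotheses (ab : a <= b) (ac : absolutely_continuous a b g).

Let tv := @total_variation R.

(** All the pieces of the partitions together form one nonoverlapping family with the same total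
    length, so the same d serves for sums of variations. *)
Lemma ac_variation_lt (I : finType) (e d : R) :
  (forall (J : finType) (u v : J -> R), nonoverlapping a b u v ->
      \sum_i (v i - u i) < d -> \sum_i `|g (v i) - g (u i)| < e) ->
  forall (u v : I -> R) (s : I -> seq R), nonoverlapping a b u v ->
  \sum_i (v i - u i) < d -> (forall i, itv_partition (u i) (v i) (s i)) ->
  \sum_i variation (u i) (v i) g (s i) < e.
Proof.
move=> H u v s [h1 h2] h3 hs; rewrite /variation.
under eq_bigr do rewrite big_mkord.
rewrite sig_big_dep/=.
apply: (H {i : I & 'I_(size (s i))}
  (fun p => nth (v (tag p)) (u (tag p) :: s (tag p)) (tagged p))
  (fun p => nth (v (tag p)) (u (tag p) :: s (tag p)) (tagged p).+1)).
  split=> [[i k]|[i k] [j l] ne] /=.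
    have [/(_ k)[A1 [A2 A3]] _] := itv_partition_nonoverlapping (hs i).
    have [B1 [B2 B3]] := h1 i.
    by split; [exact: le_trans A1|split => //; exact: le_trans B3].
  have [ij|ij] := eqVneq i j.
    subst j; have [_] := itv_partition_nonoverlapping (hs i); apply.
    by apply: contra_neq ne => ->.
  have [/(_ k)[A1 [A2 A3]] _] := itv_partition_nonoverlapping (hs i).
  have [/(_ l)[B1 [B2 B3]] _] := itv_partition_nonoverlapping (hs j).
  have [C|C] := h2 _ _ ij; [left|right].
    exact: le_trans A3 (le_trans C B1).
  exact: le_trans B3 (le_trans C A1).
rewrite -(sig_big_dep xpredT (fun=> xpredT) (fun i (k : 'I_(size (s i))) =>
  nth (v i) (u i :: s i) k.+1 - nth (v i) (u i :: s i) k))/=.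
by under eq_bigr do rewrite itv_partition_length//.
Qed.

Lemma ac_total_variation1 (e d : R) :
  (forall (J : finType) (u v : J -> R), nonoverlapping a b u v ->
      \sum_i (v i - u i) < d -> \sum_i `|g (v i) - g (u i)| < e) ->
  forall u v, a <= u -> u <= v -> v <= b -> v - u < d ->
  (tv u v g <= e%:E)%E.
Proof.
move=> H u v au uv vb uvd; apply: ge_ereal_sup => _ [_ [s ps <-] <-].
rewrite lee_fin; apply: ltW.
have := @ac_variation_lt unit _ _ H (fun=> u) (fun=> v) (fun=> s).
by rewrite !big_const/= card_unit/= !addr0; apply => //; split=> // -[] [].
Qed.

(** Finitely many intervals of length d / 2 cover the segment, each of variation at most 1; the
    induction removes one of them on the right. *)
Lemma ac_total_variation_fin u v : a <= u -> u <= v -> v <= b ->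
  tv u v g \is a fin_num.
Proof.
have [d d0 H] := absolutely_continuous_fin ac (@ltr01 R).
have H1 := ac_total_variation1 H.
suff K k w : a <= u -> u <= w -> w <= b -> w - u <= (d / 2) *+ k ->
    tv u w g \is a fin_num.
  move=> au uv vb; apply: (K (Num.bound ((v - u) / (d / 2)))) => //.
  rewrite -mulr_natl -ler_pdivrMr ?divr_gt0//; apply: ltW.
  by rewrite archi_boundP// divr_ge0 ?subr_ge0// ltW// divr_gt0.
elim: k w => [|k IH] w au uw wb.
  rewrite mulr0n subr_le0 => wu; have -> : w = u by apply/le_anti; rewrite wu uw.
  by rewrite /tv total_variationxx.
move=> wk; pose w' := Num.max u (w - d / 2).
have uw' : u <= w' by rewrite le_max lexx.
have w'w : w' <= w by rewrite ge_max uw gerBl ltW// divr_gt0.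
rewrite /tv (@total_variationD _ u w w')//= fin_numD; apply/andP; split.
  apply: IH => //; first exact: le_trans wb.
  have dk : 0 <= (d / 2) *+ k by rewrite mulrn_wge0// ltW// divr_gt0.
  by rewrite lerBlDr ge_max lerDr dk/=; move: wk; rewrite mulrSr; lra.
rewrite ge0_fin_numE ?total_variation_ge0//.
apply: le_lt_trans (H1 _ _ _ _ _ _) (ltry _) => //.
  exact: le_trans uw'.
have : w - d / 2 <= w' by rewrite le_max lexx orbT.
lra.
Qed.

Lemma absolutely_continuous_total_variation :
  absolutely_continuous a b (fun t => fine (tv a t g)).
Proof.
move=> e e0; have e20 : 0 < e / 3 by rewrite divr_gt0.
have [d d0 H] := absolutely_continuous_fin ac e20; exists d => // m u v h1 h2 h3.
have fin i : tv (u i) (v i) g \is a fin_num.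
  by have [? [? ?]] := h1 i; exact: ac_total_variation_fin.
have E i : `|fine (tv a (v i) g) - fine (tv a (u i) g)| = fine (tv (u i) (v i) g).
  have [? [? ?]] := h1 i.
  rewrite /tv (@total_variationD _ a (v i) (u i))// fineD//; last first.
    by apply: ac_total_variation_fin => //; apply: (@le_trans _ _ (v i)).
  rewrite addrAC subrr add0r ger0_norm// fine_ge0// total_variation_ge0//.
under eq_bigr do rewrite E.
(* Each variation is approximated by a partition up to eta; the m errors add up to at most e / 3,
   and [m.+1] also covers m = 0. *)
pose eta : R := e / 3 / m.+1%:R.
have eta0 : 0 < eta by rewrite divr_gt0.
have /choice[s hs] : forall i, exists s, itv_partition (u i) (v i) s /\
    fine (tv (u i) (v i) g) - eta <= variation (u i) (v i) g s.
  move=> i; have [_ [uv _]] := h1 i.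
  have [z [_ [s ps <-] <-] hz] := ub_ereal_sup_adherent eta0 (fin i).
  exists s; split => //; apply/ltW; rewrite -lte_fin EFinB fineK//.
apply: (@le_lt_trans _ _ (\sum_i (variation (u i) (v i) g (s i) + eta))).
  by apply: ler_sum => i _; rewrite -lerBlDr; have [] := hs i.
rewrite big_split/= sumr_const card_ord.
have := @ac_variation_lt 'I_m _ _ H u v s (conj h1 h2) h3 (fun i => (hs i).1).
have : eta *+ m <= e / 3.
  rewrite /eta; move: (e / 3) e20 => x x0.
  by rewrite -[leLHS]mulr_natr mulrAC ler_pdivrMr// ler_pM2l// ler_nat leqnSn.
lra.
Qed.

Lemma ac_total_variation_homo :
  {in `[a, b] &, {homo (fun t => fine (tv a t g)) : x y / x <= y}} /\
  {in `[a, b] &, {homo (fun t => fine (tv a t g) - g t) : x y / x <= y}}.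
Proof.
suff K x y : x \in `[a, b] -> y \in `[a, b] -> x <= y ->
    `|g y - g x| <= fine (tv a y g) - fine (tv a x g).
  split => x y xab yab xy; have := K x y xab yab xy; first by
    rewrite -subr_ge0; apply: le_trans.
  by have := ler_norm (g y - g x); lra.
rewrite !in_itv/= => /andP[ax xb] /andP[ay yb] xy.
rewrite /tv (@total_variationD _ a y x)// fineD; last 2 first.
  exact: ac_total_variation_fin.
  exact: ac_total_variation_fin.
rewrite addrAC subrr add0r -lee_fin fineK; last exact: ac_total_variation_fin.
exact: total_variation_ge.
Qed.

End ac_variation.

(** * Dyadic grids of [0, T] *)

Section dyadic.
Context {R : realType} (T : R).
Hypothesis T0 : 0 < T.

Definition dyad (N i : nat) : R := T * i%:R / 2 ^+ N.

(** At t = T this is 2 ^ N, one more than the index of the last cell; hence the separate treatment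
    of the right end in later proofs. *)
Definition dyad_floor (N : nat) (t : R) : nat := Num.truncn (t * 2 ^+ N / T).

Lemma dyad0 N : dyad N 0 = 0. Proof. by rewrite /dyad mulr0 mul0r. Qed.

Lemma dyad_ge0 N i : 0 <= dyad N i.
Proof. by rewrite /dyad divr_ge0 ?mulr_ge0// ?exprn_ge0// ltW. Qed.

Lemma dyad_last N : dyad N (2 ^ N) = T.
Proof. by rewrite /dyad natrX mulfK// expf_neq0// pnatr_eq0. Qed.

Lemma dyadS N i : dyad N i.+1 = dyad N i + T / 2 ^+ N.
Proof. by rewrite /dyad -natr1 mulrDr mulr1 mulrDl. Qed.

Lemma dyad_double N i : dyad N.+1 i.*2 = dyad N i.
Proof.
rewrite /dyad -muln2 natrM exprS invfM.
have h : (2 : R) != 0 by rewrite pnatr_eq0.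
rewrite (_ : _ * _ = T * i%:R * (2 ^+ N)^-1 * (2 / 2)); last by ring.
by rewrite mulfV// mulr1.
Qed.

Lemma dyad_le N i j : (i <= j)%N -> dyad N i <= dyad N j.
Proof.
move=> ij; rewrite /dyad ler_wpM2r ?invr_ge0 ?exprn_ge0// ler_wpM2l ?(ltW T0)//.
by rewrite ler_nat.
Qed.

Lemma dyad_leT N i : (i <= 2 ^ N)%N -> dyad N i <= T.
Proof. by move=> /(dyad_le N); rewrite dyad_last. Qed.

Lemma dyad_step_gt0 N : 0 < T / 2 ^+ N.
Proof. by rewrite divr_gt0 ?exprn_gt0. Qed.

Lemma dyad_step_cvg (e : R) : 0 < e -> exists N0, forall N, (N0 <= N)%N ->
  T / 2 ^+ N < e.
Proof.
move=> e0; exists (Num.bound (T / e)) => N hN.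
rewrite ltr_pdivrMr ?exprn_gt0// mulrC -ltr_pdivrMr//.
apply: lt_le_trans (archi_boundP _) _; first by rewrite divr_ge0 ?ltW.
rewrite -natrX ler_nat (leq_trans hN)// ltnW// ltn_expl//.
Qed.

Lemma dyad_floorP N t : 0 <= t ->
  dyad N (dyad_floor N t) <= t < dyad N (dyad_floor N t).+1.
Proof.
move=> t0; have h : 0 <= t * 2 ^+ N / T by rewrite divr_ge0 ?mulr_ge0 ?exprn_ge0 ?(ltW T0).
have /andP[h1 h2] := truncn_itv h.
rewrite /dyad ler_pdivrMr ?exprn_gt0// ltr_pdivlMr ?exprn_gt0//.
by move: h1 h2; rewrite -/(dyad_floor N t) ler_pdivlMr// ltr_pdivrMr// ![_ * T]mulrC => -> ->.
Qed.

Lemma dyad_floor_le N t : t <= T -> (dyad_floor N t <= 2 ^ N)%N.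
Proof.
move=> tT; have -> : (2 ^ N)%N = dyad_floor N T.
  by rewrite /dyad_floor mulrAC mulfV ?gt_eqF// mul1r -natrX natrK.
apply: le_truncn.
by rewrite ler_pM2r ?invr_gt0// ler_pM2r// exprn_gt0.
Qed.

Lemma dyad_floorE N t i : dyad N i <= t < dyad N i.+1 -> dyad_floor N t = i.
Proof.
move=> /andP[h1 h2]; apply: truncn_def.
rewrite ler_pdivlMr// ltr_pdivrMr// ![_ * T]mulrC.
by rewrite -ler_pdivrMr ?exprn_gt0// -ltr_pdivlMr ?exprn_gt0// h1 h2.
Qed.

Lemma dyad_floor_homo N s t : s <= t -> (dyad_floor N s <= dyad_floor N t)%N.
Proof.
move=> st; apply: le_truncn.
by rewrite ler_pM2r ?invr_gt0// ler_pM2r// exprn_gt0.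
Qed.

Lemma dyad_floorS N t : 0 <= t ->
  dyad_floor N.+1 t = (dyad_floor N t).*2 \/
  dyad_floor N.+1 t = (dyad_floor N t).*2.+1.
Proof.
move=> t0; have /andP[h1 h2] := dyad_floorP N t0.
have [h|h] := ltP t (dyad N.+1 (dyad_floor N t).*2.+1); [left|right];
  apply: dyad_floorE; first by rewrite dyad_double h1.
by rewrite h/= -doubleS dyad_double.
Qed.

Lemma dyad_floor_cvg t : 0 <= t ->
  dyad N (dyad_floor N t) @[N --> \oo] --> t.
Proof.
move=> t0; apply/cvgrPdist_lt => e e0; have [N0 h] := dyad_step_cvg e0.
near=> N; have /andP[h1 h2] := dyad_floorP N t0.
rewrite ger0_norm ?subr_ge0//; apply: (lt_le_trans _ (ltW (h N _))).
  by rewrite ltrBlDl -dyadS.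
by near: N; exists N0.
Unshelve. all: by end_near. Qed.

End dyadic.

Lemma ler_dist_min (R : realDomainType) (T x y : R) :
  `|Num.min x T - Num.min y T| <= `|x - y|.
Proof.
have := ler_norm (x - y); have := ler_norm (y - x); rewrite distrC ler_norml.
by case: (leP x T) => ?; case: (leP y T) => ? ? ?; apply/andP; split; lra.
Qed.

Lemma ler_dist_max0 (R : realDomainType) (x y : R) :
  `|Num.max 0 x - Num.max 0 y| <= `|x - y|.
Proof.
have := ler_norm (x - y); have := ler_norm (y - x); rewrite distrC ler_norml.
by case: (leP 0 x) => ?; case: (leP 0 y) => ? ? ?; apply/andP; split; lra.
Qed.

(** * Density of a monotone absolutely continuous function *)

Section monotone_ac.
Context {R : realType} (T : R).
Hypothesis T0 : 0 < T.
Local Notation mu := (@lebesgue_measure R).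

(** Open on the left and closed on the right, like the intervals whose Stieltjes measure is an
    increment. *)
Definition dyadic_cell (N i : nat) : set R := `]dyad T N i, dyad T N i.+1]%classic.

Definition inner_cells (O : set R) (N : nat) : {pred 'I_(2 ^ N)} :=
  fun i => `[< dyadic_cell N i `<=` O >].
Arguments inner_cells : clear implicits.

(** This replaces the decomposition of an open set into countably many intervals: at each level
    there are finitely many disjoint cells, to which absolute continuity applies directly, and their
    union increases with the level. *)
Lemma dyadic_inner_approx (O : set R) : open O ->
  O `&` `]0, T] =
  \bigcup_N \bigcup_(i in [set` inner_cells O N]) dyadic_cell N i.
Proof.
move=> oO; apply/seteqP; split=> [t [Ot /=]|t [N _ [i /= /asboolP iO it]]].
  rewrite in_itv/= => /andP[t0 tT].
  have /nbhs_ballP[e /= e0 He] : nbhs t O by exact: open_nbhs_nbhs.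
  have [N hN] := dyad_step_cvg T0 e0; have {}hN := hN N (leqnn N).
  have [k [kN /andP[k1 k2]]] : exists k, (k < 2 ^ N)%N /\ dyad T N k < t <= dyad T N k.+1.
    have /andP[f1 f2] := dyad_floorP T0 N (ltW t0).
    move: f1; rewrite le_eqVlt => /orP[/eqP f1|f1]; last first.
      exists (dyad_floor T N t); rewrite f1 (ltW f2); split => //.
      rewrite ltn_neqAle dyad_floor_le// andbT; apply/eqP => E.
      by move: f1; rewrite E dyad_last// ltNge tT.
    (* Here t is itself a grid point, which belongs to the cell on its left. *)
    have k0 : (0 < dyad_floor T N t)%N.
      by rewrite lt0n; apply/eqP => E; move: f1 t0; rewrite E dyad0 => <-; rewrite ltxx.
    exists (dyad_floor T N t).-1; rewrite prednK// dyad_floor_le//; split => //.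
    by rewrite -[X in X <= _]f1 lexx andbT -[X in _ < X]f1 -[X in _ < dyad _ _ X](prednK k0) dyadS ltrDl dyad_step_gt0.
  exists N => //; exists (Ordinal kN); last by rewrite /dyadic_cell /= in_itv/= k1.
  apply/asboolP => s; rewrite /dyadic_cell /= in_itv/= => /andP[s1 s2]; apply: He => /=.
  rewrite /ball/= ltr_norml; move: s2 k2 hN; rewrite dyadS.
  by move: (T / 2 ^+ N) => h s2 k2 hN; apply/andP; split; lra.
split; first exact: iO.
move: it; rewrite /dyadic_cell /= !in_itv/= => /andP[i1 i2]; apply/andP; split.
  exact: le_lt_trans (dyad_ge0 T0 _ _) i1.
exact: le_trans i2 (dyad_leT T0 (ltn_ord i)).
Qed.

Lemma inner_cells_homo (O : set R) (N M : nat) : (N <= M)%N ->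
  \bigcup_(i in [set` inner_cells O N]) dyadic_cell N i `<=`
  \bigcup_(i in [set` inner_cells O M]) dyadic_cell M i.
Proof.
elim: M => [|M IH]; first by rewrite leqn0 => /eqP ->.
rewrite leq_eqVlt => /predU1P[->//|/IH/subset_trans]; apply.
move=> t [i /= /asboolP iO].
rewrite /dyadic_cell /= in_itv/= => /andP[t1 t2].
have [h|h] := leP t (dyad T M.+1 i.*2.+1).
- have iM : (i.*2 < 2 ^ M.+1)%N by rewrite expnS mul2n ltn_double.
  exists (Ordinal iM) => /=; last by rewrite in_itv/= dyad_double t1 h.
  apply/asboolP => s; rewrite /dyadic_cell /= in_itv/= dyad_double => /andP[s1 s2].
  apply: iO; rewrite /dyadic_cell /= in_itv/= s1 (le_trans s2)//.
  by rewrite -(dyad_double T M i.+1) doubleS; exact: dyad_le.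
- have iM : (i.*2.+1 < 2 ^ M.+1)%N by rewrite expnS mul2n ltn_Sdouble.
  exists (Ordinal iM) => /=; last by rewrite in_itv/= h -doubleS dyad_double.
  apply/asboolP => s; rewrite /dyadic_cell /= in_itv/= -doubleS dyad_double => /andP[s1 s2].
  apply: iO; rewrite /dyadic_cell /= in_itv/= s2 andbT (le_lt_trans _ s1)//.
  by rewrite -(dyad_double T M i); exact: dyad_le.
Qed.

Lemma dyadic_cell_trivIset N :
  trivIset setT (fun i : 'I_(2 ^ N) => dyadic_cell N i).
Proof.
move=> i j _ _ [t []]; rewrite /dyadic_cell /= !in_itv/= => /andP[i1 i2] /andP[j1 j2].
have [ij|ji|/val_inj//] := ltngtP (val i) (val j).
  by have := le_lt_trans (le_trans i2 (dyad_le T0 N ij)) j1; rewrite ltxx.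
by have := le_lt_trans (le_trans j2 (dyad_le T0 N ji)) i1; rewrite ltxx.
Qed.

Lemma dyadic_nonoverlapping N (A : {pred 'I_(2 ^ N)}) :
  nonoverlapping 0 T (fun i : {i : 'I_(2 ^ N) | i \in A} => dyad T N (val i))
     (fun i : {i : 'I_(2 ^ N) | i \in A} => dyad T N (val i).+1).
Proof.
split=> [i|i j ij].
  by rewrite dyad_ge0// dyad_leT// dyad_le.
have : val (val i) != val (val j) by apply: contra_neq ij => /val_inj/val_inj.
by rewrite neq_ltn => /orP[] h; [left|right]; exact: dyad_le.
Qed.

Variable v : R -> R.
Hypothesis v_homo : {in `[0, T] &, {homo v : x y / x <= y}}.
Hypothesis v_ac : absolutely_continuous 0 T v.

Let clamp (t : R) : R := Num.max 0 (Num.min t T).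

Let clampP t : clamp t \in `[0, T].
Proof.
by rewrite in_itv/= /clamp le_max lexx/= ge_max (ltW T0) ge_min lexx orbT.
Qed.

Let clampE t : t \in `[0, T] -> clamp t = t.
Proof.
by rewrite in_itv/= => /andP[t0 tT]; rewrite /clamp (min_idPl tT) (max_idPr t0).
Qed.

(** A Stieltjes measure requires a monotone function on the whole line, so v is continued by
    constants. *)
Let vbar (t : R) : R := v (clamp t).

Let vbar_homo : {homo vbar : x y / x <= y}.
Proof.
move=> x y xy; apply: v_homo => //.
rewrite /clamp ge_max le_max lexx/= le_max; apply/orP; right.
by rewrite le_min !ge_min xy lexx !orbT.
Qed.

Let vbar_rc : right_continuous vbar.
Proof.
apply: right_continuousW => x; apply/cvgrPdist_lt => e e0.
have [d d0 H] := v_ac e0.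
have K p q : `|clamp p - clamp q| < d -> clamp q <= clamp p ->
    `|v (clamp p) - v (clamp q)| < e.
  move=> cl le; move: (clampP p) (clampP q).
  rewrite !in_itv/= => /andP[a1 a2] /andP[b1 b2].
  have := H 1%N (fun=> clamp q) (fun=> clamp p).
  rewrite !big_ord1; apply => //.
    by move=> i j; rewrite !ord1.
  by rewrite ger0_norm ?subr_ge0 in cl.
near=> y.
have xy : `|x - y| < d by near: y; exact: (nbhsx_ballx x d d0).
have cl : `|clamp x - clamp y| < d.
  by apply: le_lt_trans xy; apply: le_trans (ler_dist_max0 _ _) (ler_dist_min _ _ _).
have [|/ltW] := leP (clamp y) (clamp x); first exact: K.
by move=> h; rewrite distrC; apply: K => //; rewrite distrC.
Unshelve. all: by end_near. Qed.

HB.instance Definition _ := isCumulative.Build R _ _ vbar vbar_homo vbar_rc.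

Let ls := lebesgue_stieltjes_measure (vbar : cumulative R R).

Let ls_itv (a b : R) : a <= b -> ls `]a, b] = (vbar b - vbar a)%:E.
Proof.
move=> ab.
rewrite /ls /lebesgue_stieltjes_measure /measure_extension/= measurable_mu_extE//=.
  by rewrite wlength_itv_bnd.
exact: is_ocitv.
Qed.

Let ls_fin : (ls `]0%R, T]%classic < +oo)%E.
Proof. by rewrite ls_itv ?ltW// ltry. Qed.

Let mD : measurable (`]0, T]%classic : set (measurableTypeR R)).
Proof. exact: measurable_itv. Qed.

Let nu : {finite_measure set (measurableTypeR R) -> \bar R} :=
  mfrestr mD ls_fin.

Let mcell N i : measurable (dyadic_cell N i).
Proof. exact: measurable_itv. Qed.

(** Outer regularity puts a null set into an open set O of length less than d. Absolute continuity
    bounds the Stieltjes measure of the cells inside O by e at every level, and these cells increase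
    to the part of O in ]0, T]. *)
Let nu_dominated : nu `<< mu.
Proof.
apply/null_content_dominatesP => A mA A0.
apply/eqP; rewrite eq_le measure_ge0 andbT.
apply/lee_addgt0Pr => e e0; rewrite add0e.
have [d d0 H] := absolutely_continuous_fin v_ac e0.
have [|O [oO AO Od]] := lebesgue_regularity_outer mA _ d0; first by rewrite A0.
have mO : measurable O by exact: open_measurable.
have muO : (mu O < d%:E)%E.
  rewrite (_ : O = A `|` (O `\` A)); last by rewrite setDUK.
  apply: le_lt_trans (measureU2 _ _ _) _ => //; first exact: measurableD.
  by rewrite A0 add0e.
apply: (@le_trans _ _ (ls (O `&` `]0, T]))).
  change (ls ((A : set (measurableTypeR R)) `&` `]0%R, T]%classic) <=
    ls ((O : set (measurableTypeR R)) `&` `]0%R, T]%classic))%E.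
  apply: le_measure; last exact: setSI.
    by rewrite inE; exact: (measurableI _ _ mA mD).
  by rewrite inE; exact: (measurableI _ _ mO mD).
pose F N : set (measurableTypeR R) :=
  \bigcup_(i in [set` inner_cells O N]) dyadic_cell N i.
have mF N : measurable (F N) by apply: fin_bigcup_measurable => // i _; exact: mcell.
have FE (m : {measure set (measurableTypeR R) -> \bar R}) N :
    m (F N) = (\sum_(i < 2 ^ N | i \in inner_cells O N) m (dyadic_cell N i))%E.
  rewrite /F bigcup_pred measure_bigsetU_ord_cond//.
    by move=> i _; exact: mcell.
  exact: sub_trivIset (@dyadic_cell_trivIset N).
rewrite dyadic_inner_approx//.
have cv : ls (F N) @[N --> \oo] --> ls (\bigcup_N F N).
  apply: nondecreasing_cvg_mu; [exact: mF| |].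
    by apply: bigcup_measurable => i _; exact: mF.
  by move=> n m nm; apply/subsetPset; exact: inner_cells_homo.
rewrite -(cvg_lim _ cv)//; apply: lime_le; first by apply/cvg_ex; exists (ls (\bigcup_N F N)).
apply: nearW => N.
have -> : ls (F N) = (\sum_(i < 2 ^ N | i \in inner_cells O N)
    ls (dyadic_cell N i))%E by exact: FE.
have cellE i : (i < 2 ^ N)%N ->
    ls (dyadic_cell N i) = (`|v (dyad T N i.+1) - v (dyad T N i)|)%:E.
  move=> iN; have d1 : dyad T N i <= dyad T N i.+1 by exact: dyad_le.
  have i1 : dyad T N i \in `[0, T] by rewrite in_itv/= dyad_ge0 ?dyad_leT// ltnW.
  have i2 : dyad T N i.+1 \in `[0, T] by rewrite in_itv/= dyad_ge0 ?dyad_leT.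
  rewrite /dyadic_cell ls_itv// /vbar !clampE// ger0_norm// subr_ge0.
  exact: v_homo.
rewrite (eq_bigr (fun i : 'I_(2 ^ N) => (`|v (dyad T N i.+1) - v (dyad T N i)|)%:E)); last by move=> i _; exact: cellE.
rewrite sumEFin lee_fin big_sub; apply/ltW/H; first exact: dyadic_nonoverlapping.
rewrite -(big_sub (inner_cells O N) (fun i : 'I_(2 ^ N) => dyad T N i.+1 - dyad T N i)).
rewrite -lte_fin -sumEFin; apply: le_lt_trans muO.
rewrite (_ : (\sum_(i | _) _)%E = mu (F N)).
  apply: (@le_measure _ (measurableTypeR R) _ lebesgue_measure (F N) O).
  - by rewrite inE; exact: mF.
  - by rewrite inE; exact: mO.
  by move=> t [i /= /asboolP]; apply.
have -> : mu (F N) = (\sum_(i < 2 ^ N | i \in inner_cells O N)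
    mu (dyadic_cell N i))%E by exact: FE.
apply: eq_bigr => i _.
rewrite /dyadic_cell lebesgue_measure_itv/= lte_fin dyadS ltrDl dyad_step_gt0//.
Qed.

Lemma monotone_ac_integral : exists2 f : R -> R,
  mu.-integrable setT (EFin \o f) &
  forall t, t \in `[0, T] -> v t - v 0 = \int[mu]_(s in `[0, t]) f s.
Proof.
pose h := Radon_Nikodym_SigmaFinite.f nu mu.
have hfin := Radon_Nikodym_SigmaFinite.f_fin_num nu_dominated.
have hint := Radon_Nikodym_SigmaFinite.f_integrable nu_dominated.
have hE := Radon_Nikodym_SigmaFinite.f_integral nu_dominated.
exists (fine \o h).
  by apply: eq_integrable hint => // x _; rewrite /= fineK.
move=> t t0T; apply: EFin_inj; move: (t0T); rewrite in_itv/= => /andP[t0 tT].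
rewrite /Rintegral fineK; last first.
  apply: integrable_fin_num => //.
  apply: (integrableS measurableT) => //.
  by apply: eq_integrable hint => // x _; rewrite /= fineK.
rewrite (eq_integral h); last by move=> x _; rewrite /= fineK.
rewrite -hE//= /mfrestr /mrestr.
(* The measure is restricted to ]0, T], so the endpoint 0 drops out. *)
rewrite (_ : _ `&` _ = `]0, t]%classic); last first.
  apply/seteqP; split=> s /=; rewrite !in_itv/=; last first.
    by move=> /andP[s0 st]; rewrite s0 st (ltW s0) (le_trans st).
  by move=> [/andP[_ ->] /andP[-> _]].
by rewrite [RHS]ls_itv// /vbar !clampE// in_itv/= lexx ltW.
Qed.

End monotone_ac.

(* The total variation splits an absolutely continuous function into two
   monotone ones, whose Lebesgue-Stieltjes measures have densities. *)
Theorem absolutely_continuous_integral (R : realType) (T : R) (g : R -> R) :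
  0 < T -> absolutely_continuous 0 T g -> exists2 f : R -> R,
  lebesgue_measure.-integrable setT (EFin \o f) &
  forall s t, 0 <= s -> s <= t -> t <= T ->
    g t - g s = \int[lebesgue_measure]_(r in `[s, t]) f r.
Proof.
move=> T0 ac; pose V t := fine (total_variation 0 t g).
have [V1 V2] := ac_total_variation_homo ac.
have acV : absolutely_continuous 0 T V.
  exact: absolutely_continuous_total_variation.
have acVg : absolutely_continuous 0 T (fun t => V t - g t).
  by apply: absolutely_continuousD => //; exact: absolutely_continuousN.
have [f1 if1 Ef1] := monotone_ac_integral T0 V1 acV.
have [f2 if2 Ef2] := monotone_ac_integral T0 V2 acVg.
pose f t := f1 t - f2 t.
have intf : lebesgue_measure.-integrable setT (EFin \o f).
  rewrite (_ : EFin \o f = (EFin \o f1) \- (EFin \o f2))%E; last exact/funext.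
  exact: integrableB.
have E0 t : t \in `[0, T] -> g t - g 0 = \int[lebesgue_measure]_(r in `[0, t]) f r.
  move=> tT; rewrite RintegralB//; last 2 first.
    exact: integrableS if1.
    exact: integrableS if2.
  by rewrite -Ef1// -Ef2//; ring.
exists f => // s t s0 st tT.
have -> : g t - g s = (g t - g 0) - (g s - g 0) by ring.
rewrite !E0 ?in_itv/= ?s0 ?(le_trans s0) ?(le_trans st)//.
rewrite -(@Rintegral_itv_obnd_cbnd _ s) //.
  rewrite -(@Rintegral_itvB _ _ (BLeft 0) (BRight t))//.
  exact: integrableS intf.
exact: integrableS intf.
Qed.

(** * Energy as a supremum over dyadic grids *)

Section nonmeasurable.
Context d (X : measurableType d) (R : realType) (mu : {measure set X -> \bar R}).
Local Open Scope ereal_scope.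

(** The integral of a nonnegative function is a supremum over the simple functions below it, which
    is monotone whether or not the function is measurable. *)
Lemma ge0_le_integral_nomeas (D : set X) (f g : X -> \bar R) :
  (forall x, D x -> 0 <= f x) -> (forall x, D x -> f x <= g x) ->
  \int[mu]_(x in D) f x <= \int[mu]_(x in D) g x.
Proof.
move=> f0 fg; rewrite !ge0_integralE//=; last first.
  by move=> x Dx; exact: le_trans (f0 _ Dx) (fg _ Dx).
apply: le_ereal_sup => _ [h /= hf <-]; exists h => // x.
apply: le_trans (hf x) _; rewrite /patch; case: ifP => //; rewrite inE.
exact: fg.
Qed.

Lemma ge0_ae_eq_integral_nomeas (D : set X) (f g : X -> \bar R) :
  measurable D -> measurable_fun D g ->
  (forall x, D x -> 0 <= f x) -> (forall x, D x -> 0 <= g x) ->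
  {ae mu, forall x, D x -> f x = g x} ->
  \int[mu]_(x in D) f x = \int[mu]_(x in D) g x.
Proof.
move=> mD mg f0 g0 [N [mN N0 subN]].
have fgN x : D x -> ~ N x -> f x = g x.
  by move=> Dx; apply: contra_notP => h; apply: subN => /(_ Dx).
(* Setting g to +oo or to 0 on the null set gives measurable bounds of f from above and below, both
   with the integral of g. *)
pose ext (c : \bar R) x := if x \in N then c else g x.
have mext c : measurable_fun D (ext c).
  rewrite (_ : D = (D `&` N) `|` (D `\` N)); last by rewrite setUIDK.
  apply/measurable_funU; [exact: measurableI|exact: measurableD|split].
    apply: (eq_measurable_fun (cst c)); last exact: measurable_cst.
    by move=> x; rewrite inE => -[_ Nx]; rewrite /ext mem_set.
  apply: (eq_measurable_fun g).
    by move=> x; rewrite inE => -[_ Nx]; rewrite /ext memNset.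
  by apply: measurable_funS mg => // x [].
have extE c : 0 <= c -> \int[mu]_(x in D) ext c x = \int[mu]_(x in D) g x.
  move=> c0; apply: ge0_ae_eq_integral => //.
    by move=> x Dx; rewrite /ext; case: ifP => // _; exact: g0.
  exists N; split => // x /= h; apply: contrapT => Nx; apply: h => _.
  by rewrite /ext memNset.
apply/eqP; rewrite eq_le; apply/andP; split.
  rewrite -(extE +oo)//; apply: ge0_le_integral_nomeas => // x Dx.
  by rewrite /ext; case: ifPn => [_|/negP]; rewrite ?leey// inE => /(fgN _ Dx) ->.
rewrite -(extE 0)//; apply: ge0_le_integral_nomeas => x Dx; rewrite /ext.
  by case: ifP => // _; exact: g0.
by case: ifPn => [_|/negP]; [exact: f0|rewrite inE => /(fgN _ Dx) ->].
Qed.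

End nonmeasurable.

Lemma cvg_sumr (R : realType) (I : finType) (S : Type) (F : set_system S) {FF : Filter F}
    (f : I -> S -> R) (l : I -> R) :
  (forall i, f i x @[x --> F] --> l i) -> (\sum_i f i x) @[x --> F] --> \sum_i l i.
Proof. by move=> h; apply: cvg_big => //; exact: add_continuous. Qed.

(** * Dyadic energies and the moduli of continuity they give *)

Section dyadic_energy.
Context {R : realType} (T : R).
Hypothesis T0 : 0 < T.

Definition dyadic_energy (N : nat) (u : R -> R) : R :=
  \sum_(i < 2 ^ N) (u (dyad T N i.+1) - u (dyad T N i)) ^+ 2 / (T / 2 ^+ N).

Lemma dyadic_energy_ge0 N u : 0 <= dyadic_energy N u.
Proof. by apply: sumr_ge0 => i _; rewrite divr_ge0 ?sqr_ge0// ltW// dyad_step_gt0. Qed.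

Lemma sum_double (F : nat -> R) n :
  \sum_(i < n.*2) F i = \sum_(i < n) (F i.*2 + F i.*2.+1).
Proof.
elim: n => [|n IH]; first by rewrite !big_ord0.
by rewrite doubleS !big_ord_recr/= IH addrA.
Qed.

(** Halving a cell splits its increment into x + y, and (x + y)^2 <= 2 (x^2 + y^2). *)
Lemma dyadic_energyS N u : dyadic_energy N u <= dyadic_energy N.+1 u.
Proof.
rewrite /dyadic_energy expnS mul2n.
rewrite (sum_double (fun i => (u (dyad T N.+1 i.+1) - u (dyad T N.+1 i)) ^+ 2 / (T / 2 ^+ N.+1))).
apply: ler_sum => i _; rewrite -doubleS !dyad_double -mulrDl.
have -> : (T / 2 ^+ N.+1)^-1 = 2 * (T / 2 ^+ N)^-1 by rewrite !invf_div exprS; ring.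
rewrite mulrA ler_pM2r ?invr_gt0 ?dyad_step_gt0//.
move: (u _) (u _) (u _) => a b c.
have := sqr_ge0 (2 * a - b - c); rewrite !expr2; lra.
Qed.

Lemma dyadic_energy_homo u N M : (N <= M)%N -> dyadic_energy N u <= dyadic_energy M u.
Proof.
elim: M => [|M IH]; first by rewrite leqn0 => /eqP ->.
rewrite leq_eqVlt => /predU1P[->//|/IH/le_trans]; apply; exact: dyadic_energyS.
Qed.

Lemma young (x l : R) : 0 < l -> `|x| <= 2^-1 * (l + x ^+ 2 / l).
Proof.
move=> l0; have : 0 <= (`|x| - l) ^+ 2 / l by rewrite divr_ge0 ?sqr_ge0// ltW.
rewrite sqrrB real_normK ?num_real//.
have -> : (x ^+ 2 - `|x| * l *+ 2 + l ^+ 2) / l = x ^+ 2 / l - 2 * `|x| + l.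
  by field; rewrite gt_eqF.
lra.
Qed.

(** Young's inequality with weight l h on each cell of mesh h; since the intervals do not overlap,
    each cell is counted at most once. The parameter l is left free, to be chosen large when the
    lengths are small. *)
Lemma dyadic_increments_young (I : finType) N u (a b : I -> nat) (l : R) :
  0 < l -> (forall i, (a i <= b i)%N /\ (b i <= 2 ^ N)%N) ->
  (forall i j, i != j -> (b i <= a j)%N \/ (b j <= a i)%N) ->
  \sum_i `|u (dyad T N (b i)) - u (dyad T N (a i))| <=
  2^-1 * (l * \sum_i (dyad T N (b i) - dyad T N (a i)) + dyadic_energy N u / l).
Proof.
move=> l0 h1 h2; set h := T / 2 ^+ N; have h0 : 0 < h := dyad_step_gt0 T0 N.
pose D (k : nat) := u (dyad T N k.+1) - u (dyad T N k).
have tel (v : nat -> R) i : v (b i) - v (a i) =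
    \sum_(k < 2 ^ N | (a i <= k < b i)%N) (v k.+1 - v k).
  have [ab bN] := h1 i.
  rewrite -(big_mkord (fun k => a i <= k < b i)%N (fun k => v k.+1 - v k)).
  rewrite (big_cat_nat (n := b i))//= [X in _ = _ + X]big1_seq ?addr0; last first.
    by move=> k; rewrite mem_index_iota => /and3P[/andP[_ kb] bk _]; move: kb; rewrite ltnNge bk.
  rewrite (big_cat_nat (n := a i))//= [X in _ = X + _]big1_seq ?add0r; last first.
    by move=> k; rewrite mem_index_iota => /and3P[/andP[ak _] _ ka]; move: ak; rewrite leqNgt ka.
  rewrite -telescope_sumr// [RHS]big_nat_cond [LHS]big_nat_cond.
  by apply: eq_bigl => k; case: (a i <= k)%N; case: (k < b i)%N.
apply: (@le_trans _ _ (\sum_i \sum_(k < 2 ^ N | (a i <= k < b i)%N)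
    (2^-1 * (l * h) + 2^-1 * (D k ^+ 2 / h / l)))).
  apply: ler_sum => i _; rewrite (tel (u \o dyad T N))/=.
  apply: le_trans (ler_norm_sum _ _ _) _; apply: ler_sum => k _.
  rewrite -mulrDr; apply: le_trans (young _ (mulr_gt0 l0 h0)) _.
  rewrite -/(D k) [leRHS]mulrDr [leLHS]mulrDr lerD2l ler_pM2l ?invr_gt0//.
  by rewrite invfM (mulrC l^-1) mulrA.
under eq_bigr do rewrite big_split/=.
rewrite big_split/= mulrDr; apply: lerD.
  rewrite mulr_sumr mulr_sumr; apply: ler_sum => i _.
  rewrite (tel (dyad T N)) mulr_sumr mulr_sumr; apply: ler_sum => k _.
  by rewrite dyadS addrAC subrr add0r.
under eq_bigr do rewrite big_mkcond/=.
rewrite exchange_big/= /dyadic_energy mulr_suml mulr_sumr; apply: ler_sum => k _.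
rewrite -big_mkcond/= sumr_const -[leRHS]mulr1n ler_wpMn2l//.
  by rewrite mulr_ge0 ?invr_ge0// !divr_ge0 ?sqr_ge0// ltW.
rewrite leqNgt; apply/negP => /card_gt1P[i [j []]].
rewrite !unfold_in => /andP[i1 i2] /andP[j1 j2] ij.
have [H|H] := h2 _ _ ij; lia.
Qed.

(** Exactly the continuity that carries an estimate from grid points to arbitrary times. *)
Definition dyadic_continuous (u : R -> R) : Prop := forall t, 0 <= t <= T ->
  u (dyad T N (dyad_floor T N t)) @[N --> \oo] --> u t.

Lemma energy_young (u : R -> R) (E : R) : dyadic_continuous u ->
  (forall N, dyadic_energy N u <= E) ->
  forall (I : finType) (a b : I -> R), nonoverlapping 0 T a b -> forall l, 0 < l ->
  \sum_i `|u (b i) - u (a i)| <= 2^-1 * (l * \sum_i (b i - a i) + E / l).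
Proof.
move=> cu hE I a b [h1 h2] l l0.
pose fl N t := dyad T N (dyad_floor T N t).
have cflo i : fl N (a i) @[N --> \oo] --> a i.
  by apply: dyad_floor_cvg => //; have [] := h1 i.
have cflo' i : fl N (b i) @[N --> \oo] --> b i.
  by apply: dyad_floor_cvg => //; have [ai [abi _]] := h1 i; exact: le_trans abi.
have L : (\sum_i `|u (fl N (b i)) - u (fl N (a i))|) @[N --> \oo] -->
    \sum_i `|u (b i) - u (a i)|.
  apply: cvg_sumr => i; apply: cvg_norm; have [ai [abi bi]] := h1 i.
  apply: cvgB; apply: cu; first by rewrite (le_trans ai abi).
  by rewrite ai (le_trans abi bi).
have L' : (2^-1 * (l * (\sum_i (fl N (b i) - fl N (a i))) + E / l)) @[N --> \oo] -->
    2^-1 * (l * (\sum_i (b i - a i)) + E / l).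
  apply: cvgMr; apply: cvgD; last exact: cvg_cst.
  by apply: cvgMr; apply: cvg_sumr => i; apply: cvgB.
rewrite -(cvg_lim _ L)// -(cvg_lim _ L')//; apply: ler_lim.
- by apply/cvg_ex; eexists; exact: L.
- by apply/cvg_ex; eexists; exact: L'.
apply: nearW => N.
apply: le_trans (@dyadic_increments_young I N u (fun i => dyad_floor T N (a i)) (fun i => dyad_floor T N (b i)) l l0 _ _) _.
- move=> i; have [? [? ?]] := h1 i.
  by split; [exact: dyad_floor_homo|exact: dyad_floor_le].
- by move=> i j /h2[] ?; [left|right]; exact: dyad_floor_homo.
by rewrite ler_pM2l ?invr_gt0// lerD2l ler_pM2r ?invr_gt0.
Qed.

Lemma energy_absolutely_continuous (u : R -> R) (E : R) : dyadic_continuous u ->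
  (forall N, dyadic_energy N u <= E) -> absolutely_continuous 0 T u.
Proof.
move=> cu hE e e0.
have E0 : 0 <= E := le_trans (dyadic_energy_ge0 0 u) (hE 0%N).
(* With this l, E / l is at most e, and a total length below e / l contributes less than e; the
   factor 1/2 brings the sum below e. *)
pose l := (E + 1) / e; have l0 : 0 < l by rewrite divr_gt0// ltr_wpDl.
exists (e / l); first exact: divr_gt0.
move=> m a b h1 h2 h3.
apply: le_lt_trans (energy_young cu hE (conj h1 h2) l0) _.
move: h3; rewrite ltr_pdivlMr// mulrC => h3.
have : E / l <= e.
  rewrite ler_pdivrMr// /l mulrCA mulfV ?gt_eqF// mulr1; lra.
lra.
Qed.

Lemma energy_modulus (u : R -> R) (E : R) : dyadic_continuous u ->
  (forall N, dyadic_energy N u <= E) ->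
  forall s t l, 0 <= s -> s <= t -> t <= T -> 0 < l ->
  `|u t - u s| <= 2^-1 * (l * (t - s) + E / l).
Proof.
move=> cu hE s t l s0 st tT l0.
have := @energy_young u E cu hE unit (fun=> s) (fun=> t) _ l l0.
by rewrite !big_const card_unit/= !addr0; apply; split=> // -[] [].
Qed.

End dyadic_energy.

Lemma ae_lebesgue_filter (R : realType) :
  Filter (nbhs (almost_everywhere (@lebesgue_measure R))).
Proof. exact: ae_filter_ringOfSetsType. Qed.
#[local] Existing Instance ae_lebesgue_filter.

Lemma ae_neq (R : realType) (a : R) :
  {ae (@lebesgue_measure R), forall x, x != a}.
Proof.
exists [set a]; split => //; first exact: lebesgue_measure_set1.
by move=> x /= /negP; rewrite negbK => /eqP.
Qed.

(** * Functions that are integrals of a density *)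

Section primitive.
Context {R : realType} (T : R).
Hypothesis T0 : 0 < T.
Local Notation mu := (@lebesgue_measure R).

Definition primitive_on (u g : R -> R) : Prop :=
  mu.-integrable setT (EFin \o g) /\
  forall s t, 0 <= s -> s <= t -> t <= T -> u t - u s = \int[mu]_(r in `[s, t]) g r.

Lemma primitive_measurable u g : primitive_on u g -> measurable_fun setT g.
Proof. by move=> [/integrableP[/measurable_EFinP]]. Qed.

(** Cauchy-Schwarz in the form (g - m)^2 >= 0, with m the mean slope: integrating 2 m g - m^2 <= g^2
    gives the quotient. *)
Lemma primitive_quotient_le u g : primitive_on u g ->
  forall s t, 0 <= s -> s < t -> t <= T ->
  (((u t - u s) ^+ 2 / (t - s))%:E <= \int[mu]_(r in `[s, t]) (g r ^+ 2)%:E)%E.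
Proof.
move=> pg s t s0 st tT; have [ig Eg] := pg.
have mg2 : measurable_fun (`[s, t] : set (measurableTypeR R)) (fun r => (g r ^+ 2)%:E).
  apply/measurable_EFinP; apply: measurable_funX.
  exact: measurable_funS (primitive_measurable pg).
have [->|fin] := eqVneq (\int[mu]_(r in `[s, t]) (g r ^+ 2)%:E)%E +oo%E.
  by rewrite leey.
have ig2 : mu.-integrable `[s, t] (EFin \o (fun r => g r ^+ 2)).
  apply/integrableP; split => //.
  have -> : (\int[mu]_(x in `[s, t]) `|(EFin \o (fun r => (g r ^+ 2)%R)) x| =
      \int[mu]_(r in `[s, t]) (g r ^+ 2)%:E)%E.
    by apply: eq_integral => x _ /=; rewrite ger0_norm ?sqr_ge0.
  by rewrite ltey.
have igs : mu.-integrable `[s, t] (EFin \o g) by exact: integrableS ig.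
rewrite -[leRHS]fineK; last exact: integrable_fin_num.
rewrite lee_fin; set m := (u t - u s) / (t - s).
have ts : t - s != 0 by rewrite subr_eq0 gt_eqF.
have icst c : mu.-integrable `[s, t] (EFin \o (fun=> c)).
  apply: continuous_compact_integrable; first exact: segment_compact.
  by apply: continuous_subspaceT => x; exact: cvg_cst.
have ilin : mu.-integrable `[s, t] (EFin \o (fun r => (2 * m) * g r)).
  by rewrite (_ : _ \o _ = (fun r => (2 * m)%:E * (g r)%:E)%E)//; exact: integrableZl.
have : \int[mu]_(r in `[s, t]) ((2 * m) * g r - m ^+ 2) <=
       \int[mu]_(r in `[s, t]) (g r ^+ 2).
  apply: le_Rintegral => //.
    rewrite (_ : _ \o _ = (EFin \o (fun r => (2 * m * g r)%R)) \- (EFin \o (fun=> (m ^+ 2)%R)))%E; last exact/funext.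
    exact: integrableB.
  by move=> x _; have := sqr_ge0 (g x - m); rewrite sqrrB -mulr_natl; lra.
apply: le_trans; rewrite RintegralB// RintegralZl// -Eg ?(ltW st)// Rintegral_cst//.
rewrite [X in fine X](_ : _ = (t - s)%:E)/=; last first.
  by rewrite [LHS]lebesgue_measure_itv/= lte_fin st.
rewrite le_eqVlt; apply/orP; left; apply/eqP.
by rewrite /m; field.
Qed.

Lemma primitive_energy_le u g : primitive_on u g -> forall N,
  ((dyadic_energy T N u)%:E <= \int[mu]_(r in `[0%R, T]) (g r ^+ 2)%:E)%E.
Proof.
move=> pg N; have [ig Eg] := pg.
suff K k : (k <= 2 ^ N)%N -> ((\sum_(i < k) (u (dyad T N i.+1) - u (dyad T N i)) ^+ 2 / (T / 2 ^+ N))%:E <=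
    \int[mu]_(r in `[0%R, dyad T N k]) (g r ^+ 2)%:E)%E.
  by have := K (2 ^ N)%N (leqnn _); rewrite dyad_last.
have mg2 (D : set (measurableTypeR R)) : measurable_fun D (fun r => (g r ^+ 2)%:E).
  apply/measurable_EFinP; apply: measurable_funX.
  exact: measurable_funS (primitive_measurable pg).
elim: k => [|k IH] kN.
  by rewrite big_ord0; apply: integral_ge0 => x _; rewrite lee_fin sqr_ge0.
have d0 := dyad_ge0 T0 N k.
have d1 : dyad T N k < dyad T N k.+1 by rewrite dyadS ltrDl dyad_step_gt0.
rewrite big_ord_recr/= EFinD.
rewrite (@itv_bndbnd_setU _ _ _ (BLeft (dyad T N k))) ?bnd_simp ?(ltW d1)//.
rewrite ge0_integral_setU//=; last first.
  apply/disj_setPS => y [/=]; rewrite 2!in_itv/= => /andP[_ yx] /andP[].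
  by rewrite leNgt yx.
  by move=> x _; rewrite lee_fin sqr_ge0.
have {}IH := IH (ltnW kN); rewrite -integral_itv_bndo_bndc in IH; last exact: mg2.
apply: (leeD IH).
have := primitive_quotient_le pg d0 d1 (dyad_leT T0 kN).
have -> : dyad T N k.+1 - dyad T N k = T / 2 ^+ N.
  by rewrite dyadS addrAC subrr add0r.
by [].
Qed.

Lemma primitive_ae_derivable u g : primitive_on u g ->
  {ae mu, forall x, 0 < x < T -> derivable u x 1 /\ derive1 u x = g x}.
Proof.
move=> [ig Eg].
have ig0 y : mu.-integrable [set` Interval (BLeft 0) (BRight y)] (EFin \o g).
  exact: integrableS ig.
have := FTC1 ig0 (open_integrable_locally openT ig).
apply: filterS => x H /andP[x0 xT].
have [|H1 H2] := H; first by rewrite /= lte_fin.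
pose F (y : R) : R := \int[mu]_(t in `[0, y]) g t.
have E : {near x, (cst (u 0) + F) =1 u}.
  near=> y; rewrite -[RHS](subrK (u 0)) addrC Eg//; apply: ltW; near: y.
    exact: lt_nbhsr.
  exact: lt_nbhsl.
have D0 : derivable F x 1 by [].
have Dc : derivable (cst (u 0) : R -> R) x 1 := derivable_cst _ _ _.
have D : derivable (cst (u 0) + F) x 1 := derivableD Dc D0.
split; first exact: near_eq_derivable E D.
have DE : 'D_1 (cst (u 0) + F) x = 'D_1 u x by exact: near_eq_derive E.
by rewrite derive1E -DE (deriveD Dc D0) derive_cst add0r -derive1E.
Unshelve. all: by end_near. Qed.

End primitive.

(** * The energy of the density is at most the supremum of the dyadic energies *)

Section fatou_energy.
Context {R : realType} (T : R) (m : nat) (u g : 'I_m -> R -> R).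
Hypothesis T0 : 0 < T.
Local Notation mu := (@lebesgue_measure R).
Hypothesis pg : forall j, primitive_on T (u j) (g j).

(** Closed on the left this time, so that the cell of t is the one numbered by [dyad_floor]. *)
Let cell N i : set (measurableTypeR R) := `[dyad T N i, dyad T N i.+1[%classic.

Let q N (j : 'I_m) (i : nat) : R :=
  ((u j (dyad T N i.+1) - u j (dyad T N i)) / (T / 2 ^+ N)) ^+ 2.

(** The squared difference quotients as a step function: its integral is the dyadic energy, and it
    converges almost everywhere to the squared derivatives. *)
Let G N (t : measurableTypeR R) : R :=
  \sum_j \sum_(i < 2 ^ N) q N j i * \1_(cell N i) t.

Let mcell N i : measurable (cell N i).
Proof. exact: measurable_itv. Qed.

Let mq N j i : measurable_fun setT (fun t => (q N j i * \1_(cell N i) t)%:E).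
Proof.
by apply/measurable_EFinP; apply: measurable_funM => //; exact: measurable_indic.
Qed.

Let q0 N j i : 0 <= q N j i. Proof. exact: sqr_ge0. Qed.

Let integral_G N : (\int[mu]_(t in `[0%R, T]) (G N t)%:E)%E =
  (\sum_j dyadic_energy T N (u j))%:E.
Proof.
under eq_integral do rewrite -sumEFin.
rewrite ge0_integral_sum//=; last 2 first.
- move=> j; apply/measurable_EFinP; apply: measurable_sum => i.
  by apply/measurable_EFinP; apply: measurable_funS (mq N j i).
- by move=> j t _; rewrite lee_fin sumr_ge0// => i _; rewrite mulr_ge0.
rewrite -sumEFin; apply: eq_bigr => j _.
under eq_integral do rewrite -sumEFin.
rewrite ge0_integral_sum//=; last 2 first.
- by move=> i; exact: measurable_funS (mq N j i).
- by move=> i t _; rewrite lee_fin mulr_ge0.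
rewrite /dyadic_energy -sumEFin; apply: eq_bigr => i _.
under eq_integral do rewrite EFinM.
rewrite ge0_integralZl_EFin//; last first.
  by apply/measurable_EFinP; exact: measurable_indic.
rewrite integral_indic// setIidl; last first.
  move=> t; rewrite /cell /= !in_itv/= => /andP[t1 /ltW t2].
  by rewrite (le_trans (dyad_ge0 T0 N i))// (le_trans t2)// dyad_leT.
rewrite [X in (_ * X)%E](_ : _ = (T / 2 ^+ N)%:E); last first.
  rewrite [LHS]lebesgue_measure_itv/= lte_fin dyadS ltrDl dyad_step_gt0//.
  by rewrite -EFinD addrAC subrr add0r.
rewrite -EFinM; congr (_%:E); rewrite /q; set h := T / _.
have h0 : h != 0 by rewrite gt_eqF// dyad_step_gt0.
by field.
Qed.

Let G_floor N t : 0 <= t < T -> G N t = \sum_j q N j (dyad_floor T N t).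
Proof.
move=> /andP[t0 tT]; apply: eq_bigr => j _.
have /andP[f1 f2] := dyad_floorP T0 N t0.
have kN : (dyad_floor T N t < 2 ^ N)%N.
  rewrite ltn_neqAle dyad_floor_le ?(ltW tT)// andbT; apply/eqP => E.
  by move: f1; rewrite E dyad_last// leNgt tT.
rewrite (bigD1 (Ordinal kN))//= big1 ?addr0.
  by rewrite indicE mem_set ?mulr1// /cell/= in_itv/= f1.
move=> i /eqP iN; rewrite indicE memNset ?mulr0// /cell/= in_itv/= => h.
by apply: iN; apply: val_inj; rewrite /= (dyad_floorE T0 h).
Qed.

(** In general t is not an endpoint of its cell [a, a + h]. The first order expansions at the two
    ends have errors e (t - a) and e (a + h - t), which add up to e h. *)
Let quotient_cvg j t : 0 < t -> derivable (u j) t 1 ->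
  q N j (dyad_floor T N t) @[N --> \oo] --> (derive1 (u j) t) ^+ 2.
Proof.
move=> t0 du; rewrite /q; under eq_fun do rewrite expr2.
rewrite expr2; set l := derive1 _ _.
have cv : h^-1 * (u j (h + t) - u j t) @[h --> 0^'] --> l.
  have -> : (fun h => h^-1 * (u j (h + t) - u j t)) =
      (fun h => h^-1 *: (u j (h *: 1 + t) - u j t)).
    by apply/funext => h; rewrite /GRing.scale/= mulr1.
  by rewrite /l derive1E; exact: du.
suff L : (u j (dyad T N (dyad_floor T N t).+1) - u j (dyad T N (dyad_floor T N t))) /
    (T / 2 ^+ N) @[N --> \oo] --> l by exact: cvgM.
apply/cvgrPdist_le => e e0.
have /cvgrPdist_le/(_ _ e0)[d /= d0 Hd] := cv.
have K x : `|x - t| < d -> `|u j x - u j t - l * (x - t)| <= e * `|x - t|.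
  move=> xd; have [->|xt] := eqVneq x t.
    by rewrite !subrr mulr0 subr0 !normr0 mulr0.
  have xt0 : x - t != 0 by rewrite subr_eq0.
  have := Hd (x - t); rewrite /= sub0r normrN xd => /(_ isT xt0).
  rewrite subrK -(ler_pM2r (_ : 0 < `|x - t|)) ?normr_gt0// -normrM.
  have -> : (l - (x - t)^-1 * (u j x - u j t)) * (x - t) =
    - (u j x - u j t - l * (x - t)) by field.
  by rewrite normrN.
have [N0 hN0] := dyad_step_cvg T0 d0.
near=> N.
have hN : T / 2 ^+ N < d by apply: hN0; near: N; exists N0.
have h0 := dyad_step_gt0 T0 N.
have /andP[f1 f2] := dyad_floorP T0 N (ltW t0).
move: f1 f2 h0 hN; rewrite dyadS.
set a := dyad T N _; set h := T / 2 ^+ N => f1 f2 h0 hN.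
have Ka : `|u j a - u j t - l * (a - t)| <= e * (t - a).
  by have := K a; rewrite distrC ger0_norm ?subr_ge0//; apply; lra.
have Kb : `|u j (a + h) - u j t - l * (a + h - t)| <= e * (a + h - t).
  by have := K (a + h); rewrite ger0_norm ?subr_ge0 ?(ltW f2)//; apply; lra.
have -> : l - (u j (a + h) - u j a) / h = (l * h - (u j (a + h) - u j a)) / h.
  by field; rewrite gt_eqF.
rewrite normrM normfV (ger0_norm (ltW h0)) ler_pdivrMr//.
have -> : l * h - (u j (a + h) - u j a) =
  (u j a - u j t - l * (a - t)) - (u j (a + h) - u j t - l * (a + h - t)) by ring.
apply: le_trans (ler_normB _ _) _; apply: le_trans (lerD Ka Kb) _.
by rewrite -mulrDr; apply: ler_wpM2l; [exact: ltW|lra].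
Unshelve. all: by end_near. Qed.

Lemma integral_le_energy (C : R) :
  (forall N, \sum_j dyadic_energy T N (u j) <= C) ->
  (\int[mu]_(t in `[0%R, T]) (\sum_j g j t ^+ 2)%:E <= C%:E)%E.
Proof.
move=> hC.
have -> : (\int[mu]_(t in `[0%R, T]) (\sum_j g j t ^+ 2)%:E =
   \int[mu]_(t in `[0%R, T]) limn_einf (fun N => (G N t)%:E))%E.
  symmetry; apply: ge0_ae_eq_integral_nomeas => //.
  - apply/measurable_EFinP; apply: measurable_sum => j; apply: measurable_funX.
    exact: measurable_funS (primitive_measurable (pg j)).
  - move=> t _; rewrite limn_einf_lim; apply: lime_ge.
      exact: is_cvg_einfs.
    apply: nearW => N; apply: le_ereal_inf_tmp => _ [k _ <-].
    by rewrite lee_fin; apply: sumr_ge0 => j _; apply: sumr_ge0 => i _; rewrite mulr_ge0.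
  - by move=> t _; rewrite lee_fin; apply: sumr_ge0 => j _; exact: sqr_ge0.
  have H1 : {ae mu, forall t, forall j, 0 < t < T ->
      derivable (u j) t 1 /\ derive1 (u j) t = g j t}.
    by apply: filter_forall => j; exact: primitive_ae_derivable.
  apply: (filterS _ (filterI (ae_neq 0) (filterI (ae_neq T) H1))).
  move=> t [tN0 [tNT H]]; rewrite /= in_itv/= => /andP[t0 tT].
  have {}t0 : 0 < t by rewrite lt_neqAle eq_sym tN0.
  have {}tT : t < T by rewrite lt_neqAle tNT.
  have cv : (fun N => (G N t)%:E) @ \oo --> (\sum_j g j t ^+ 2)%:E.
    apply: cvg_EFin; first exact: nearW.
    have -> : fine \o (fun N => (G N t)%:E) =
        (fun N => \sum_j q N j (dyad_floor T N t)).
      by apply/funext => N /=; rewrite G_floor// ltW.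
    apply: cvg_sumr => j; have [|dj <-] := H j; first by rewrite t0.
    exact: quotient_cvg.
  by rewrite (cvg_limn_einf_sup cv).
apply: le_trans (fatou _ _ _ _) _ => //.
- move=> N; apply/measurable_EFinP; apply: measurable_sum => j.
  apply: measurable_sum => i.
  by apply/measurable_EFinP; apply: measurable_funS (mq N j i).
- move=> N t _; rewrite lee_fin; apply: sumr_ge0 => j _.
  by apply: sumr_ge0 => i _; rewrite mulr_ge0.
rewrite limn_einf_lim; apply: lime_le; first exact: is_cvg_einfs.
apply: nearW => N; apply: le_trans (_ : (\sum_j dyadic_energy T N (u j))%:E <= _)%E; last by rewrite lee_fin.
by rewrite -integral_G; apply: ereal_inf_lbound; exists N => /=.
Unshelve. all: by end_near. Qed.

End fatou_energy.

Section integral_increments.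
Context {R : realType}.
Local Notation mu := (@lebesgue_measure R).

Lemma continuous_integrable_segment (p : R -> R) (a b : R) : continuous p ->
  mu.-integrable `[a, b] (EFin \o p).
Proof.
move=> cp; apply: continuous_compact_integrable; first exact: segment_compact.
exact: continuous_subspaceT.
Qed.

Lemma integral_increment (p : R -> R) (s t : R) : continuous p -> 0 <= s -> s <= t ->
  \int[mu]_(r in `[0, t]) p r - \int[mu]_(r in `[0, s]) p r =
  \int[mu]_(r in `[s, t]) p r.
Proof.
move=> cp s0 st; have ip a b := @continuous_integrable_segment p a b cp.
rewrite -(@Rintegral_itv_obnd_cbnd _ s) //; last first.
  by apply: integrableS (ip s t) => //; exact: subset_itv_oc_cc.
exact: (@Rintegral_itvB _ _ (BLeft 0) (BRight t)).
Qed.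

Lemma integral_increment_dist (p q : R -> R) (s t c : R) :
  continuous p -> continuous q -> 0 <= s -> s <= t ->
  (forall r, s <= r <= t -> `|p r - q r| <= c) ->
  `|(\int[mu]_(r in `[0, t]) p r - \int[mu]_(r in `[0, s]) p r) -
    (\int[mu]_(r in `[0, t]) q r - \int[mu]_(r in `[0, s]) q r)| <= c * (t - s).
Proof.
move=> cp cq s0 st H; rewrite (integral_increment cp s0 st) (integral_increment cq s0 st).
rewrite -RintegralB//; [|exact: continuous_integrable_segment..].
have cpq : continuous (fun r => p r - q r) by move=> r; apply: cvgB; [exact: cp|exact: cq].
apply: le_trans (le_normr_Rintegral _ _) _ => //; first exact: continuous_integrable_segment.
apply: (@le_trans _ _ (\int[mu]_(r in `[s, t]) c)).
  apply: le_Rintegral => //.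
    by apply: continuous_integrable_segment => r; apply: cvg_norm; exact: cpq.
  by apply: continuous_integrable_segment => r; exact: cvg_cst.
rewrite Rintegral_cst//.
rewrite [X in fine X](_ : _ = (t - s)%:E)//; last first.
rewrite [LHS]lebesgue_measure_itv/= lte_fin; case: ltP => // ts.
by congr (_%:E); apply/eqP; rewrite eq_sym subr_eq0 eq_le ts st.
Qed.

Lemma integral_segment0 (p : R -> R) : \int[mu]_(r in `[0, 0]) p r = 0.
Proof. by rewrite set_itv1 Rintegral_set1. Qed.

End integral_increments.

(** * The Dirichlet energy as a supremum of dyadic energies *)

Section energy_characterization.
Context {R : realType} (T : R) (n : nat) (th p : 'I_n -> R -> R) (th0 : 'I_n -> R).
Hypothesis T0 : 0 < T.
Local Notation mu := (@lebesgue_measure R).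
Hypothesis cth : forall j, continuous (th j).
Hypothesis cp : forall j, continuous (p j).

Definition residual (j : 'I_n) (t : R) : R :=
  th j t - th0 j - \int[mu]_(s in `[0, t]) p j s.

Let ip j a b : mu.-integrable `[a, b] (EFin \o p j).
Proof. exact: continuous_integrable_segment. Qed.

Lemma drift_lipschitz j : exists2 C, 0 < C & forall s t, 0 <= s -> s <= t -> t <= T ->
  `|\int[mu]_(r in `[0, t]) p j r - \int[mu]_(r in `[0, s]) p j r| <= C * (t - s).
Proof.
have cn : {within `[0, T], continuous (fun x => `|p j x|)}.
  by apply: continuous_subspaceT => x; apply: cvg_norm; exact: cp.
have [c _ hc] := EVT_max (ltW T0) cn.
exists (`|p j c| + 1); first by rewrite ltr_wpDl.
move=> s t s0 st tT.
have := @integral_increment_dist R (p j) (fun=> 0) s t (`|p j c| + 1) (@cp j) _ s0 st.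
rewrite !Rintegral_cst// !mul0r subrr subr0; apply; first by move=> r; exact: cvg_cst.
move=> x /andP[sx xt]; rewrite subr0; apply: ler_wpDr => //; apply: hc.
by rewrite in_itv/= (le_trans s0)//= (le_trans xt).
Qed.

Lemma lipschitz_absolutely_continuous (C : R) (f : R -> R) : 0 < C ->
  (forall s t, 0 <= s -> s <= t -> t <= T -> `|f t - f s| <= C * (t - s)) ->
  absolutely_continuous 0 T f.
Proof.
move=> C0 H e e0; exists (e / C); first exact: divr_gt0.
move=> m u v h1 h2; rewrite ltr_pdivlMr// => h3; apply: le_lt_trans h3.
rewrite mulr_suml; apply: ler_sum => i _; have [? [? ?]] := h1 i.
by rewrite mulrC; exact: H.
Qed.

Lemma residual_dyadic_continuous j : dyadic_continuous T (residual j).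
Proof.
move=> t /andP[t0 tT]; apply: cvgB.
  apply: cvgB; last exact: cvg_cst.
  by apply: cvg_comp (dyad_floor_cvg T0 t0) _; exact: cth.
have [C C0 hC] := drift_lipschitz j.
apply/cvgrPdist_le => e e0.
have := dyad_floor_cvg T0 t0; move=> /cvgrPdist_le/(_ (e / C))[|N0 _ HN]; first exact: divr_gt0.
exists N0 => // N /HN /=; have /andP[f1 f2] := dyad_floorP T0 N t0.
rewrite ger0_norm ?subr_ge0// => h.
apply: le_trans (hC _ _ _ f1 tT) _; first exact: dyad_ge0.
by rewrite mulrC -ler_pdivlMr.
Qed.

(** The drift is cut off outside [0, T] because [primitive_on] asks for integrability on the whole
    line. *)
Lemma residual_primitive j f : primitive_on T (th j) f ->
  primitive_on T (residual j) (fun t => f t - (p j \_ `[0, T]) t).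
Proof.
move=> [intf Ef].
have ipT : mu.-integrable setT (EFin \o (p j \_ `[0, T])).
  by rewrite -restrict_EFin; apply/integrable_restrict => //=; rewrite setTI.
split.
  rewrite (_ : _ \o _ = (EFin \o f) \- (EFin \o (p j \_ `[0%R, T])))%E; last exact/funext.
  exact: integrableB.
move=> s t s0 st tT; rewrite RintegralB//; last 2 first.
  exact: integrableS intf.
  exact: integrableS ipT.
rewrite -Ef//; have -> : \int[mu]_(r in `[s, t]) (p j \_ `[0, T]) r =
    \int[mu]_(r in `[s, t]) p j r.
  apply: eq_Rintegral => x; rewrite inE/= in_itv/= => /andP[sx xt].
  by rewrite patchE mem_set//= in_itv/= (le_trans s0)//= (le_trans xt).
by rewrite -integral_increment// /residual; ring.
Qed.

Lemma residual_ac j : absolutely_continuous 0 T (th j) <->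
  absolutely_continuous 0 T (residual j).
Proof.
have [C C0 hC] := drift_lipschitz j.
have acP := lipschitz_absolutely_continuous C0 hC.
have accst (c : R) : absolutely_continuous 0 T (fun=> c).
  move=> e e0; exists 1 => // m u v _ _ _.
  by rewrite big1// => i _; rewrite subrr normr0.
split=> ac.
  by apply: absolutely_continuousD; [apply: absolutely_continuousD|];
    [|exact: absolutely_continuousN|exact: absolutely_continuousN].
rewrite (_ : th j = fun t => residual j t + (th0 j + \int[mu]_(s in `[0, t]) p j s)).
  by apply: absolutely_continuousD => //; exact: absolutely_continuousD.
by apply/funext => t; rewrite /residual; ring.
Qed.

(** Exchanges the pointwise derivatives, with their default values, for densities. *)
Let ac_data : (forall j, absolutely_continuous 0 T (th j)) ->
  exists f : 'I_n -> R -> R, (forall j, primitive_on T (th j) (f j)) /\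
  (\int[mu]_(s in `[0%R, T]) (\sum_j `|derive1 (th j) s - p j s| ^+ 2)%:E =
   \int[mu]_(s in `[0%R, T]) (\sum_j (f j s - (p j \_ `[0, T]) s) ^+ 2)%:E)%E.
Proof.
move=> ac.
have /choice[f hf] : forall j, exists f, primitive_on T (th j) f.
  by move=> j; have [f f1 f2] := absolutely_continuous_integral T0 (ac j); exists f.
exists f; split=> //; apply: ge0_ae_eq_integral_nomeas => //.
- apply/measurable_EFinP; apply: measurable_sum => j; apply: measurable_funX.
  exact: measurable_funS (primitive_measurable (residual_primitive (hf j))).
- by move=> x _; rewrite lee_fin; apply: sumr_ge0 => j _; exact: sqr_ge0.
- by move=> x _; rewrite lee_fin; apply: sumr_ge0 => j _; exact: sqr_ge0.
have H1 : {ae mu, forall t, forall j, 0 < t < T ->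
    derivable (th j) t 1 /\ derive1 (th j) t = f j t}.
  by apply: filter_forall => j; exact: primitive_ae_derivable.
apply: (filterS _ (filterI (ae_neq 0) (filterI (ae_neq T) H1))).
move=> t [tN0 [tNT H]] tT; have := tT; rewrite /= in_itv/= => /andP[t0 tT'].
congr (_%:E); apply: eq_bigr => j _; have [|_ ->] := H j.
  by rewrite !lt_neqAle eq_sym tN0 tNT t0.
by rewrite real_normK ?num_real// patchE mem_set.
Qed.

(** A bound on all dyadic energies already forces absolute continuity, so the infinite branch of the
    energy is covered too. *)
Lemma dirichlet_le_energyP (c : R) :
  ((forall j, absolutely_continuous 0 T (th j)) /\
  ((2^-1)%:E * \int[mu]_(s in `[0%R, T])
      (\sum_j `|derive1 (th j) s - p j s| ^+ 2)%:E <= c%:E)%E) <->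
  forall N, 2^-1 * \sum_j dyadic_energy T N (residual j) <= c.
Proof.
split=> [[ac]|H].
  have [f [hf ->]] := ac_data ac => H N.
  rewrite -lee_fin; apply: le_trans H; rewrite EFinM.
  apply: lee_wpmul2l; first by rewrite lee_fin invr_ge0.
  rewrite -sumEFin.
  under [leRHS]eq_integral do rewrite -sumEFin.
  rewrite ge0_integral_sum//; last first.
  - by move=> j t _; rewrite lee_fin sqr_ge0.
  - move=> j; apply/measurable_EFinP; apply: measurable_funX.
    exact: measurable_funS (primitive_measurable (residual_primitive (hf j))).
  apply: lee_sum => j _; apply: primitive_energy_le => //.
  exact: residual_primitive.
have H2 N : \sum_j dyadic_energy T N (residual j) <= 2 * c.
  by have := H N; rewrite ler_pdivrMl.
have ac j : absolutely_continuous 0 T (th j).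
  apply/residual_ac; apply: (@energy_absolutely_continuous _ _ T0 _ (2 * c)).
    exact: residual_dyadic_continuous.
  move=> N; apply: le_trans (H2 N); rewrite (bigD1 j)//= lerDl.
  by apply: sumr_ge0 => i _; exact: dyadic_energy_ge0.
split=> //; have [f [hf ->]] := ac_data ac.
rewrite lee_pdivrMl// -EFinM.
exact: (integral_le_energy T0 (fun j => residual_primitive (hf j))).
Qed.

End energy_characterization.

(** * Gaussian estimates *)

Lemma abs_ge_setE (R : realType) (a : R) :
  [set x | a <= `|x|] = `[a, +oo[%classic `|` `]-oo, - a]%classic.
Proof.
apply/seteqP; split=> x /=; rewrite !in_itv/= andbT ler_normr lerNr.
  by move=> /orP.
by move=> /orP.
Qed.

Lemma measurable_abs_ge (R : realType) (a : R) :
  measurable ([set x | a <= `|x|] : set (measurableTypeR R)).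
Proof. by rewrite abs_ge_setE; exact: measurableU. Qed.

(** * Bounds for one Gaussian variable *)

Section normal_bounds.
Context {R : realType} (s : R).
Hypothesis s0 : 0 < s.
Local Notation mu := (@lebesgue_measure R).

Let sN0 : s != 0. Proof. by rewrite gt_eqF. Qed.

(** Compare with the Gaussian centred at a: x^2 - a^2 - (x - a)^2 = 2 a (x - a) is nonnegative on A,
    so the centred density is at most the exponential factor times the shifted one, which has mass
    1. *)
Lemma normal_prob_half_line (a : R) (A : set (measurableTypeR R)) : measurable A ->
  (forall x, A x -> 0 <= a * (x - a)) ->
  (normal_prob 0 s A <= (expR (- (a ^+ 2 / (2 * s ^+ 2))))%:E)%E.
Proof.
move=> mA hA; rewrite /normal_prob.
have mpdf m (D : set (measurableTypeR R)) : measurable_fun D (fun x => (normal_pdf m s x)%:E).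
  apply/measurable_EFinP.
  exact: measurable_funS (measurable_normal_pdf m s).
apply: (@le_trans _ _ (\int[mu]_(x in A)
    ((expR (- (a ^+ 2 / (2 * s ^+ 2))))%:E * (normal_pdf a s x)%:E))%E).
  apply: ge0_le_integral => //.
  - by move=> x _; rewrite lee_fin normal_pdf_ge0.
  - apply: emeasurable_funM => //; exact: mpdf.
  move=> x Ax; rewrite -EFinM lee_fin !normal_pdfE// mulrCA ler_pM2l ?normal_peak_gt0//.
  rewrite /normal_fun -expRD ler_expR subr0.
  have := hA _ Ax => h.
  rewrite -mulNr -mulNr -mulr_natl -mulrDl ler_pM2r ?invr_gt0 ?mulr_gt0 ?exprn_gt0//.
  by move: h; rewrite !expr2; nra.
rewrite ge0_integralZl_EFin//; last by move=> x _; rewrite lee_fin normal_pdf_ge0.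
rewrite -[leRHS]mule1; apply: lee_wpmul2l; first by rewrite lee_fin expR_ge0.
rewrite -(integral_normal_pdf a s); apply: ge0_subset_integral => //.
by move=> x _; rewrite lee_fin normal_pdf_ge0.
Qed.

Lemma normal_prob_tail (a : R) : 0 <= a ->
  (normal_prob 0 s [set x | (a <= `|x|)%R] <= (2 * expR (- (a ^+ 2 / (2 * s ^+ 2))))%:E)%E.
Proof.
move=> a0.
have m1 : measurable (`[a, +oo[%classic : set (measurableTypeR R)) by [].
have m2 : measurable (`]-oo, - a]%classic : set (measurableTypeR R)) by [].
rewrite abs_ge_setE; apply: le_trans (measureU2 _ m1 m2) _.
rewrite mulr_natl mulr2n EFinD; apply: leeD.
  apply: normal_prob_half_line => // x; rewrite /= in_itv/= andbT => ax.
  by rewrite mulr_ge0// subr_ge0.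
rewrite -[a in leRHS]opprK sqrrN; apply: normal_prob_half_line => // x.
by rewrite /= in_itv/= => xa; rewrite mulNr -mulrN mulr_ge0// opprB; lra.
Qed.

Lemma normal_prob_itv_ge (a b M : R) : a <= b -> (forall x, a <= x <= b -> `|x| <= M) ->
  (((b - a) * (normal_peak s * expR (- (M ^+ 2 / (2 * s ^+ 2)))))%:E <=
   normal_prob 0 s `[a, b])%E.
Proof.
move=> ab hM; rewrite /normal_prob mulrC.
apply: (@le_trans _ _ (\int[mu]_(x in `[a, b])
   (cst (normal_peak s * expR (- (M ^+ 2 / (2 * s ^+ 2))))%:E x))%E).
  rewrite integral_cst// [X in (_ * X)%E](_ : _ = (b - a)%:E)//; last first.
  rewrite [LHS]lebesgue_measure_itv/= lte_fin; case: ltP => // ba.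
  by congr (_%:E); apply/eqP; rewrite eq_sym subr_eq0 eq_le ba ab.
apply: ge0_le_integral => //.
- by move=> x _; rewrite lee_fin mulr_ge0 ?expR_ge0 ?normal_peak_ge0.
- apply/measurable_EFinP.
  exact: measurable_funS (measurable_normal_pdf 0 s).
move=> x /=; rewrite in_itv/= => /hM xM.
rewrite lee_fin normal_pdfE// ler_pM2l ?normal_peak_gt0// /normal_fun ler_expR subr0.
rewrite mulNr lerN2 -mulr_natl ler_pM2r ?invr_gt0 ?mulr_gt0 ?exprn_gt0//.
by rewrite -[leLHS]real_normK ?num_real// ler_pXn2r ?nnegrE// (le_trans _ xM).
Qed.

End normal_bounds.

Lemma lee_prod (R : realType) (I : finType) (F G : I -> \bar R) :
  (forall i, 0 <= F i <= G i)%E -> (\prod_i F i <= \prod_i G i)%E.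
Proof.
move=> h; suff [] : (0 <= \prod_i F i)%E /\ (\prod_i F i <= \prod_i G i)%E by [].
elim/big_ind2 : _ => [|x y z t [x0 xy] [z0 zt]|i _]; first by rewrite lee01.
  by split; [exact: mule_ge0|exact: lee_pmul].
by have /andP := h i.
Qed.

Lemma one_add_le_expr (R : realType) (x : R) (q : nat) : 0 <= x ->
  1 + q%:R * x <= (1 + x) ^+ q.
Proof.
move=> x0; elim: q => [|q IH]; first by rewrite mul0r addr0 expr0.
rewrite exprS; apply: le_trans (_ : (1 + x) * (1 + q%:R * x) <= _); last first.
  by rewrite ler_wpM2l// addr_ge0.
have : 0 <= q%:R * x by rewrite mulr_ge0.
by rewrite -natr1; nra.
Qed.

(** * Chaining along dyadic levels *)

Section dyadic_chaining.
Context {R : realType} (T : R).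
Hypothesis T0 : 0 < T.

Lemma dyadic_chaining (u : R -> R) (N : nat) (dl : R) : dyadic_continuous T u ->
  0 < dl ->
  (forall m i, (i < 2 ^ (N + m.+1))%N ->
     `|u (dyad T (N + m.+1) i.+1) - u (dyad T (N + m.+1) i)| <= dl / 3 * (3 / 4) ^+ m.+1) ->
  forall t, 0 <= t <= T -> `|u t - u (dyad T N (dyad_floor T N t))| <= dl.
Proof.
move=> cu dl0 H t tT; have /andP[t0 tT'] := tT.
pose f M := u (dyad T M (dyad_floor T M t)).
(* From one level to the next the floor point stays or moves by one fine step, and dl (1 - (3/4)^m)
   is the sum of the first m thresholds. *)
have K m : `|f (N + m)%N - f N| <= dl * (1 - (3 / 4) ^+ m).
  elim: m => [|m IH]; first by rewrite addn0 subrr normr0 expr0 subrr mulr0.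
  have S : `|f (N + m.+1)%N - f (N + m)%N| <= dl / 3 * (3 / 4) ^+ m.+1.
    rewrite /f addnS; have [E|E] := dyad_floorS T0 (N + m) t0; rewrite E.
      by rewrite dyad_double subrr normr0 mulr_ge0 ?exprn_ge0// ?divr_ge0// ltW.
    rewrite -(dyad_double T (N + m)) -addnS; apply: H.
    have := dyad_floor_le T0 (N + m.+1) tT'; rewrite addnS E; exact: leq_trans.
  have -> : f (N + m.+1)%N - f N = (f (N + m.+1)%N - f (N + m)%N) + (f (N + m)%N - f N) by ring.
  apply: le_trans (ler_normD _ _) _; apply: le_trans (lerD S IH) _.
  by rewrite exprS; move: ((3 / 4) ^+ m) => z; lra.
have cv : `|f (M + N)%N - f N| @[M --> \oo] --> `|u t - f N|.
  apply: cvg_norm; apply: cvgB; last exact: cvg_cst.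
  by rewrite (cvg_shiftn N f); exact: cu.
rewrite -(cvg_lim _ cv)//; apply: limr_le; first by apply/cvg_ex; eexists; exact: cv.
apply: nearW => M; rewrite addnC; apply: le_trans (K M) _.
by rewrite ler_piMr ?(ltW dl0)// gerBl exprn_ge0.
Qed.

End dyadic_chaining.

(** * Increments of the Brownian motions on a dyadic grid *)

Section brownian_increments.
Context {R : realType} (n : nat) (T : R) (d : measure_display)
  (Omega : measurableType d) (P : probability Omega R)
  (W : 'I_n.+1 -> R -> Omega -> R).
Hypothesis T0 : 0 < T.
Hypothesis W_brownian : independent_brownians P W.

Definition increment (N : nat) (j : 'I_n.+1) (i : nat) (w : Omega) : R :=
  W j (dyad T N i.+1) w - W j (dyad T N i) w.

Lemma measurable_increment N j i : measurable_fun setT (increment N j i).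
Proof.
have [/(_ j)[mW _ _ _ _] _] := W_brownian.
by apply: measurable_funB; apply: mW; exact: dyad_ge0.
Qed.

Lemma measurable_increment_preimage N j i (B : set (measurableTypeR R)) :
  measurable B -> measurable (increment N j i @^-1` B).
Proof.
by move=> mB; rewrite -[X in measurable X]setTI; exact: measurable_increment.
Qed.

Lemma increment_law N j i (B : set (measurableTypeR R)) : measurable B ->
  P (increment N j i @^-1` B) = normal_prob 0 (Num.sqrt (T / 2 ^+ N)) B.
Proof.
move=> mB; have [/(_ j)[_ _ _ nW _] _] := W_brownian.
have /= := @nW (dyad T N i) (dyad T N i.+1) (dyad_ge0 T0 N i) _ B mB.
rewrite dyadS addrAC subrr add0r => <- //.
  by rewrite -dyadS.
by rewrite ltrDl dyad_step_gt0.
Qed.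

(** Independence of the motions gives the product over j, independence of increments the one over i.
    The first applies only once the j-th event is seen to belong to the sigma-algebra generated by
    [W j]. *)
Lemma increment_independent N (B : 'I_n.+1 -> 'I_(2 ^ N) -> set (measurableTypeR R)) :
  (forall j i, measurable (B j i)) ->
  P [set w | forall j (i : 'I_(2 ^ N)), B j i (increment N j i w)] =
  (\prod_j \prod_(i < 2 ^ N) normal_prob 0 (Num.sqrt (T / 2 ^+ N)) (B j i))%E.
Proof.
move=> mB; have [sW iW] := W_brownian.
pose A j := \bigcap_(i in [set: 'I_(2 ^ N)]) (increment N j i @^-1` (B j i)).
rewrite (_ : [set w | _] = \bigcap_(j in setT) A j); last first.
  by apply/seteqP; split=> [w h j _ i _|w h j i]; [exact: h|exact: h].
rewrite iW; last first.
  move=> j; set G := \bigcup_(t in _) _.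
  have mW t : 0 <= t -> measurable_fun (setT : set (g_sigma_algebraType G)) (W j t).
    move=> t0 _ C mC; rewrite setTI; apply: sub_gen_smallest.
    by exists t; [rewrite /= in_itv/= t0|exists C].
  have mA : measurable (A j : set (g_sigma_algebraType G)).
    apply: fin_bigcap_measurable => // i _.
    have mD : measurable_fun (setT : set (g_sigma_algebraType G)) (increment N j i).
      by apply: measurable_funB; apply: mW; exact: dyad_ge0.
    by have := mD measurableT (B j i) (mB j i); rewrite setTI.
  exact: mA.
apply: eq_bigr => j _; rewrite /A.
have [_ _ /(_ (2 ^ N)%N (dyad T N)) iWj _ _] := sW j.
rewrite iWj.
- by apply: eq_bigr => i _; exact: increment_law.
- by rewrite dyad0.
- by move=> a b; exact: dyad_le.
by move=> i; exists (B j i); first exact: mB.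
Qed.

Lemma increment_tail N j i (k a : R) : 0 < k -> 0 <= a ->
  (P [set w | (a <= `|Num.sqrt k * increment N j i w|)%R] <=
   (2 * expR (- (a ^+ 2 / (2 * (T / 2 ^+ N)) / k)))%:E)%E.
Proof.
move=> k0 a0; have sk0 : 0 < Num.sqrt k by rewrite sqrtr_gt0.
have h0 := dyad_step_gt0 T0 N.
pose B := [set x : measurableTypeR R | (a / Num.sqrt k <= `|x|)%R].
have mB : measurable B by exact: measurable_abs_ge.
rewrite (_ : [set w | _] = increment N j i @^-1` B); last first.
  apply/seteqP; split=> w; rewrite /B/= normrM (gtr0_norm sk0) ler_pdivrMr// mulrC//.
rewrite increment_law//.
have a0' : 0 <= a / Num.sqrt k by rewrite divr_ge0// ltW.
have s0 : 0 < Num.sqrt (T / 2 ^+ N) by rewrite sqrtr_gt0.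
apply: le_trans (normal_prob_tail s0 a0') _.
rewrite lee_fin ler_pM2l// ler_expR lerN2 exprMn exprVn !sqr_sqrtr ?(ltW h0) ?(ltW k0)//.
rewrite le_eqVlt; apply/orP; left; apply/eqP; set h := T / _.
by field; rewrite !gt_eqF.
Qed.

Lemma boole_fin (I : finType) (Q : pred I) (A : I -> set Omega) :
  (forall i, measurable (A i)) ->
  (P (\bigcup_(i in [set` Q]) A i) <= \sum_(i | Q i) P (A i))%E.
Proof.
move=> mA; rewrite bigcup_pred/=.
have [] : (P (\big[setU/set0]_(i | Q i) A i) <= \sum_(i | Q i) P (A i))%E /\
    measurable (\big[setU/set0]_(i | Q i) A i); last by [].
elim/big_ind2 : _ => [|B x C y [h1 h2] [h3 h4]|i _]; last by [].
  by rewrite measure0.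
split; last exact: measurableU.
by apply: le_trans (measureU2 _ h2 h4) _; exact: leeD.
Qed.

Definition scaled_energy (N : nat) (k : R) (w : Omega) : R :=
  2^-1 * \sum_j dyadic_energy T N (fun t => Num.sqrt k * W j t w).

Lemma scaled_energyE N k w : scaled_energy N k w =
  (\sum_(p : 'I_n.+1 * 'I_(2 ^ N)) (Num.sqrt k * increment N p.1 p.2 w) ^+ 2) /
  (2 * (T / 2 ^+ N)).
Proof.
rewrite -(pair_bigA _ (fun (j : 'I_n.+1) (i : 'I_(2 ^ N)) => (Num.sqrt k * increment N j i w) ^+ 2))/=.
rewrite /scaled_energy /dyadic_energy; set h := T / _.
rewrite [(2 * h)^-1]invfM [RHS]mulrCA; congr (_ * _).
by rewrite mulr_suml; apply: eq_bigr => j _; rewrite mulr_suml; apply: eq_bigr => i _; rewrite mulrBr.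
Qed.

(* Rounding the increments down to a grid leaves finitely many product events,
   each of which is estimated by independence and the Gaussian tail. *)
Lemma energy_tail (N : nat) (c c' : R) : 0 <= c' -> c' < c ->
  exists2 C, 0 < C & forall k, 0 < k ->
  exists2 A, measurable A & [set w | c <= scaled_energy N k w] `<=` A /\
    (P A <= (C * expR (- (c' / k)))%:E)%E.
Proof.
move=> c'0 c'c; set h := T / 2 ^+ N; have h0 : 0 < h := dyad_step_gt0 T0 N.
pose I := ('I_n.+1 * 'I_(2 ^ N))%type; pose m := #|{: I}|.
pose D := 2 * h * c; pose D' := 2 * h * c'.
have D'0 : 0 <= D' by rewrite !mulr_ge0// ltW.
have DD' : 0 < D - D' by rewrite subr_gt0 ltr_pM2l// mulr_gt0.
(* Increments are truncated at rho: a single one reaching rho suffices, as rho^2 >= D'. Below rho,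
   rounding down to multiples of eta = rho / K costs at most 2 rho eta + eta^2 for each square, and
   K is large enough for the m losses to stay within D - D'. *)
pose rho := D' + 1; have rho0 : 0 < rho by rewrite ltr_wpDl.
pose K := (Num.bound (3 * m%:R * rho ^+ 2 / (D - D'))).+1.
have hK : 3 * m%:R * rho ^+ 2 / (D - D') <= K%:R.
  apply: ltW; apply: lt_trans (archi_boundP _) _; last by rewrite ltr_nat.
  by rewrite divr_ge0 ?(ltW DD')// !mulr_ge0// ltW.
pose eta := rho / K%:R; have eta0 : 0 < eta by rewrite divr_gt0.
have etar : eta <= rho by rewrite ler_pdivrMr// ler_peMr ?(ltW rho0)// ler1n.
have K0 : (K%:R : R) != 0 by rewrite pnatr_eq0.
have Keta : K%:R * eta = rho by rewrite /eta mulrC divfK.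
have meta : m%:R * (2 * rho * eta + eta ^+ 2) <= D - D'.
  apply: (@le_trans _ _ (m%:R * (3 * rho * eta))).
    by apply: ler_wpM2l => //; rewrite expr2; nra.
  move: hK; rewrite ler_pdivrMr// /eta => hK.
  rewrite (_ : _ * _ = (3 * m%:R * rho ^+ 2) / K%:R); last by field.
  by rewrite ler_pdivrMr// [leRHS]mulrC.
pose Q (f : {ffun I -> 'I_K.+1}) := D' <= \sum_p ((f p)%:R * eta) ^+ 2.
pose B (f : {ffun I -> 'I_K.+1}) k := [set w | forall j (i : 'I_(2 ^ N)),
  (f (j, i))%:R * eta / Num.sqrt k <= `|increment N j i w|].
exists ((#|{ffun I -> 'I_K.+1}| * 2 ^ m)%:R + 1); first by rewrite ltr_wpDl.
move=> k k0; have sk0 : 0 < Num.sqrt k by rewrite sqrtr_gt0.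
have mB f : measurable (B f k).
  rewrite (_ : B f k = \bigcap_(j in setT) \bigcap_(i in [set: 'I_(2 ^ N)])
    (increment N j i @^-1` [set x | (f (j, i))%:R * eta / Num.sqrt k <= `|x|])).
    apply: fin_bigcap_measurable => // j _; apply: fin_bigcap_measurable => // i _.
    apply: measurable_increment_preimage; exact: measurable_abs_ge.
  by apply/seteqP; split=> [w H j _ i _|w H j i]; exact: H.
have PB f : Q f -> (P (B f k) <= ((2 ^ m)%:R * expR (- (c' / k)))%:E)%E.
  move=> Qf; rewrite /B (increment_independent (B := fun j i => [set x | (f (j, i))%:R * eta / Num.sqrt k <= `|x|])); last by move=> j i; exact: measurable_abs_ge.
  rewrite pair_bigA/=.
  have s0 : 0 < Num.sqrt h by rewrite sqrtr_gt0.
  apply: (@le_trans _ _ (\prod_p (2 * expR (- (((f p)%:R * eta) ^+ 2 / (2 * h) / k)))%:E)%E).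
    apply: lee_prod => -[j i] /=; rewrite measure_ge0/=.
    have a0 : 0 <= (f (j, i))%:R * eta / Num.sqrt k 
      by apply: divr_ge0; [apply: mulr_ge0 => //; exact: ltW|exact: ltW].
    apply: le_trans (normal_prob_tail s0 a0) _.
    set z := (f (j, i))%:R * eta.
    rewrite lee_fin ler_pM2l// ler_expR lerN2 expr_div_n !sqr_sqrtr ?(ltW h0) ?(ltW k0)//.
    rewrite le_eqVlt; apply/orP; left; apply/eqP; rewrite -/h.
    by field; rewrite !gt_eqF.
  rewrite prodEFin lee_fin big_split/= prodr_const -natrX -expR_sum.
  apply: ler_wpM2l => //; rewrite ler_expR sumrN lerN2 -mulr_suml -mulr_suml.
  rewrite ler_pM2r ?invr_gt0// ler_pdivlMr ?mulr_gt0// mulrC.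
  exact: Qf.
exists (\bigcup_(f in [set` Q]) B f k); first exact: fin_bigcup_measurable.
split; last first.
  apply: le_trans (boole_fin _ _) _ => //.
  apply: le_trans (lee_sum _ PB) _.
  rewrite sumEFin lee_fin sumr_const -[leLHS]mulr_natl mulrA ler_pM2r ?expR_gt0//.
  rewrite ler_wpDr// natrM ler_wpM2r// ler_nat max_card//.
move=> w; rewrite /= scaled_energyE ler_pdivlMr ?mulr_gt0// => hw.
pose y (p : I) := `|Num.sqrt k * increment N p.1 p.2 w|.
have {hw} hw : D <= \sum_p y p ^+ 2.
  rewrite /D mulrC (le_trans hw)//; apply: ler_sum => p _.
  by rewrite real_normK// num_real.
have y0 p : 0 <= y p by exact: normr_ge0.
pose f := [ffun p : I => inord (minn (Num.truncn (y p / eta)) K) : 'I_K.+1].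
have fE p : f p = minn (Num.truncn (y p / eta)) K :> nat.
  by rewrite ffunE inordK// ltnS geq_minr.
have fy p : (f p)%:R * eta <= y p.
  rewrite -ler_pdivlMr// fE (@le_trans _ _ (Num.truncn (y p / eta))%:R)//.
    by rewrite ler_nat geq_minl.
  by rewrite truncn_le divr_ge0// ltW.
exists f; last first.
  move=> j i; rewrite ler_pdivrMr//; apply: le_trans (fy (j, i)) _.
  by rewrite /y/= normrM (gtr0_norm sk0) mulrC.
change (D' <= \sum_p ((f p)%:R * eta) ^+ 2).
have [[p hp]|hlt] := pselect (exists p, rho <= y p).
  have fpK : f p = K :> nat.
    rewrite fE; apply/minn_idPr; rewrite truncn_ge_nat ?divr_ge0 ?(ltW eta0) ?(ltW rho0)//.
    by rewrite ler_pdivlMr// Keta.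
  rewrite (bigD1 p)//= fpK Keta ler_wpDr//.
    by apply: sumr_ge0 => q _; exact: sqr_ge0.
  by rewrite /rho; nra.
have ylt p : y p < rho by rewrite ltNge; apply/negP => ?; apply: hlt; exists p.
have fy' p : y p ^+ 2 <= ((f p)%:R * eta) ^+ 2 + (2 * rho * eta + eta ^+ 2).
  have fE' : f p = Num.truncn (y p / eta) :> nat.
    rewrite fE; apply/minn_idPl; rewrite truncn_le_nat ltr_pdivrMr// mulrC.
    apply: lt_trans (ylt p) _; rewrite -Keta -natr1 mulrDr mulr1 mulrC ltrDl//.
  have : y p < (f p)%:R * eta + eta.
    rewrite fE' -[X in _ + X]mul1r -mulrDl natr1 -ltr_pdivrMr//.
    exact: truncnS_gt.
  have := fy p; have := ylt p; have := y0 p.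
  have : 0 <= (f p)%:R * eta by rewrite mulr_ge0// ltW.
  by move: (_ * eta) (y p) => a b ? ? ? ? ?; rewrite !expr2; nra.
have : D <= \sum_p ((f p)%:R * eta) ^+ 2 + m%:R * (2 * rho * eta + eta ^+ 2).
  apply: le_trans hw _; rewrite mulr_natl -sumr_const -big_split/=.
  by apply: ler_sum => p _; exact: fy'.
lra.
Qed.

(* The event that some dyadic increment of level N + m, m > 0, exceeds
   (d / 3) (3 / 4) ^ m; these thresholds sum up to d. *)
Definition rough (N : nat) (dl k : R) : set Omega :=
  \bigcup_m \bigcup_(p in [set: 'I_n.+1 * 'I_(2 ^ (N + m.+1))])
    [set w | dl / 3 * (3 / 4) ^+ m.+1 <=
      `|Num.sqrt k * increment (N + m.+1) p.1 p.2 w|].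

Let measurable_rough_event N k j i (a : R) : 0 < k ->
  measurable [set w | a <= `|Num.sqrt k * increment N j i w|].
Proof.
move=> k0; have sk0 : 0 < Num.sqrt k by rewrite sqrtr_gt0.
rewrite (_ : [set w | _] = increment N j i @^-1` [set x | a / Num.sqrt k <= `|x|]); last first.
  by apply/seteqP; split=> w /=; rewrite normrM (gtr0_norm sk0) ler_pdivrMr// mulrC.
by apply: measurable_increment_preimage; exact: measurable_abs_ge.
Qed.

Lemma measurable_rough N dl k : 0 < k -> measurable (rough N dl k).
Proof.
move=> k0; apply: bigcup_measurable => m _; apply: fin_bigcup_measurable => // p _.
exact: measurable_rough_event.
Qed.

(** Union bound. At level N + q the Gaussian exponent is A (2 (3/4)^2)^q = A (9/8)^q >= A (1 + q /
    8): the ratio 3/4 exceeds 1 / sqrt 2, so the exponent grows with q. As A >= 24, exp (- A / 8) <=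
    1/4, which beats the 2^q cells and leaves a geometric series. *)
Lemma rough_tail N (dl k : R) : 0 < dl -> 0 < k ->
  24 * k <= dl ^+ 2 * 2 ^+ N / (18 * T) ->
  (P (rough N dl k) <=
    (n.+1%:R * 2 ^+ N.+1 * expR (- (dl ^+ 2 * 2 ^+ N / (18 * T) / k)))%:E)%E.
Proof.
move=> dl0 k0; set a := dl ^+ 2 * 2 ^+ N / (18 * T) => hk.
pose A := a / k.
have A24 : 24 <= A by rewrite /A ler_pdivlMr.
pose F m := \bigcup_(p in [set: 'I_n.+1 * 'I_(2 ^ (N + m.+1))])
    [set w | dl / 3 * (3 / 4) ^+ m.+1 <=
      `|Num.sqrt k * increment (N + m.+1) p.1 p.2 w|].
have mF m : measurable (F m).
  by apply: fin_bigcup_measurable => // p _; exact: measurable_rough_event.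
apply: le_trans (measure_sigma_subadditive _ mF (measurable_rough N dl k0) (@subset_refl _ _)) _.
have c0 : 0 <= n.+1%:R * 2 ^+ N.+1 * expR (- A).
  by rewrite mulr_ge0 ?expR_ge0// mulr_ge0// exprn_ge0.
apply: le_trans (epsilon_trick0 xpredT c0).
apply: lee_nneseries; first by move=> m _ _; exact: measure_ge0.
move=> m _.
have d0 : 0 <= dl / 3 * (3 / 4) ^+ m.+1.
  by rewrite mulr_ge0 ?exprn_ge0// ?divr_ge0// ltW.
rewrite /F (_ : [set: _] = [set` (xpredT : pred ('I_n.+1 * 'I_(2 ^ (N + m.+1))))]); last first.
  by apply/seteqP; split.
apply: le_trans (boole_fin _ _) _.
  by move=> p; exact: measurable_rough_event.
apply: (@le_trans _ _ (\sum_(p : 'I_n.+1 * 'I_(2 ^ (N + m.+1)))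
    (2 * expR (- ((dl / 3 * (3 / 4) ^+ m.+1) ^+ 2 / (2 * (T / 2 ^+ (N + m.+1))) / k)))%:E)%E).
  by apply: lee_sum => p _; exact: increment_tail.
rewrite sumEFin lee_fin sumr_const -[leLHS]mulr_natl.
have -> : #|xpredT : pred ('I_n.+1 * 'I_(2 ^ (N + m.+1)))| = (n.+1 * 2 ^ (N + m.+1))%N.
  by rewrite card_prod !card_ord.
rewrite natrM natrX.
have A0 : 0 <= A by exact: le_trans A24.
move: (m.+1) => q.
have E1 : expR (- A * (1 + q%:R * (1 / 8))) <= expR (- A) * (1 / 4) ^+ q.
  rewrite mulrDr mulr1 expRD ler_pM2l ?expR_gt0// mulrCA expRM_natl.
  apply: lerXn2r; rewrite ?nnegrE ?expR_ge0//.
  rewrite mulNr expRN -[leRHS]invrK lef_pV2 ?posrE ?expR_gt0//.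
  by apply: le_trans (expR_ge1Dx _); rewrite invf_div; lra.
have E2 : expR (- ((dl / 3 * (3 / 4) ^+ q) ^+ 2 / (2 * (T / 2 ^+ (N + q))) / k)) <=
   expR (- A * (1 + q%:R * (1 / 8))).
  rewrite ler_expR mulNr lerN2.
  apply: le_trans (ler_wpM2l A0 (one_add_le_expr q _)) _; first by [].
  rewrite le_eqVlt; apply/orP; left; apply/eqP.
  rewrite /A /a exprMn -exprM mulnC exprM exprD.
  have -> : (1 + 1 / 8 : R) = (3 / 4) ^+ 2 * 2 by rewrite expr2; field.
  rewrite exprMn; set x := (_ ^+ 2) ^+ q; set y := 2 ^+ q; set z := 2 ^+ N.
  by field; rewrite !gt_eqF// ?exprn_gt0.
apply: (@le_trans _ _ (n.+1%:R * (2 ^+ (N + q)) * (2 * (expR (- A) * (1 / 4) ^+ q)))).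
  apply: ler_wpM2l; first by rewrite mulr_ge0// exprn_ge0.
  by rewrite ler_pM2l//; exact: le_trans E1.
rewrite le_eqVlt; apply/orP; left; apply/eqP.
rewrite natrX exprD exprS (_ : (1 / 4 : R) = 2^-1 * 2^-1); last by field.
rewrite exprMn !exprVn; set y := 2 ^+ q; set z := 2 ^+ N; set e := expR _.
by field; rewrite gt_eqF// exprn_gt0.
Qed.

(** The scaled increments are confined to a box of half-width r around p. There the Gaussian
    exponent grows by at most r (2 |p| + 1) / (2 h) per coordinate, hence by at most e in total for
    r small. The interval length carries a factor 1 / sqrt k, bounded below by 1 when k <= 1. *)
Lemma increments_lower N (p : 'I_n.+1 -> 'I_(2 ^ N) -> R) (eta e : R) :
  0 < eta -> 0 < e ->
  exists2 C, 0 < C & forall k, 0 < k -> k <= 1 -> exists2 A, measurable A &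
    A `<=` [set w | forall j (i : 'I_(2 ^ N)), `|Num.sqrt k * increment N j i w - p j i| <= eta] /\
    ((C * expR (- (((\sum_j \sum_i (p j i) ^+ 2) / (2 * (T / 2 ^+ N)) + e) / k)))%:E <= P A)%E.
Proof.
move=> eta0 e0; set h := T / 2 ^+ N; have h0 : 0 < h := dyad_step_gt0 T0 N.
pose S := \sum_j \sum_i (2 * `|p j i| + 1).
have S0 : 0 <= S by apply: sumr_ge0 => j _; apply: sumr_ge0 => i _; rewrite addr_ge0// mulr_ge0.
pose r := Num.min eta (Num.min 1 (2 * h * e / (S + 1))).
have r0 : 0 < r by rewrite !lt_min eta0 ltr01/= divr_gt0// ?mulr_gt0// ltr_wpDl.
have reta : r <= eta by rewrite ge_min lexx.
have r1 : r <= 1 by rewrite !ge_min lexx orbT.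
have rS : r * S <= 2 * h * e.
  apply: (@le_trans _ _ (r * (S + 1))); first by rewrite ler_pM2l// lerDl.
  by rewrite -ler_pdivlMr ?ltr_wpDl// !ge_min lexx !orbT.
have s0 : 0 < Num.sqrt h by rewrite sqrtr_gt0.
pose c := 2 * r * normal_peak (Num.sqrt h).
have c0 : 0 < c by rewrite !mulr_gt0// normal_peak_gt0// gt_eqF.
exists (c ^+ #|{: 'I_n.+1 * 'I_(2 ^ N)}|); first exact: exprn_gt0.
move=> k k0 k1; have sk0 : 0 < Num.sqrt k by rewrite sqrtr_gt0.
have sk1 : Num.sqrt k <= 1 by rewrite -sqrtr1 ler_sqrt.
pose B j i := `[(p j i - r) / Num.sqrt k, (p j i + r) / Num.sqrt k]%classic.
have mB j i : measurable (B j i : set (measurableTypeR R)) by exact: measurable_itv.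
exists [set w | forall j (i : 'I_(2 ^ N)), B j i (increment N j i w)].
  rewrite (_ : [set w | _] = \bigcap_(j in setT) \bigcap_(i in [set: 'I_(2 ^ N)])
    (increment N j i @^-1` B j i)).
    apply: fin_bigcap_measurable => // j _; apply: fin_bigcap_measurable => // i _.
    exact: measurable_increment_preimage.
  by apply/seteqP; split=> [w H j _ i _|w H j i]; exact: H.
split.
  move=> w H j i; have := H j i; rewrite /B/= in_itv/= ler_pdivrMr// ler_pdivlMr//.
  rewrite [_ * Num.sqrt k]mulrC => /andP[h1 h2]; rewrite ler_norml.
  by apply/andP; split; lra.
rewrite (increment_independent (B := B))// -/h [leRHS]pair_bigA/=.
apply: (@le_trans _ _ (\prod_(q : 'I_n.+1 * 'I_(2 ^ N))
    (c * expR (- ((`|p q.1 q.2| + r) ^+ 2 / (2 * h) / k)))%:E)%E).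
  rewrite prodEFin lee_fin big_split/= prodr_const -expR_sum.
  apply: ler_wpM2l; first by rewrite exprn_ge0// ltW.
  rewrite ler_expR sumrN lerN2 -mulr_suml -mulr_suml ler_pM2r ?invr_gt0//.
  rewrite -(ler_pM2r (_ : 0 < 2 * h)) ?mulr_gt0// divfK ?gt_eqF ?mulr_gt0//.
  rewrite mulrDl divfK ?gt_eqF ?mulr_gt0//.
  rewrite -(pair_bigA _ (fun (j : 'I_n.+1) (i : 'I_(2 ^ N)) => (`|p j i| + r) ^+ 2))/=.
  apply: (@le_trans _ _ (\sum_j \sum_i (p j i) ^+ 2 + r * S)); last first.
    by rewrite lerD2l [leRHS]mulrC.
  rewrite /S mulr_sumr -big_split/=; apply: ler_sum => j _.
  rewrite mulr_sumr -big_split/=; apply: ler_sum => i _.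
  rewrite -[p j i ^+ 2]real_normK ?num_real//.
  have := normr_ge0 (p j i); move: `|p j i| => x x0; rewrite !expr2; nra.
apply: lee_prod => -[j i] /=.
rewrite lee_fin mulr_ge0 ?expR_ge0 ?(ltW c0)//=.
pose M := (`|p j i| + r) / Num.sqrt k.
have ab : (p j i - r) / Num.sqrt k <= (p j i + r) / Num.sqrt k.
  by rewrite ler_pM2r ?invr_gt0//; lra.
apply: le_trans (normal_prob_itv_ge s0 (M := M) ab _); last first.
  move=> x /andP[]; rewrite ler_pdivrMr// ler_pdivlMr// => x1 x2.
  rewrite /M ler_pdivlMr// -{1}(gtr0_norm sk0) -normrM ler_norml.
  have := ler_norm (p j i); have := ler_norm (- p j i); rewrite normrN => y1 y2.
  by apply/andP; split; lra.
rewrite lee_fin -mulrBl opprD opprK addrACA subrr add0r -mulr2n -[r *+ 2]mulr_natl.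
have -> : M ^+ 2 / (2 * Num.sqrt h ^+ 2) = (`|p j i| + r) ^+ 2 / (2 * h) / k.
  by rewrite /M expr_div_n !sqr_sqrtr ?(ltW h0) ?(ltW k0)//; field; rewrite !gt_eqF.
rewrite /c; set x := normal_peak _; set E := expR _.
rewrite (_ : 2 * r / Num.sqrt k * (x * E) = 2 * r * x * E * (Num.sqrt k)^-1); last by ring.
rewrite ler_peMr ?invf_ge1//.
by rewrite !mulr_ge0 ?expR_ge0 ?normal_peak_ge0 ?(ltW r0).
Qed.

End brownian_increments.

(** * Sublevel sets of the potential *)

Section configurations.
Context {R : realType} (n : nat).
Implicit Types (x y : 'rV[R]_n.+1) (k : 'rV[int]_n.+1).

Lemma row_norm_coord (x : 'rV[R]_n.+1) j : `|x 0 j| <= `|x|.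
Proof.
rewrite [leRHS]mx_normrE.
exact: (le_bigmax _ (fun i : 'I_1 * 'I_n.+1 => `|x i.1 i.2|) (0, j)).
Qed.

Lemma row_norm_le (x : 'rV[R]_n.+1) (e : R) : 0 <= e ->
  (forall j, `|x 0 j| <= e) -> `|x| <= e.
Proof.
move=> e0 h; rewrite [leLHS]mx_normrE; apply: bigmax_le => // -[i j] _ /=.
by rewrite ord1.
Qed.

Lemma lattice_shiftE k x :
  lattice_shift k x = x + \row_j (2 * pi * (k 0 j)%:~R).
Proof. by apply/rowP => j; rewrite !mxE. Qed.

Lemma lattice_shiftB k x y : lattice_shift k x - lattice_shift k y = x - y.
Proof. by rewrite !lattice_shiftE opprD addrACA subrr addr0. Qed.

Lemma lattice_shiftD k k' x :
  lattice_shift k (lattice_shift k' x) = lattice_shift (k + k') x.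
Proof. by apply/rowP => j; rewrite !mxE intrD; ring. Qed.

Lemma torus_conf_shift k x : torus_conf (lattice_shift k x) <-> torus_conf x.
Proof.
split=> -[k' h]; last by exists (k' - k); rewrite lattice_shiftD subrK.
by exists (k' + k); rewrite -lattice_shiftD.
Qed.

Lemma angle_dist x y j : `|angle x j - angle y j| <= `|x - y|.
Proof.
rewrite /angle opprD addrACA subrr addr0.
by have := row_norm_coord (x - y) (inord (j %% n.+1)); rewrite !mxE.
Qed.

Definition spacing x (j : nat) : R := angle x j.+1 - angle x j.

Lemma spacing_dist x y j : `|spacing x j - spacing y j| <= 2 * `|x - y|.
Proof.
have -> : spacing x j - spacing y j =
  (angle x j.+1 - angle y j.+1) - (angle x j - angle y j) by rewrite /spacing; ring.
apply: le_trans (ler_normB _ _) _.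
by rewrite mulr_natl mulr2n lerD ?angle_dist.
Qed.

Lemma ordered_repE x : ordered_rep x <-> forall j : 'I_n.+1, 0 < spacing x j.
Proof.
by split=> h j; have := h j; rewrite /spacing subr_gt0.
Qed.

Lemma gap_spacing x (j : 'I_n.+1) : ordered_rep x -> gap x j = spacing x j.
Proof. by move=> /ordered_repE/(_ j) h; rewrite /gap ger0_norm// ltW. Qed.

Lemma sum_spacing x : \sum_(j < n.+1) spacing x j = 2 * pi.
Proof.
rewrite -(big_mkord xpredT (spacing x)) telescope_sumr// /angle.
rewrite modnn divnn/= mod0n div0n !mulr0 addr0 mulr1; ring.
Qed.

Lemma min_gap_gtP x (e : R) : ordered_rep x ->
  (e < min_gap x) <-> forall j : 'I_n.+1, e < spacing x j.
Proof.
move=> ox; rewrite /min_gap; split=> [/bigmin_gtP[_ h] j|h].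
  by rewrite -gap_spacing//; exact: h.
apply/bigmin_gtP; split; first by have := h ord0; rewrite -gap_spacing.
by move=> j _; rewrite gap_spacing.
Qed.

Lemma min_gap_attained x : ordered_rep x ->
  (exists j : 'I_n.+1, min_gap x = spacing x j) /\
  forall j : 'I_n.+1, min_gap x <= spacing x j.
Proof.
move=> ox; split; last by move=> j; rewrite -gap_spacing//; exact: bigmin_le.
rewrite /min_gap; elim/big_ind : _ => [|a b [i ->] [j ->]|j _].
- by exists ord0; rewrite -(gap_spacing ord0).
- by rewrite /Num.min; case: ifP => _; [exists i|exists j].
- by exists j; rewrite gap_spacing.
Qed.

Lemma pi2_gt0 : 0 < 2 * pi :> R.
Proof. by rewrite mulr_gt0// pi_gt0. Qed.

Lemma spacing_le x (j : 'I_n.+1) : ordered_rep x -> spacing x j <= 2 * pi.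
Proof.
move=> /ordered_repE h; rewrite -(sum_spacing x) (bigD1 j)//= lerDl.
by apply: sumr_ge0 => i _; exact: ltW.
Qed.

(* Two ordered representatives have the same spacings: the difference of two
   numbers in ]0, 2 pi] is a multiple of 2 pi only if it is zero. *)
Lemma spacing_shift k x (j : 'I_n.+1) : ordered_rep x ->
  ordered_rep (lattice_shift k x) -> spacing (lattice_shift k x) j = spacing x j.
Proof.
move=> ox okx; have /ordered_repE/(_ j) a0 := ox; have a1 := spacing_le j ox.
have /ordered_repE/(_ j) b0 := okx; have b1 := spacing_le j okx.
have [z E] : exists z : int, spacing (lattice_shift k x) j = spacing x j + 2 * pi * z%:~R.
  exists (k 0 (inord (j.+1 %% n.+1)) - k 0 (inord (j %% n.+1))).
  by rewrite /spacing /angle !mxE intrB; ring.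
move: b0 b1; rewrite E => b0 b1; have p0 := pi2_gt0.
suff -> : z = 0 by rewrite mulr0 addr0.
have z1 : (z%:~R < 1 :> R) by nra.
have z2 : (-1 < z%:~R :> R) by nra.
move: z1 z2; rewrite -[1]/(1%:~R) -[- 1]/((-1)%:~R) !ltr_int; lia.
Qed.

Lemma torus_conf_epsE x (e : R) : ordered_rep x ->
  torus_conf_eps e x <-> e < min_gap x.
Proof.
have z0 y : lattice_shift (0 : 'rV[int]_n.+1) y = y.
  by apply/rowP => j; rewrite !mxE mulr0 addr0.
move=> ox; split=> [[k [ok ek]]|ex]; last by exists 0; rewrite z0.
apply/(min_gap_gtP _ ox) => j; rewrite -(spacing_shift j ox ok).
exact: (min_gap_gtP _ ok).1 ek j.
Qed.

Definition equispaced x : 'rV[R]_n.+1 := \row_j (x 0 0 + 2 * pi / n.+1%:R * j%:R).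

Lemma spacing_mix x (s : R) j :
  spacing (x + s *: (equispaced x - x)) j =
  (1 - s) * spacing x j + s * (2 * pi / n.+1%:R).
Proof.
have n0 : (n.+1%:R : R) != 0 by rewrite pnatr_eq0.
have E i : angle (x + s *: (equispaced x - x)) i =
   (1 - s) * angle x i + s * (x 0 0 + 2 * pi / n.+1%:R * i%:R).
  rewrite /angle !mxE inordK ?ltn_mod//.
  have -> : (i%:R : R) = (i %/ n.+1)%:R * n.+1%:R + (i %% n.+1)%:R.
    by rewrite -natrM -natrD -divn_eq.
  by field.
by rewrite /spacing !E -natr1; ring.
Qed.

(** Moving towards the equispaced configuration pushes every spacing strictly above the minimal gap
    of x, so x is in the closure; the strict inequality in the set excludes x itself. *)
Lemma boundary_torus_conf_eps x : ordered_rep x ->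
  min_gap x < 2 * pi / n.+1%:R -> boundary (torus_conf_eps (min_gap x)) x.
Proof.
move=> ox lt; have [_ hmin] := min_gap_attained ox; split; last first.
  by move=> /interior_subset /(torus_conf_epsE _ ox); rewrite ltxx.
move=> B /nbhs_ballP[e /= e0 eB].
have m0 : 0 < min_gap x.
  by have [[j ->] _] := min_gap_attained ox; exact: (ordered_repE x).1.
pose v := equispaced x - x.
pose s := Num.min 1 (e / (2 * (`|v| + 1))).
have v1 : 0 < `|v| + 1 by rewrite ltr_wpDl.
have s0 : 0 < s by rewrite lt_min ltr01 divr_gt0// mulr_gt0.
have s1 : s <= 1 by rewrite ge_min lexx.
have sv : s * `|v| < e.
  apply: (@le_lt_trans _ _ (e / 2)); last by lra.
  apply: (@le_trans _ _ (s * (`|v| + 1))); first by rewrite ler_pM2l// lerDl.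
  rewrite -ler_pdivlMr// /s ge_min; apply/orP; right.
  by rewrite invfM mulrA.
have sp (j : 'I_n.+1) : min_gap x < spacing (x + s *: v) j.
  rewrite /v spacing_mix; have := hmin j; move: (2 * pi / n.+1%:R) lt => z lt.
  by move: (spacing x j) => y; nra.
have oy : ordered_rep (x + s *: v).
  by apply/ordered_repE => j; apply: lt_trans (sp j).
exists (x + s *: v); split.
  by apply/(torus_conf_epsE _ oy); apply/(min_gap_gtP _ oy).
apply: eB; rewrite -ball_normE /= opprD addrA subrr add0r normrN normrZ.
by rewrite gtr0_norm.
Qed.

End configurations.

(** * Uniform control of the potential on sublevel sets *)

Section sublevels.
Context {R : realType} (n : nat) (U : 'rV[R]_n.+1 -> R).
Hypothesis U_dyson : dyson_type_potential U.
Implicit Types (x y : 'rV[R]_n.+1) (k : 'rV[int]_n.+1).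

Definition sublevel (M : R) : set 'rV[R]_n.+1 := [set x | torus_conf x /\ U x <= M].

Lemma sublevel_shift M k x : sublevel M x -> sublevel M (lattice_shift k x).
Proof.
have [Up _ _ _ _] := U_dyson.
by move=> [cx Ux]; split; [exact/torus_conf_shift|rewrite Up].
Qed.

(** A configuration of small minimal gap m lies on the boundary of [torus_conf_eps m], where U is
    large. This membership was shown only for m below the equispaced value, hence the second term of
    the minimum. *)
Lemma sublevel_spacing (M : R) : exists2 e, 0 < e &
  forall x, ordered_rep x -> U x <= M -> forall j : 'I_n.+1, e <= spacing x j.
Proof.
have [_ _ _ Ub _] := U_dyson.
have /= := Ub; move=> /cvgeyPgt/(_ M).
move=> [e1 /= e10 He1].
exists (Num.min (e1 / 2) (2 * pi / n.+1%:R)).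
  by rewrite lt_min divr_gt0// divr_gt0// pi2_gt0.
move=> x ox UM j; have [[i Ei] hmin] := min_gap_attained ox.
rewrite leNgt; apply/negP => lt.
have m0 : 0 < min_gap x by rewrite Ei; exact: (ordered_repE x).1.
have := le_lt_trans (hmin j) lt; rewrite lt_min => /andP[m1 m2].
have b := boundary_torus_conf_eps ox m2.
have /= := He1 (min_gap x); rewrite sub0r normrN gtr0_norm// => /(_ _ m0) H.
have : (M%:E < (U x)%:E)%E.
  apply: lt_le_trans (H _) _; first by lra.
  by apply: ereal_inf_lbound; exists x.
by rewrite lte_fin ltNge UM.
Qed.

Lemma torus_conf_near_sublevel (M : R) : exists2 e, 0 < e &
  forall x, sublevel M x -> forall y, `|y - x| < e -> torus_conf y.
Proof.
have [Up _ _ _ _] := U_dyson.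
have [e e0 He] := sublevel_spacing M.
exists (e / 2); first exact: divr_gt0.
move=> x [[k ok] UM] y yx; exists k; apply/ordered_repE => j.
have := He _ ok; rewrite Up; last by exists k.
move=> /(_ UM j) h.
have := spacing_dist (lattice_shift k x) (lattice_shift k y) j.
rewrite lattice_shiftB distrC => d.
have := ler_norm (spacing (lattice_shift k x) j - spacing (lattice_shift k y) j).
rewrite distrC => n1; rewrite distrC in yx.
by lra.
Qed.

(** Each configuration belongs to the sublevel set of its own potential. *)
Lemma open_torus_conf : open (@torus_conf R n).
Proof.
rewrite openE => x cx; have [e e0 He] := torus_conf_near_sublevel (U x).
apply/nbhs_ballP; exists e => // y; rewrite -ball_normE/= => xy.
by apply: (He x) => //; rewrite distrC.
Qed.

(** A limit point is still a configuration because a uniform neighbourhood of the sublevel set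
    consists of configurations; then U is continuous there. *)
Lemma sublevel_closed M : closed (sublevel M).
Proof.
have [_ _ UC _ _] := U_dyson.
move=> x clx; have [e e0 He] := torus_conf_near_sublevel M.
have [y [My]] := clx _ (nbhsx_ballx x e e0); rewrite -ball_normE/= => xy.
have cx : torus_conf x by exact: He xy.
split => //; have [cU _ _] := UC x cx.
rewrite leNgt; apply/negP => lt.
have : \forall z \near x, M < U z by exact: (cvgr_gt (U x) cU).
by move=> /clx[z [[_ zM]]]; rewrite /= ltNge zM.
Qed.

Lemma partial_shift (f : 'rV[R]_n.+1 -> R) j :
  (forall x, torus_conf x -> forall k, f (lattice_shift k x) = f x) ->
  forall x, torus_conf x -> forall k, partial j f (lattice_shift k x) = partial j f x.
Proof.
move=> pf x cx k; rewrite /partial.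
have -> : 'D_(delta_mx 0 j) f x = 'D_(delta_mx 0 j) (f \o lattice_shift k) x.
  apply: near_eq_derive.
  have : \forall z \near x, torus_conf z.
    by apply: open_nbhs_nbhs; split => //; exact: open_torus_conf.
  by apply: filterS => z cz /=; rewrite pf.
have E : (fun h : R => h^-1 *: ((f \o shift (lattice_shift k x)) (h *: delta_mx 0 j)
      - f (lattice_shift k x))) =
    (fun h : R => h^-1 *: (((f \o lattice_shift k) \o shift x) (h *: delta_mx 0 j)
      - (f \o lattice_shift k) x)).
  by apply/funext => h /=; rewrite /shift/= !lattice_shiftE addrA.
by rewrite /derive E.
Qed.

Lemma line_mvt (f : 'rV[R]_n.+1 -> R) (z v : 'rV[R]_n.+1) (a : R) :
  (forall s, `|s| <= `|a| -> derivable f (z + s *: v) v) ->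
  exists2 s, `|s| <= `|a| & f (z + a *: v) - f z = 'D_v f (z + s *: v) * a.
Proof.
move=> df; pose g (s : R) := f (z + s *: v).
have dg (s : R) : `|s| <= `|a| -> is_derive s 1 g ('D_v f (z + s *: v)).
  move=> sa; have E : (fun h => h^-1 *: ((g \o shift s) (h *: 1) - g s)) =
      (fun h => h^-1 *: ((f \o shift (z + s *: v)) (h *: v) - f (z + s *: v))).
    apply/funext => h /=; rewrite /g /shift/=; congr (_ *: (f _ - _)).
    by rewrite [h%:A]mulr1 scalerDl addrCA.
  apply: DeriveDef; first by rewrite /derivable E; exact: df.
  by rewrite /derive E.
have mvt p q : p <= q -> (forall s, p <= s <= q -> `|s| <= `|a|) ->
    exists2 s, `|s| <= `|a| & g q - g p = 'D_v f (z + s *: v) * (q - p).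
  move=> pq H; have [||c] := @MVT_segment R g (fun s => 'D_v f (z + s *: v)) p q pq.
  - by move=> s; rewrite in_itv/= => /andP[ps sq]; apply: dg; apply: H; rewrite !ltW.
  - apply: derivable_within_continuous => s; rewrite in_itv/= => /H/dg.
    by move=> ?; exact: ex_derive.
  by rewrite in_itv/= => /H ca E; exists c.
have g0 : g 0 = f z by rewrite /g scale0r addr0.
have [a0|a0] := leP 0 a.
  have [|s sa E] := mvt 0 a a0; first by move=> s /andP[s0 sa]; rewrite !ger0_norm.
  by exists s => //; rewrite -g0 -/(g a) E subr0.
have [|s sa E] := mvt a 0 (ltW a0).
  by move=> s /andP[as_ s0]; rewrite !ler0_norm ?(ltW a0)// lerN2.
by exists s => //; rewrite -g0 -/(g a) -opprB E sub0r mulrN opprK.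
Qed.

(** Only partial derivatives are available, so the coordinates are changed one at a time, each with
    its own intermediate point; in the maximum norm all these points stay within |y - x| of x. *)
Lemma row_mvt (f : 'rV[R]_n.+1 -> R) (x y : 'rV[R]_n.+1) :
  (forall z j, `|z - x| <= `|y - x| -> derivable f z (delta_mx 0 j)) ->
  exists2 zt : 'I_n.+1 -> 'rV[R]_n.+1, forall j, `|zt j - x| <= `|y - x| &
    f y - f x = \sum_j partial j f (zt j) * (y 0 j - x 0 j).
Proof.
move=> df; pose w (i : nat) : 'rV[R]_n.+1 := \row_j (if (j < i)%N then y 0 j else x 0 j).
have wS (i : 'I_n.+1) : w i.+1 = w i + (y 0 i - x 0 i) *: delta_mx 0 i.
  apply/rowP => j; rewrite !mxE eqxx/= ltnS leq_eqVlt.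
  have [ji|ji] := eqVneq j i; first by rewrite ji eqxx/= ltnn mulr1 addrC subrK.
  by rewrite (negbTE (_ : val j != val i))//= mulr0 addr0.
have nearx (i : 'I_n.+1) s : `|s| <= `|y 0 i - x 0 i| ->
    `|w i + s *: delta_mx 0 i - x| <= `|y - x|.
  move=> hs; apply: row_norm_le => // j; rewrite !mxE eqxx/=.
  have := row_norm_coord (y - x) j; rewrite !mxE => cj.
  have [ji|ji] := eqVneq j i.
    by rewrite ji ltnn mulr1 addrAC subrr add0r (le_trans hs)// -ji.
  by rewrite mulr0 addr0; case: ifP => // _; rewrite subrr normr0.
have /choice[s hs] : forall i : 'I_n.+1, exists s, `|s| <= `|y 0 i - x 0 i| /\
    f (w i.+1) - f (w i) = partial i f (w i + s *: delta_mx 0 i) * (y 0 i - x 0 i).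
  move=> i; have [|s s1 s2] := @line_mvt f (w i) (delta_mx 0 i) (y 0 i - x 0 i).
    by move=> s hs; apply: df; exact: nearx.
  by exists s; split => //; rewrite wS.
exists (fun i : 'I_n.+1 => (w i + s i *: delta_mx 0 i : 'rV[R]_n.+1)).
  by move=> i; apply: nearx; have [] := hs i.
have -> : y = w n.+1 by apply/rowP => j; rewrite mxE ltn_ord.
have -> : x = w 0%N by apply/rowP => j; rewrite mxE.
rewrite -(telescope_sumr (fun i => f (w i)))// big_mkord; apply: eq_bigr => i _.
by have [_ ->] := hs i; rewrite !mxE ltn_ord.
Qed.

(** One parameter c gives both the bound and the inverse radius, so that the covering argument has a
    single quantity to send to infinity. *)
Let bounded_near (c : R) x := forall y, `|y - x| <= c^-1 ->
  [/\ torus_conf y, (forall j, `|partial j U y| <= c) &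
      (forall i j, `|partial i (partial j U) y| <= c)].

(** Up to lattice shifts, which change neither U nor its derivatives, the points lie in a cube of
    side 2 pi, where the sublevel set is compact. *)
Let local_bounds M : exists2 c, 0 < c & forall x, sublevel M x -> bounded_near c x.
Proof.
have [Up _ UC _ _] := U_dyson.
pose K := [set x : 'rV[R]_n.+1 | forall j, `[0, 2 * pi]%classic (x ord0 j)] `&` sublevel M.
have cK : compact K.
  apply: compact_closedI; last exact: sublevel_closed.
  by apply: (@rV_compact _ n.+1 (fun=> `[0, 2 * pi]%classic)) => _; exact: segment_compact.
have := (compact_near_coveringP K).1 cK R (pinfty_nbhs R) bounded_near _.
move=> [|c0 [c0r Hc]].
  move=> x [_ [cx _]].
  have [_ U1 U2] := UC x cx.
  pose C := 1 + \sum_j `|partial j U x| + \sum_i \sum_j `|partial i (partial j U) x|.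
  have sum_ge (F : 'I_n.+1 -> R) i : (forall l, 0 <= F l) -> F i <= \sum_l F l.
    by move=> F0; rewrite (bigD1 i)//= lerDl sumr_ge0.
  have S2 i := sum_ge (fun j => `|partial i (partial j U) x|).
  have S1 := sum_ge (fun j => `|partial j U x|) _ (fun=> normr_ge0 _).
  have S20 i : 0 <= \sum_j `|partial i (partial j U) x| by exact: sumr_ge0.
  have S3 := sum_ge (fun i => \sum_j `|partial i (partial j U) x|) _ S20.
  have C1 j : `|partial j U x| + 1 <= C.
    by have := S1 j; have := S3 j; have := S20 j; rewrite /C; lra.
  have C2 i j : `|partial i (partial j U) x| + 1 <= C.
    have := S2 i j (fun=> normr_ge0 _); have := S3 i.
    have S10 : 0 <= \sum_j `|partial j U x| by exact: sumr_ge0.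
    by rewrite /C; lra.
  have : \forall y \near x, [/\ torus_conf y, (forall j, `|partial j U y| <= C) &
      (forall i j, `|partial i (partial j U) y| <= C)].
    have nb (g : 'rV[R]_n.+1 -> R) : {for x, continuous g} -> `|g x| + 1 <= C ->
        \forall y \near x, `|g y| <= C.
      move=> cg gC; have := cvgr_norm_le (g x) cg (`|g x| + 1) _.
      move=> /(_ _)[|e e0 He]; first by rewrite ltrDl.
      by exists e => // y /He/le_trans; apply.
    near=> y; split.
    - by near: y; apply: open_nbhs_nbhs; split => //; exact: open_torus_conf.
    - by near: y; apply: filter_forall => j; apply: nb => //; have [] := U1 j.
    - near: y; apply: filter_forall => i; apply: filter_forall => j.
      by apply: nb => //; have [] := U2 i j.
  move=> /nbhs_ballP[e /= e0 He].
  (* Half of the radius e is spent on moving the centre, the other half on c^-1 < e / 2. *)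
  exists (ball x (e / 2), [set c | Num.max C (2 / e) < c]) => /=.
    split; first by apply: nbhsx_ballx; exact: divr_gt0.
    by exists (Num.max C (2 / e)); split; rewrite ?num_real.
  move=> [x' c] [/=]; rewrite -ball_normE/= gt_max => xx' /andP[cC ce] y yx'.
  have c0 : 0 < c by apply: lt_trans ce; rewrite divr_gt0.
  have [] := He y.
    rewrite -ball_normE/=; have -> : x - y = (x - x') + (x' - y) by rewrite addrA subrK.
    apply: le_lt_trans (ler_normD _ _) _.
    have : c^-1 < e / 2 by rewrite -invf_div ltf_pV2 ?posrE// divr_gt0.
    by move: yx' xx'; rewrite [`|y - x'|]distrC; lra.
  move=> h1 h2 h3; split => // [j|i j].
    exact: le_trans (h2 j) (ltW cC).
  exact: le_trans (h3 i j) (ltW cC).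
pose c := Num.max c0 0 + 1.
have c0' : 0 < c by rewrite ltr_pwDr// le_max lexx orbT.
have {}Hc : K `<=` bounded_near c.
  by apply: Hc; rewrite /c ltr_pwDr// le_max lexx.
exists c => // x sx y yx.
pose k : 'rV[int]_n.+1 := \row_j (- Num.floor (x 0 j / (2 * pi))).
have kx : K (lattice_shift k x).
  split; last exact: sublevel_shift.
  move=> j; rewrite /= in_itv/= !mxE.
  have /andP[f1 f2] := floor_itv (x 0 j / (2 * pi)).
  move: f1 f2; rewrite intrD mulrNz ler_pdivlMr ?pi2_gt0// ltr_pdivrMr ?pi2_gt0//.
  by have := @pi2_gt0 R; move: (2 * pi) => p p0 f1 f2; apply/andP; split; nra.
have [|/torus_conf_shift cy h1 h2] := Hc _ kx (lattice_shift k y).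
  by rewrite lattice_shiftB.
have pU j z : torus_conf z -> forall k, partial j U (lattice_shift k z) = partial j U z.
  by move=> cz k'; exact: (partial_shift j Up cz).
split; first exact: cy.
  by move=> j; rewrite -(pU j y cy k); exact: h1.
by move=> i j; rewrite -(partial_shift i (pU j) cy k); exact: h2.
Unshelve. all: by end_near. Qed.

Lemma local_control (M : R) : exists r L, [/\ 0 < r, 0 < L &
  forall x, sublevel M x -> forall y, `|y - x| <= r ->
  [/\ torus_conf y,
      forall j, `|partial j U y| <= L,
      forall j, `|partial j U y - partial j U x| <= L * `|y - x|,
      `|U y - U x| <= L * `|y - x| &
      U y - U x <= \sum_j partial j U x * (y 0 j - x 0 j) + L * `|y - x| ^+ 2]].
Proof.
have [Up _ UC _ _] := U_dyson.
have [c c0 Hc] := local_bounds M.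
have n1 : 1 <= n.+1%:R :> R by rewrite ler1n.
exists c^-1, (n.+1%:R ^+ 2 * c); split; [by rewrite invr_gt0|by rewrite mulr_gt0// exprn_gt0|].
move=> x sx y yx; have [cy b1 b2] := Hc x sx y yx.
have nc : c <= n.+1%:R ^+ 2 * c by rewrite ler_peMl ?(ltW c0)// expr_ge1// (le_trans ler01).
have nc' : n.+1%:R * c <= n.+1%:R ^+ 2 * c.
  by rewrite ler_pM2r// expr2 ler_peMl// (le_trans ler01).
have lip (f : 'rV[R]_n.+1 -> R) (z : 'rV[R]_n.+1) : `|z - x| <= `|y - x| ->
    (forall t j, `|t - x| <= c^-1 -> derivable f t (delta_mx 0 j)) ->
    (forall t j, `|t - x| <= c^-1 -> `|partial j f t| <= c) ->
    `|f z - f x| <= n.+1%:R * c * `|z - x|.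
  move=> zy df bf; have zx := le_trans zy yx.
  have [t j tz|zt hzt ->] := @row_mvt f x z; first by apply: df; exact: le_trans zx.
  apply: le_trans (ler_norm_sum _ _ _) _.
  have -> : n.+1%:R * c * `|z - x| = \sum_(j < n.+1) c * `|z - x|.
    by rewrite sumr_const card_ord -mulrA mulr_natl.
  apply: ler_sum => j _; rewrite normrM; apply: ler_pM => //.
    by apply: bf; exact: le_trans zx.
  by have := row_norm_coord (z - x) j; rewrite !mxE.
have dU t j : `|t - x| <= c^-1 -> derivable U t (delta_mx 0 j).
  by move=> tx; have [ct _ _] := Hc x sx t tx; have [_ /(_ j)[]] := UC t ct.
have dU2 i t j : `|t - x| <= c^-1 -> derivable (partial i U) t (delta_mx 0 j).
  by move=> tx; have [ct _ _] := Hc x sx t tx; have [_ _ /(_ j i)[]] := UC t ct.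
have lipU i z : `|z - x| <= `|y - x| ->
    `|partial i U z - partial i U x| <= n.+1%:R * c * `|z - x|.
  move=> zy; apply: lip => // t j tx; first exact: dU2.
  by have [_ _] := Hc x sx t tx; apply.
split => //.
- by move=> j; exact: le_trans (b1 j) nc.
- by move=> j; apply: le_trans (lipU j y (lexx _)) _; rewrite ler_wpM2r.
- apply: le_trans (_ : n.+1%:R * c * `|y - x| <= _); last by rewrite ler_wpM2r.
  apply: lip; [exact: lexx|exact: dU|move=> t j tx].
  by have [_ + _] := Hc x sx t tx; apply.
have [t j tz|zt hzt ->] := @row_mvt U x y; first by apply: dU; exact: le_trans yx.
have -> : n.+1%:R ^+ 2 * c * `|y - x| ^+ 2 =
    \sum_(j < n.+1) (n.+1%:R * c * `|y - x|) * `|y - x|.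
  by rewrite sumr_const card_ord -[RHS]mulr_natl; ring.
rewrite -big_split/=; apply: ler_sum => j _.
rewrite -lerBlDl -mulrBl; apply: le_trans (ler_norm _) _; rewrite normrM.
apply: ler_pM => //.
  apply: le_trans (lipU j _ (hzt j)) _.
  by rewrite ler_wpM2l// mulr_ge0// ltW.
by have := row_norm_coord (y - x) j; rewrite !mxE.
Qed.

End sublevels.

(** * Paths and their noise *)

Lemma ultra_cvg_image (S : Type) (V : topologicalType) (F : set_system S) (f : S -> V)
    (K : set V) : UltraFilter F -> compact K -> F (f @^-1` K) ->
  exists2 p, K p & f @ F --> p.
Proof.
move=> FU cK FK; have [p [Kp cp]] := cK (f @ F) _ FK.
exists p => // B nB /=; rewrite /fmap/=.
have [//|FB] := in_ultra_setVsetC (f @^-1` B) FU.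
have [y [/= nBy By]] := cp (~` B) B FB nB.
by case: nBy.
Qed.

(** * A bootstrap principle for continuous functions *)

Section first_crossing.
Context {R : realType}.

(** At the first time where f >= c, the bound f <= c holds up to and including that time by
    continuity, so the hypothesis makes it strict: a contradiction. *)
Lemma first_crossing (f : R -> R) (a b c : R) : continuous f -> f a <= c ->
  (forall t, a <= t <= b -> (forall s, a <= s <= t -> f s <= c) -> f t < c) ->
  forall t, a <= t <= b -> f t <= c.
Proof.
move=> cf fa H t0 /andP[at0 t0b]; rewrite leNgt; apply/negP => ft0.
pose S := [set t | a <= t <= b /\ c <= f t].
have S0 : S t0 by split; [rewrite at0 t0b|exact: ltW].
have lbS : lbound S a by move=> t [/andP[]].
have infS : has_inf S by split; [exists t0|exists a].
set t := inf S.
have at' : a <= t by apply: lb_le_inf => //; exists t0.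
have tt0 : t <= t0 by apply: ge_inf => //; exists a.
have tb : t <= b := le_trans tt0 t0b.
have cS : closed S.
  have -> : S = `[a, b]%classic `&` f @^-1` [set x | c <= x].
    by apply/seteqP; split=> x /=; rewrite in_itv.
  apply: closedI; first exact: itv_closed.
  by apply: closed_comp => [x _|]; [exact: cf|exact: closed_ge].
have [_ ct] : S t.
  apply: cS => B /nbhs_ballP[e /= e0 Be].
  have [s Ss st] := inf_adherent e0 infS.
  exists s; split => //; apply: Be; rewrite -ball_normE/= distrC ger0_norm ?subr_ge0.
    by rewrite ltrBlDl.
  by apply: ge_inf Ss; exists a.
have lt s : a <= s -> s < t -> f s < c.
  move=> as' st; rewrite ltNge; apply/negP => cs.
  have : t <= s by apply: ge_inf; [exists a|split => //; rewrite as' (le_trans (ltW st) tb)].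
  by rewrite leNgt st.
have ft : f t <= c.
  move: at'; rewrite le_eqVlt => /predU1P[<-//|at'].
  rewrite leNgt; apply/negP => cft.
  have : \forall s \near t, c < f s by have := cvgr_gt (f t) (cf t); apply.
  move=> /nbhs_ballP[e /= e0 Be].
  pose s := Num.max a (t - e / 2).
  have st : s < t by rewrite gt_max at'/= ltrBlDr ltrDl divr_gt0.
  have as' : a <= s by rewrite le_max lexx.
  have := Be s; rewrite -ball_normE/= ger0_norm ?subr_ge0 ?(ltW st)//.
  have se : t - s < e.
    have : t - e / 2 <= s by rewrite le_max lexx orbT.
    by lra.
  by move=> /(_ se); rewrite ltNge (ltW (lt s as' st)).
have : f t < c.
  apply: H; first by rewrite at' tb.
  move=> s /andP[as']; rewrite le_eqVlt => /predU1P[->//|st]; exact: ltW (lt s as' st).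
by rewrite ltNge ct.
Qed.

End first_crossing.

(** The right endpoint has its floor in the next cell, so it is treated through the two half cells,
    whose thresholds add up to dl / 2. *)
Lemma dyadic_chaining_cell (R : realType) (T : R) (u : R -> R) (N : nat) (dl : R) : 0 < T ->
  dyadic_continuous T u -> 0 < dl ->
  (forall m i, (i < 2 ^ (N + m.+1))%N ->
     `|u (dyad T (N + m.+1) i.+1) - u (dyad T (N + m.+1) i)| <= dl / 3 * (3 / 4) ^+ m.+1) ->
  forall i t, (i < 2 ^ N)%N -> dyad T N i <= t <= dyad T N i.+1 ->
    `|u t - u (dyad T N i)| <= dl.
Proof.
move=> T0 cu dl0 H i t iN /andP[it]; rewrite le_eqVlt => /predU1P[->|ti]; last first.
  rewrite -(@dyad_floorE _ _ T0 N t i) ?it//; apply: dyadic_chaining => //.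
  by rewrite (le_trans (dyad_ge0 T0 N i) it) (le_trans (ltW ti))// dyad_leT.
have iN' : (i.*2.+1 < 2 ^ (N + 1))%N by rewrite addn1 expnS; lia.
have := lerD (H 0%N _ iN') (H 0%N _ (ltnW iN')).
rewrite !addn1 -doubleS !dyad_double => h.
rewrite (_ : u _ - _ = (u (dyad T N i.+1) - u (dyad T N.+1 i.*2.+1)) +
  (u (dyad T N.+1 i.*2.+1) - u (dyad T N i))); last by ring.
by apply: le_trans (ler_normD _ _) _; apply: le_trans h _; rewrite expr1; lra.
Qed.

(** * The noise of a path and its energy *)

Section noise.
Context {R : realType} (n : nat) (T : R) (theta0 : 'rV[R]_n.+1) (U : 'rV[R]_n.+1 -> R).
Hypothesis T0 : 0 < T.
Hypothesis U_dyson : dyson_type_potential U.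
Local Notation path := (torus_path T theta0).
Implicit Types (X Y : path) (j : 'I_n.+1).

Definition noise X : 'I_n.+1 -> R -> R :=
  residual (fun j t => X t 0 j) (fun j s => drift U j (X s)) (fun j => theta0 0 j).

Definition noise_energy N X : R := 2^-1 * \sum_j dyadic_energy T N (noise X j).

Lemma path_coord_continuous X j : continuous (fun t => X t 0 j).
Proof.
move=> t; apply: (@continuous_comp _ _ _ (path_fun X) (fun x : 'rV[R]_n.+1 => x 0 j)).
  exact: path_continuous.
exact: coord_continuous.
Qed.

Lemma path_drift_continuous X j : continuous (fun s => drift U j (X s)).
Proof.
have [_ _ UC _ _] := U_dyson.
move=> t; apply: (@continuous_comp _ _ _ (path_fun X) (drift U j)).
  exact: path_continuous.
have [_ /(_ j)[_ +] _] := UC _ (path_conf X t).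
by move=> /(@cvgN _ _ _ _ _ _ _).
Qed.

Lemma path_potential_continuous X : continuous (fun s => U (X s)).
Proof.
have [_ _ UC _ _] := U_dyson.
move=> t; apply: (@continuous_comp _ _ _ (path_fun X) U); first exact: path_continuous.
by have [] := UC _ (path_conf X t).
Qed.

Lemma noise0 X j : noise X j 0 = 0.
Proof. by rewrite /noise /residual path_start subrr integral_segment0 subr0. Qed.

Lemma noise_dyadic_continuous X j : dyadic_continuous T (noise X j).
Proof.
by apply: residual_dyadic_continuous => // i; [exact: path_coord_continuous|exact: path_drift_continuous].
Qed.

Lemma noise_increment X j s t a c : 0 <= s -> s <= t ->
  (forall r, s <= r <= t -> `|drift U j (X r) - a| <= c) ->
  `|X t 0 j - X s 0 j - (noise X j t - noise X j s) - a * (t - s)| <= c * (t - s).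
Proof.
move=> s0 st H.
have := @integral_increment_dist R (fun s => drift U j (X s)) (fun=> a) s t c
  (@path_drift_continuous X j) _ s0 st H.
rewrite (@integral_increment _ (fun=> a))//; last by move=> r; exact: cvg_cst.
rewrite Rintegral_cst//.
rewrite [X in fine X](_ : _ = (t - s)%:E)//; last first.
  rewrite [LHS]lebesgue_measure_itv/= lte_fin; case: ltP => // ts.
  by congr (_%:E); apply/eqP; rewrite eq_sym subr_eq0 eq_le ts st.
move=> /(_ _) h; apply: le_trans _ (h _); last by move=> r; exact: cvg_cst.
rewrite le_eqVlt; apply/orP; left; apply/eqP; congr `| _ |.
by rewrite /noise /residual/=; ring.
Qed.

Lemma noise_increment_dist X Y j s t c : 0 <= s -> s <= t ->
  (forall r, s <= r <= t -> `|drift U j (X r) - drift U j (Y r)| <= c) ->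
  `|(X t 0 j - Y t 0 j) - (X s 0 j - Y s 0 j) - ((noise X j t - noise Y j t)
    - (noise X j s - noise Y j s))| <= c * (t - s).
Proof.
move=> s0 st H.
pose F (Z : path) r := \int[lebesgue_measure]_(s in `[0, r]) drift U j (Z s).
have E Z r : noise Z j r = Z r 0 j - theta0 0 j - F Z r by [].
have := integral_increment_dist (@path_drift_continuous X j) (@path_drift_continuous Y j) s0 st H.
move=> h; apply: le_trans _ h.
rewrite le_eqVlt; apply/orP; left; apply/eqP; congr `| _ |.
by rewrite !E -!/(F _ _); clearbody F; ring.
Qed.

Lemma noise_energy_ge0 N X : 0 <= noise_energy N X.
Proof. by rewrite mulr_ge0 ?invr_ge0 ?sumr_ge0// => j _; exact: dyadic_energy_ge0. Qed.

Lemma noise_energy_homo X N M : (N <= M)%N -> noise_energy N X <= noise_energy M X.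
Proof.
by move=> NM; rewrite ler_pM2l ?invr_gt0// ler_sum// => j _; exact: dyadic_energy_homo.
Qed.

Lemma dirichlet_energy_leP X (c : R) :
  (dirichlet_energy (drift U) X <= c%:E)%E <-> forall N, noise_energy N X <= c.
Proof.
rewrite -(@dirichlet_le_energyP R T n.+1 (fun j t => X t 0 j) (fun j s => drift U j (X s))
   (fun j => theta0 0 j) T0 (@path_coord_continuous X) (@path_drift_continuous X)).
rewrite /dirichlet_energy; case: asboolP => ac; split=> //.
- by case.
- by case=> /ac.
Qed.

Lemma dirichlet_energy_ge0 X : (0 <= dirichlet_energy (drift U) X)%E.
Proof.
rewrite /dirichlet_energy; case: asboolP => _ //.
apply: mule_ge0; first by rewrite lee_fin invr_ge0.
by apply: integral_ge0 => s _; rewrite lee_fin sumr_ge0// => j _; rewrite sqr_ge0.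
Qed.

End noise.

(** * Paths of small discrete energy stay away from the collisions *)

Section confinement.
Context {R : realType} (n : nat) (T : R) (theta0 : 'rV[R]_n.+1) (U : 'rV[R]_n.+1 -> R).
Hypothesis T0 : 0 < T.
Hypothesis U_dyson : dyson_type_potential U.
Local Notation path := (torus_path T theta0).
Implicit Types (X Y : path) (j : 'I_n.+1).

(* Discrete control at a single scale, at most [dl]; this is what can be read off the
   Gaussian increments, and it characterizes an energy at most [c] as [dl] goes to 0. *)
Definition regular (c dl : R) X := exists N, [/\ T / 2 ^+ N <= dl,
  noise_energy U N X <= c &
  forall j i t, (i < 2 ^ N)%N -> dyad T N i <= t <= dyad T N i.+1 ->
    `|noise U X j t - noise U X j (dyad T N i)| <= dl].

Lemma regular_homo c dl dl' X : dl <= dl' -> regular c dl X -> regular c dl' X.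
Proof.
move=> dd [N [h1 h2 h3]]; exists N; split; [exact: le_trans dd|by []|].
by move=> j i t iN it; exact: le_trans (h3 j i t iN it) dd.
Qed.

Lemma row_norm_enorm (x : 'rV[R]_n.+1) : `|x| <= enorm x.
Proof.
apply: row_norm_le (enorm_ge0 _) _ => j; rewrite -sqrtr_sqr ler_sqrt ?sumr_ge0//.
  by rewrite (bigD1 j)//= lerDl sumr_ge0// => i _; exact: sqr_ge0.
by move=> i _; exact: sqr_ge0.
Qed.

Lemma row_norm_sqr (x : 'rV[R]_n.+1) : `|x| ^+ 2 <= \sum_j x 0 j ^+ 2.
Proof. by rewrite -enorm_sqr ler_pXn2r ?nnegrE ?enorm_ge0// row_norm_enorm. Qed.

(** Here a is a partial derivative of U, D the increment of the path and p that of the noise, so D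
    is close to p - a h. Completing the square gives a p - a^2 h <= p^2 / (4 h); the quadratic
    remainder uses D^2 <= 2 p^2 + 2 (L h)^2. *)
Let descent_term (h L rho dl a D p : R) : 0 < h -> h <= dl -> 0 < L -> 0 <= rho ->
  `|a| <= L -> `|D - p - - a * h| <= L * rho * h -> `|D - p| <= L * h ->
  a * D + L * D ^+ 2 <= p ^+ 2 * ((4 * h)^-1 + 2 * L) + h * (L ^+ 2 * rho + 2 * L ^+ 3 * dl).
Proof.
move=> h0 hd L0 rho0 aL H1 H2.
have A1 : a * D <= a * p - a ^+ 2 * h + L * (L * rho * h).
  have : a * (D - p - - a * h) <= L * (L * rho * h).
    by apply: le_trans (ler_norm _) _; rewrite normrM; apply: ler_pM.
  by lra.
have A2 : a * p - a ^+ 2 * h <= p ^+ 2 * (4 * h)^-1.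
  have : 0 <= (p - 2 * a * h) ^+ 2 * (4 * h)^-1.
    by rewrite mulr_ge0 ?sqr_ge0// invr_ge0 mulr_ge0// ltW.
  have -> : (p - 2 * a * h) ^+ 2 * (4 * h)^-1 = p ^+ 2 * (4 * h)^-1 - (a * p - a ^+ 2 * h).
    by field; rewrite gt_eqF.
  by lra.
have A3 : D ^+ 2 <= 2 * p ^+ 2 + 2 * (L * h) ^+ 2.
  have : (D - p) ^+ 2 <= (L * h) ^+ 2.
    by rewrite -[X in X <= _]real_normK ?num_real// ler_pXn2r ?nnegrE ?mulr_ge0// ?ltW.
  have : 0 <= (D - 2 * p) ^+ 2 by exact: sqr_ge0.
  by nra.
have A4 : L * D ^+ 2 <= L * (2 * p ^+ 2 + 2 * (L * h) ^+ 2) by rewrite ler_pM2l.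
have A5 : L ^+ 3 * (h * h) <= L ^+ 3 * (h * dl) by rewrite !ler_pM2l ?exprn_gt0.
by lra.
Qed.

(* Along a grid of small mesh h, a path obeying d X = - grad U dt + d psi satisfies
   U(X_(i+1)) - U(X_i) <= grad U . dpsi - h |grad U|^2 + o(h) <= |dpsi|^2 / (4 h) + o(h),
   and the sum of these is half of the discrete energy of psi. *)
Lemma regular_confined c : 0 <= c -> exists M dl, 0 < dl /\
  forall X, regular c dl X -> forall t, sublevel U M (X t).
Proof.
(* The sum of p^2 / (4 h) is half the discrete energy, hence c / 2; the 1 is room for the errors,
   which amount to K dl < 1. *)
move=> c0; pose M := U theta0 + c / 2 + 1.
have [r [L [r0 L0 HL]]] := local_control U_dyson M.
have [K K0 KE] : exists2 K, 0 < K &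
    n.+1%:R * T * (L ^+ 2 * (1 + L) + 2 * L ^+ 3) + 4 * L * c + L * (1 + L) = K.
  have L1 := ltW L0; have T1 := ltW T0; eexists; last by [].
  rewrite ltr_wpDl//; last by rewrite mulr_gt0 ?addr_gt0.
  by do ?[apply: addr_ge0 | apply: mulr_ge0 | apply: exprn_ge0 | by []].
have L10 : 0 < 1 + L by rewrite addr_gt0.
pose dl := Num.min (r / (1 + L)) (K^-1 / 2).
have dl0 : 0 < dl.
  by rewrite lt_min; apply/andP; split; apply: divr_gt0 => //; rewrite invr_gt0.
have dlr : (1 + L) * dl <= r.
  by rewrite mulrC -ler_pdivlMr ?addr_gt0// ge_min lexx.
have dlK : K * dl < 1.
  have : dl <= K^-1 / 2 by rewrite ge_min lexx orbT.
  by move=> /(ler_wpM2l (ltW K0)); rewrite mulrA mulfV ?gt_eqF//; lra.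
exists M, dl; split=> // X [N [hdl EN osc]].
set h := T / 2 ^+ N in hdl; have h0 : 0 < h := dyad_step_gt0 T0 N.
(* Inside a cell the path moves by at most dl through the noise and L h <= L dl through the
   drift. *)
pose rho := (1 + L) * dl; have rho0 : 0 <= rho by rewrite mulr_ge0 ?addr_ge0 ?(ltW L0) ?(ltW dl0).
suff HM t : 0 <= t <= T -> U (X t) <= M.
  move=> t; split; first exact: path_conf.
  rewrite path_stopped; apply: HM.
  by rewrite le_max lexx/= ge_max (ltW T0) ge_min lexx orbT.
move: t; apply: (@first_crossing R (fun t => U (X t)) 0 T M).
- exact: path_potential_continuous.
- by rewrite path_start /M; lra.
move=> t /andP[t0 tT] Ht.
have sub s : 0 <= s -> s <= t -> sublevel U M (X s).
  by move=> s0 st; split; [exact: path_conf|apply: Ht; rewrite s0].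
have bd s j : 0 <= s -> s <= t -> `|drift U j (X s)| <= L.
  move=> s0 st; have [|_ + _ _ _] := HL (X s) (sub s s0 st) (X s).
    by rewrite subrr normr0 ltW.
  by rewrite normrN; apply.
have cell0 i s j : (i < 2 ^ N)%N -> dyad T N i <= s <= dyad T N i.+1 -> s <= t ->
    `|X s 0 j - X (dyad T N i) 0 j - (noise U X j s - noise U X j (dyad T N i))| <= L * h.
  move=> iN /andP[hs si] st; have i0 := dyad_ge0 T0 N i.
  have := @noise_increment R n T theta0 U U_dyson X j (dyad T N i) s 0 L i0 hs.
  rewrite mul0r subr0 => /(_ _)/le_trans; apply.
    by move=> x /andP[ix xs]; rewrite subr0; apply: bd; [exact: le_trans ix|exact: le_trans st].
  by rewrite ler_pM2l// lerBlDl -dyadS.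
have cell i s : (i < 2 ^ N)%N -> dyad T N i <= s <= dyad T N i.+1 -> s <= t ->
    `|X s - X (dyad T N i)| <= rho.
  move=> iN hs st; apply: row_norm_le => // j; rewrite !mxE.
  have := cell0 i s j iN hs st; have := osc j i s iN hs.
  move: (X s 0 j) (X (dyad T N i) 0 j) (noise U X j s) (noise U X j (dyad T N i)) => a b p q h1 h2.
  rewrite (_ : a - b = (a - b - (p - q)) + (p - q)); last by ring.
  apply: le_trans (ler_normD _ _) _; apply: le_trans (lerD h2 h1) _.
  by rewrite /rho mulrDl mul1r addrC lerD2l ler_pM2l.
pose S k := \sum_j ((noise U X j (dyad T N k.+1) - noise U X j (dyad T N k)) ^+ 2 *
   ((4 * h)^-1 + 2 * L) + h * (L ^+ 2 * rho + 2 * L ^+ 3 * dl)).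
have hL : 0 <= (4 * h)^-1 + 2 * L.
  by rewrite addr_ge0 ?invr_ge0 ?mulr_ge0// ltW.
have S0 k : 0 <= S k.
  apply: sumr_ge0 => j _; apply: addr_ge0; first by rewrite mulr_ge0 ?sqr_ge0.
  have L1 := ltW L0; have h1 := ltW h0; have d1 := ltW dl0.
  by do ?[by [] | apply: addr_ge0 | apply: mulr_ge0 | apply: exprn_ge0].
have step k : (k < 2 ^ N)%N -> dyad T N k.+1 <= t ->
    U (X (dyad T N k.+1)) - U (X (dyad T N k)) <= S k.
  move=> kN kt; have k0 := dyad_ge0 T0 N k.
  have kk : dyad T N k <= dyad T N k.+1 by exact: dyad_le.
  have kt' := le_trans kk kt.
  have ck := cell k (dyad T N k.+1) kN _ kt.
  have [|_ _ _ _ ] := HL _ (sub _ k0 kt') (X (dyad T N k.+1)).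
    by apply: le_trans dlr; apply: ck; rewrite kk lexx.
  move=> /le_trans; apply.
  apply: le_trans (_ : _ <= \sum_j (partial j U (X (dyad T N k)) *
     (X (dyad T N k.+1) 0 j - X (dyad T N k) 0 j) +
     L * (X (dyad T N k.+1) 0 j - X (dyad T N k) 0 j) ^+ 2)) _.
    rewrite big_split/= lerD2l -mulr_sumr ler_pM2l//.
    by apply: le_trans (row_norm_sqr _) _; apply: ler_sum => j _; rewrite !mxE.
  apply: ler_sum => j _; apply: descent_term => //.
  - by rewrite -normrN; exact: bd.
  - have := @noise_increment R n T theta0 U U_dyson X j (dyad T N k) (dyad T N k.+1)
      (- partial j U (X (dyad T N k))) (L * rho) k0 kk.
    have -> : dyad T N k.+1 - dyad T N k = h by rewrite dyadS addrAC subrr add0r.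
    apply.
    move=> x /andP[kx xk]; rewrite /drift -opprD normrN.
    have cx : `|X x - X (dyad T N k)| <= rho.
      by apply: cell => //; [rewrite kx xk|exact: le_trans kt].
    have [|_ _ + _ _] := HL _ (sub _ k0 kt') (X x); first exact: le_trans dlr.
    by move=> /(_ j)/le_trans; apply; rewrite ler_pM2l.
  - by apply: cell0 => //; rewrite kk lexx.
have climb i : (i <= 2 ^ N)%N -> dyad T N i <= t ->
    U (X (dyad T N i)) - U theta0 <= \sum_(0 <= k < i) S k.
  elim: i => [|i IH] iN it; first by rewrite dyad0 path_start subrr big_nil.
  rewrite big_nat_recr//=.
  have it' : dyad T N i <= t by apply: le_trans it; exact: dyad_le.
  by have := IH (ltnW iN) it'; have := step i iN it; lra.
have total : \sum_(0 <= k < 2 ^ N) S k <=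
    c / 2 + 4 * L * c * dl + n.+1%:R * T * (L ^+ 2 * rho + 2 * L ^+ 3 * dl).
  have -> : \sum_(0 <= k < 2 ^ N) S k = (2^-1 + 4 * L * h) * noise_energy U N X +
      n.+1%:R * T * (L ^+ 2 * rho + 2 * L ^+ 3 * dl).
    rewrite big_mkord /S exchange_big/=.
    under eq_bigr do rewrite big_split/= sumr_const card_ord -mulr_suml.
    rewrite big_split/= sumr_const card_ord -mulr_suml; congr (_ + _).
      rewrite /noise_energy /dyadic_energy -/h mulr_sumr mulr_suml mulr_sumr.
      apply: eq_bigr => j _; rewrite -[X in _ = _ * (_ * X)]mulr_suml.
      by field; rewrite gt_eqF.
    rewrite -[LHS]mulr_natl -[X in _ * X]mulr_natl natrX /h.
    by field; rewrite expf_neq0// pnatr_eq0.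
  rewrite lerD2r mulrDl; apply: lerD; first by rewrite mulrC ler_pM2r ?invr_gt0.
  have : h * noise_energy U N X <= dl * c.
    by apply: ler_pM => //; [exact: ltW|exact: noise_energy_ge0].
  by move=> /(ler_wpM2l (ltW L0)); lra.
pose i := dyad_floor T N t.
have /andP[it ti] := dyad_floorP T0 N t0.
have iN : (i <= 2 ^ N)%N by exact: dyad_floor_le.
have Ui : U (X (dyad T N i)) - U theta0 <= \sum_(0 <= k < 2 ^ N) S k.
  apply: le_trans (climb i iN it) _.
  by rewrite (big_cat_nat (n := i) (p := 2 ^ N))//= lerDl sumr_ge0.
have Ut : U (X t) - U (X (dyad T N i)) <= L * rho.
  move: iN; rewrite leq_eqVlt => /predU1P[iN|iN].
    have -> : t = dyad T N i.
      by apply/eqP; rewrite eq_le it andbT iN dyad_last.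
    by rewrite subrr mulr_ge0// ltW.
  have ct : `|X t - X (dyad T N i)| <= rho by apply: cell => //; rewrite it ltW.
  have [|_ _ _ + _] := HL _ (sub _ (dyad_ge0 T0 N i) it) (X t); first exact: le_trans dlr.
  move=> h1; apply: le_trans (ler_norm _) _; apply: le_trans h1 _.
  by rewrite ler_pM2l.
have : 4 * L * c * dl + n.+1%:R * T * (L ^+ 2 * rho + 2 * L ^+ 3 * dl) + L * rho = K * dl.
  by rewrite -KE /rho; ring.
by rewrite /M; lra.
Qed.

End confinement.

(** * Equicontinuity and limits of regular paths *)

Section compactness.
Context {R : realType} (n : nat) (T : R) (theta0 : 'rV[R]_n.+1) (U : 'rV[R]_n.+1 -> R).
Hypothesis T0 : 0 < T.
Hypothesis U_dyson : dyson_type_potential U.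
Local Notation path := (torus_path T theta0).
Implicit Types (X Y : path) (j : 'I_n.+1).
Let clamp (t : R) : R := Num.max 0 (Num.min t T).

Let clamp_itv t : 0 <= clamp t <= T.
Proof. by rewrite le_max lexx/= ge_max (ltW T0) ge_min lexx orbT. Qed.

Let clamp_dist s t : `|clamp s - clamp t| <= `|s - t|.
Proof. exact: le_trans (ler_dist_max0 _ _) (ler_dist_min _ _ _). Qed.

Lemma path_norm_dist X Y t : `|X t - Y t| <= path_dist X Y.
Proof.
rewrite (path_stopped X) (path_stopped Y); apply: le_trans (row_norm_enorm _) _.
by apply: path_dist_ge; rewrite in_itv/=; exact: clamp_itv.
Qed.

Lemma path_dist_norm X Y e : 0 <= e -> (forall t, 0 <= t <= T -> `|X t - Y t| <= e) ->
  path_dist X Y <= n.+1%:R * e.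
Proof.
move=> e0 H; apply: path_dist_le; first exact: mulr_ge0.
move=> t; rewrite in_itv/= => /H He.
rewrite -[leRHS]ger0_norm ?mulr_ge0// -sqrtr_sqr ler_sqrt ?sqr_ge0//.
apply: (@le_trans _ _ (\sum_(j < n.+1) e ^+ 2)).
  apply: ler_sum => j _; rewrite -[X in X <= _]real_normK ?num_real//.
  by rewrite ler_pXn2r ?nnegrE//; apply: le_trans (row_norm_coord _ _) He.
rewrite sumr_const card_ord exprMn -[leLHS]mulr_natl ler_wpM2r ?sqr_ge0//.
by rewrite expr2 ler_peMl// ler1n.
Qed.

Lemma regular_osc c dl X : 0 <= dl -> regular U c dl X -> exists N,
  [/\ T / 2 ^+ N <= dl, noise_energy U N X <= c &
   forall j t, 0 <= t <= T -> `|noise U X j t - noise U X j (dyad T N (dyad_floor T N t))| <= dl].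
Proof.
move=> dl0 [N [h1 h2 h3]]; exists N; split=> // j t /andP[t0 tT].
have /andP[it ti] := dyad_floorP T0 N t0; set i := dyad_floor T N t in it ti *.
have : (i <= 2 ^ N)%N by exact: dyad_floor_le.
rewrite leq_eqVlt => /predU1P[iN|iN]; last by apply: h3; rewrite ?it ?(ltW ti).
have -> : t = dyad T N i by apply/eqP; rewrite eq_le it andbT iN dyad_last.
by rewrite subrr normr0.
Qed.

(** Young's inequality between the floors of s and t, which are at most t - s + dl apart, then dl
    for the noise in each of the two cells, and L (t - s) for the drift. *)
Lemma regular_modulus c : 0 <= c -> exists M L dl0, [/\ 0 < L, 0 < dl0 &
  forall dl X, 0 <= dl -> dl <= dl0 -> regular U c dl X ->
  (forall t, sublevel U M (X t)) /\
  forall s t l, 0 <= s -> s <= t -> t <= T -> 0 < l ->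
  `|X t - X s| <= 2^-1 * (l * (t - s + dl) + 2 * c / l) + 2 * dl + L * (t - s)].
Proof.
move=> c0; have [M [dl0 [dl00 HM]]] := @regular_confined R n T theta0 U T0 U_dyson c c0.
have [r [L [r0 L0 HL]]] := local_control U_dyson M.
exists M, L, dl0; split=> // dl X d0 dd regX.
have subX := HM X (regular_homo dd regX).
split=> // s t l s0 st tT l0.
have t0 : 0 <= t := le_trans s0 st; have sT := le_trans st tT.
have [N [hN EN osc]] := regular_osc d0 regX.
apply: row_norm_le => [|j].
  have l1 := ltW l0; have L1 := ltW L0; have ts : 0 <= t - s by rewrite subr_ge0.
  by do ?[by [] | apply: addr_ge0 | apply: mulr_ge0 | by rewrite invr_ge0].
rewrite !mxE; set a := dyad_floor T N s; set b := dyad_floor T N t.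
have /andP[as' sa] := dyad_floorP T0 N s0; have /andP[bt tb] := dyad_floorP T0 N t0.
rewrite -/a -/b in as' sa bt tb.
have ab : (a <= b)%N by exact: dyad_floor_homo.
have bN : (b <= 2 ^ N)%N by exact: dyad_floor_le.
have H1 : `|X t 0 j - X s 0 j - (noise U X j t - noise U X j s)| <= L * (t - s).
  have := @noise_increment R n T theta0 U U_dyson X j s t 0 L s0 st.
  rewrite mul0r subr0; apply => x _; rewrite subr0 normrN.
  have [|_ + _ _ _] := HL (X x) (subX x) (X x); first by rewrite subrr normr0 ltW.
  exact.
have H2 := osc j t; rewrite t0 tT in H2; have {}H2 := H2 isT.
have H3 := osc j s; rewrite s0 sT in H3; have {}H3 := H3 isT.
have := @dyadic_increments_young R T T0 unit N (noise U X j) (fun=> a) (fun=> b) l l0.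
rewrite !big_const card_unit/= !addr0 => H4.
have {}H4 : `|noise U X j (dyad T N b) - noise U X j (dyad T N a)| <=
    2^-1 * (l * (t - s + dl) + 2 * c / l).
  apply: le_trans (H4 _ _) _; [by []|by case; case|].
  rewrite ler_pM2l ?invr_gt0//; apply: lerD.
    rewrite ler_pM2l//; move: sa; rewrite dyadS => sa'.
    apply: le_trans (lerB bt (_ : s - dl <= _)) _; last by rewrite opprB addrA addrAC.
    by rewrite lerBlDr (le_trans (ltW sa'))// lerD2l.
  rewrite ler_pM2r ?invr_gt0//; apply: le_trans (_ : 2 * noise_energy U N X <= _); last first.
    by rewrite ler_pM2l.
  rewrite /noise_energy mulrA mulfV ?pnatr_eq0// mul1r (bigD1 j)//= lerDl sumr_ge0// => i _.
  exact: dyadic_energy_ge0.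
move: H1 H2 H3 H4; rewrite -/a -/b.
move: (X t 0 j) (X s 0 j) (noise U X j t) (noise U X j s)
  (noise U X j (dyad T N b)) (noise U X j (dyad T N a)).
move=> x y p q p' q' H1 H2 H3 H4.
rewrite (_ : x - y = (x - y - (p - q)) + ((p - p') - (q - q') + (p' - q'))); last by ring.
have K1 := ler_normD (x - y - (p - q)) ((p - p') - (q - q') + (p' - q')).
have K2 := ler_normD ((p - p') - (q - q')) (p' - q').
have K3 := ler_normB (p - p') (q - q').
by lra.
Qed.

Lemma regular_equicontinuous c e : 0 <= c -> 0 < e -> exists2 dl, 0 < dl &
  forall X, regular U c dl X -> forall s t, `|t - s| <= dl -> `|X t - X s| <= e.
Proof.
move=> c0 e0; have [M [L [dl0 [L0 dl00 H]]]] := regular_modulus c0.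
(* This makes c / l at most e / 4; once l is fixed, dl makes the remaining terms at most e / 4. *)
pose l := 4 * (c + 1) / e; have l0 : 0 < l.
  by rewrite divr_gt0 ?mulr_gt0 ?ltr_wpDl.
have cl : c / l <= e / 4.
  rewrite ler_pdivrMr// /l; have -> : e / 4 * (4 * (c + 1) / e) = c + 1; last by lra.
  by field; rewrite gt_eqF.
have lL : 0 < l + 2 + L by rewrite !addr_gt0.
pose dl := Num.min dl0 (e / 4 / (l + 2 + L)).
have d0 : 0 < dl by rewrite lt_min dl00 !divr_gt0.
have dd : dl <= dl0 by rewrite ge_min lexx.
have de : (l + 2 + L) * dl <= e / 4 by rewrite mulrC -ler_pdivlMr// ge_min lexx orbT.
exists dl => // X regX.
have [_ {}H] := H dl X (ltW d0) dd regX.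
suff K s t : 0 <= s -> s <= t -> t <= T -> t - s <= dl -> `|X t - X s| <= e.
  move=> s t std; rewrite (path_stopped _ s) (path_stopped _ t) -/(clamp s) -/(clamp t).
  have := clamp_dist t s; move: (clamp_itv s) (clamp_itv t).
  move: (clamp s) (clamp t) => a b /andP[a0 aT] /andP[b0 bT] abd.
  have {}abd := le_trans abd std.
  have [ab|/ltW ba] := leP a b; first by apply: K => //; exact: le_trans (ler_norm _) abd.
  by rewrite distrC; apply: K => //; apply: le_trans (ler_norm _) _; rewrite distrC.
move=> s0 st tT std; apply: le_trans (H s t l s0 st tT l0) _.
have h1 : l * (t - s + dl) <= l * (2 * dl) by rewrite ler_pM2l//; lra.
have h2 : L * (t - s) <= L * dl by rewrite ler_pM2l.
have h3 : 2 * c / l = 2 * (c / l) by rewrite mulrA.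
have h4 : 0 <= L * dl by rewrite mulr_ge0 ?ltW.
by rewrite h3; lra.
Qed.

Lemma regular_bounded c : 0 <= c -> exists B dl, [/\ 0 < B, 0 < dl &
  forall X, regular U c dl X -> forall t, `|X t| <= B].
Proof.
move=> c0; have [M [L [dl [L0 dl0 H]]]] := regular_modulus c0.
exists (`|theta0| + (2^-1 * ((T + dl) + 2 * c) + 2 * dl + L * T)), dl; split=> //.
  have := normr_ge0 theta0; have : 0 < L * T by rewrite mulr_gt0.
  by have := T0; lra.
move=> X regX t; rewrite path_stopped -/(clamp t).
have /andP[t0 tT] := clamp_itv t; move: (clamp t) t0 tT => {}t t0 tT.
have [_ /(_ 0 t 1)] := H dl X (ltW dl0) (lexx _) regX.
rewrite lexx t0 tT ltr01 => /(_ isT isT isT isT).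
rewrite path_start subr0 mul1r divr1 => h.
have := ler_normD (X t - theta0) theta0; rewrite subrK.
have : L * t <= L * T by rewrite ler_pM2l.
lra.
Qed.

Lemma path_sublevel X : exists M, forall t, sublevel U M (X t).
Proof.
have cU : {within `[0, T], continuous (fun t => U (X t))}.
  by apply: continuous_subspaceT; exact: path_potential_continuous.
have [t0 _ H] := EVT_max (ltW T0) cU.
exists (U (X t0)) => t; split; first exact: path_conf.
by rewrite path_stopped -/(clamp t); apply: H; rewrite in_itv/= clamp_itv.
Qed.

(** Uniform convergence eventually brings X within r of g, where the gradient differs from that
    along g by at most L times the distance; hence the noises are close. *)
Lemma noise_cvg (F : set_system path) (g : path) j t : Filter F -> F --> g ->
  0 <= t <= T -> noise U X j t @[X --> F] --> noise U g j t.
Proof.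
move=> FF Fg /andP[t0 tT]; have [M HM] := path_sublevel g.
have [r [L [r0 L0 HL]]] := local_control U_dyson M.
have LT : 0 < 1 + L * T by rewrite addr_gt0// mulr_gt0.
apply/cvgrPdist_le => e e0.
pose dl := Num.min r (e / (1 + L * T)).
have dl0 : 0 < dl by rewrite lt_min r0 divr_gt0.
have : \forall X \near F, path_dist g X < dl.
  by apply: Fg; exact: (@nbhsx_ballx _ path g dl dl0).
apply: filterS => X /ltW Xg.
have dX s : `|X s - g s| <= dl by rewrite (le_trans (path_norm_dist _ _ _))// path_dist_sym.
have := @noise_increment_dist R n T theta0 U U_dyson X g j 0 t (L * dl) (lexx 0) t0.
rewrite (path_start X) (path_start g) (noise0 U X j) (noise0 U g j).
rewrite (subrr (theta0 0 j)) (subrr (0 : R)) 3!subr0 => H.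
have {}H : `|X t 0 j - g t 0 j - (noise U X j t - noise U g j t)| <= L * dl * t.
  apply: H => s _; rewrite /drift -opprD normrN.
  have [|_ _ + _ _] := HL _ (HM s) (X s).
    by apply: le_trans (dX s) _; rewrite ge_min lexx.
  by move=> /(_ j)/le_trans; apply; rewrite ler_pM2l.
have := le_trans (row_norm_coord (X t - g t) j) (dX t); rewrite !mxE.
have de : (1 + L * T) * dl <= e by rewrite mulrC -ler_pdivlMr// ge_min lexx orbT.
have tT' : L * dl * t <= L * dl * T by rewrite ler_wpM2l// mulr_ge0 ?ltW.
move: H; move: (X t 0 j) (g t 0 j) (noise U X j t) (noise U g j t) => x y p q h1 h2.
have := ler_normB (x - y) (x - y - (p - q)).
have -> : x - y - (x - y - (p - q)) = p - q by ring.
by rewrite [`|q - p|]distrC; lra.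
Qed.

Lemma noise_energy_cvg (F : set_system path) (g : path) N : Filter F -> F --> g ->
  noise_energy U N X @[X --> F] --> noise_energy U N g.
Proof.
move=> FF Fg; apply: cvgMr.
apply: cvg_sumr => j; apply: cvg_sumr => i; apply: cvgMl.
have nc k : (k <= 2 ^ N)%N -> noise U X j (dyad T N k) @[X --> F] --> noise U g j (dyad T N k).
  by move=> kN; apply: noise_cvg => //; rewrite dyad_ge0//= dyad_leT.
by apply: cvgM; apply: cvgB; apply: nc => //; exact: ltnW.
Qed.

(** Arzela-Ascoli along an ultrafilter: pointwise limits exist by boundedness, inherit the modulus
    of continuity and stay in a closed sublevel set, so they form a path; equicontinuity and a
    finite grid make the convergence uniform. *)
Lemma ultra_regular_cvg (F : set_system path) c : UltraFilter F -> 0 <= c ->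
  (forall dl, 0 < dl -> F (regular U c dl)) ->
  exists2 g : path, F --> g & forall N, noise_energy U N g <= c.
Proof.
move=> FU c0 FG.
have [B [dl1 [B0 dl10 HB]]] := regular_bounded c0.
have [M [dl2 [dl20 HM]]] := @regular_confined R n T theta0 U T0 U_dyson c c0.
have cK : compact [set v : 'rV[R]_n.+1 | forall j, `[- B, B]%classic (v ord0 j)].
  by apply: (@rV_compact _ n.+1 (fun=> `[- B, B]%classic)) => _; exact: segment_compact.
have /choice[g Hg] : forall t : R,
    exists x : 'rV[R]_n.+1, (fun X : path => X t) @ F --> x.
  move=> t; have [|x _ cx] := @ultra_cvg_image _ _ F (fun X => X t) _ FU cK.
    apply: filterS (FG _ dl10) => X /HB/(_ t) Xt j.
    rewrite /= in_itv/= -ler_norml.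
    exact: le_trans (row_norm_coord (X t) j) Xt.
  by exists x.
have Huniq (V : 'rV[R]_n.+1) t : (fun X : path => X t) @ F --> V -> g t = V.
  by move=> h; exact: (cvg_unique _ (Hg t) h).
have equi e : 0 < e -> exists2 dl, 0 < dl &
    forall s t, `|t - s| <= dl -> `|g t - g s| <= e.
  move=> e0; have [dl dl0 H] := regular_equicontinuous c0 e0.
  exists dl => // s t std.
  have cv : (fun X : path => `|X t - X s|) @ F --> `|g t - g s|.
    by apply: cvg_norm; apply: cvgB; exact: Hg.
  rewrite -(cvg_lim _ cv)//; apply: limr_le; first by apply/cvg_ex; eexists; exact: cv.
  by apply: filterS (FG _ dl0) => X /H; apply.
have g_stop t : g t = g (Num.max 0 (Num.min t T)).
  apply: Huniq; rewrite (_ : (fun X : path => X t) = (fun X : path => X (clamp t))).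
    exact: Hg.
  by apply/funext => X; rewrite path_stopped.
have g_cont : continuous g.
  move=> t; apply/cvgrPdist_le => e e0; have [dl dl0 H] := equi e e0.
  by exists dl => //= s /= st; apply: H; exact: ltW.
have g_start : g 0 = theta0.
  apply: Huniq; rewrite (_ : (fun X : path => X 0) = cst theta0); first exact: cvg_cst.
  by apply/funext => X; rewrite path_start.
have g_conf t : torus_conf (g t).
  suff [] : sublevel U M (g t) by [].
  apply: (@closed_cvg _ _ F _ (fun X : path => X t)) (Hg t) => //.
    exact: sublevel_closed.
  by apply: filterS (FG _ dl20) => X /HM.
pose G := TorusPath g_stop g_cont g_start g_conf.
have FcG : F --> G.
  move=> A /nbhs_ballP[e /= e0 He].
  (* Three errors e' and the factor n + 1 from the Euclidean norm give 3 e / 4. *)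
  pose e' := e / (4 * n.+1%:R); have e'0 : 0 < e' by rewrite divr_gt0 ?mulr_gt0.
  have [dl dl0 H] := equi e' e'0.
  have [dl' dl'0 H'] := regular_equicontinuous c0 e'0.
  have [N hN] : exists N, T / 2 ^+ N < Num.min dl dl'.
    have [|N hN] := @dyad_step_cvg _ T T0 (Num.min dl dl'); first by rewrite lt_min dl0.
    by exists N; exact: hN.
  move: hN; rewrite lt_min => /andP[hN hN'].
  have : F [set X : path | forall i : 'I_(2 ^ N).+1,
      `|g (dyad T N i) - X (dyad T N i)| <= e'].
    apply: filter_forall => i.
    by have /cvgrPdist_le/(_ e' e'0) := Hg (dyad T N i).
  move=> /filterI/(_ (FG _ dl'0)); apply: filterS => X [Xi regX]; apply: He.
  rewrite /ball/=; apply: le_lt_trans (_ : n.+1%:R * (3 * e') < e); last first.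
    rewrite /e' (_ : _ * (3 * _) = 3 / 4 * e); first by lra.
    have : n.+1%:R != 0 :> R by rewrite pnatr_eq0.
    by move: (n.+1%:R : R) => z z0; field.
  apply: path_dist_norm; first by rewrite mulr_ge0 ?ltW.
  move=> t /andP[t0 tT]; set i := dyad_floor T N t.
  have iN : (i < (2 ^ N).+1)%N by rewrite ltnS; exact: dyad_floor_le.
  have := Xi (Ordinal iN) => /= h1.
  have /andP[it ti] := dyad_floorP T0 N t0; rewrite -/i dyadS in it ti.
  have ti' : `|t - dyad T N i| <= T / 2 ^+ N by rewrite ger0_norm ?subr_ge0//; lra.
  have h2 := H (dyad T N i) t (le_trans ti' (ltW hN)).
  have h3 := H' X regX (dyad T N i) t (le_trans ti' (ltW hN')).
  rewrite (_ : G t - X t = (g t - g (dyad T N i)) + (g (dyad T N i) - X (dyad T N i))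
     - (X t - X (dyad T N i))); last first.
    by rewrite /= opprB addrA addrA subrK subrK.
  apply: le_trans (ler_normB _ _) _.
  have := ler_normD (g t - g (dyad T N i)) (g (dyad T N i) - X (dyad T N i)); lra.
exists G => // N.
have FF : Filter F by exact: _.
have cv := @noise_energy_cvg F G N FF FcG.
rewrite -(cvg_lim _ cv)//; apply: limr_le; first by apply/cvg_ex; eexists; exact: cv.
(* Regularity at scale T / 2^N is witnessed by a grid at least as fine as level N, and the energy
   increases with the level. *)
apply: filterS (FG _ (dyad_step_gt0 T0 N)) => X [N' [hN' EN' _]].
apply: le_trans EN'; apply: noise_energy_homo => //.
rewrite -(@ler_eXn2l R 2) ?ltr1n//; move: hN'.
by rewrite ler_pM2l// lef_pV2 ?posrE ?exprn_gt0.
Qed.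

(** In the modulus (l (t - s) + 2 c / l) / 2, first l is taken large, then the mesh small. All fine
    levels work, so N can meet further demands. *)
Lemma finite_energy_osc c X (dl : R) : (forall N, noise_energy U N X <= c) -> 0 < dl ->
  exists N0, forall N, (N0 <= N)%N -> T / 2 ^+ N <= dl /\
  forall j i t, (i < 2 ^ N)%N -> dyad T N i <= t <= dyad T N i.+1 ->
    `|noise U X j t - noise U X j (dyad T N i)| <= dl.
Proof.
move=> H dl0; have c0 : 0 <= c := le_trans (noise_energy_ge0 _ T0 0 X) (H 0%N).
pose l := 2 * (c + 1) / dl; have l0 : 0 < l by rewrite divr_gt0 ?mulr_gt0 ?ltr_wpDl.
have cl : 2 * c / l <= dl.
  rewrite ler_pdivrMr// /l; have -> : dl * (2 * (c + 1) / dl) = 2 * (c + 1); last by lra.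
  by field; rewrite gt_eqF.
have [|N0 hN] := @dyad_step_cvg _ T T0 (Num.min dl (dl / l)).
  by rewrite lt_min dl0 divr_gt0.
exists N0 => N /hN; rewrite lt_min => /andP[h1 h2]; split; first exact: ltW.
move=> j i t iN /andP[it ti].
have E N' : dyadic_energy T N' (noise U X j) <= 2 * c.
  apply: le_trans (_ : 2 * noise_energy U N' X <= _); last by rewrite ler_pM2l.
  rewrite /noise_energy mulrA mulfV ?pnatr_eq0// mul1r (bigD1 j)//= lerDl sumr_ge0// => k _.
  exact: dyadic_energy_ge0.
have tT : t <= T := le_trans ti (dyad_leT T0 iN).
have := energy_modulus T0 (@noise_dyadic_continuous R n T theta0 U T0 U_dyson X j) E.
move=> /(_ _ t l (dyad_ge0 T0 N i) it tT l0)/le_trans; apply.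
have : l * (t - dyad T N i) <= dl.
  rewrite mulrC -ler_pdivlMr//; apply: le_trans (ltW h2).
  by move: ti; rewrite dyadS; lra.
lra.
Qed.

Lemma finite_energy_regular c X (dl : R) : (forall N, noise_energy U N X <= c) -> 0 < dl ->
  regular U c dl X.
Proof.
move=> H dl0; have [N /(_ N (leqnn N))[h osc]] := finite_energy_osc H dl0.
by exists N; split => //; exact: H.
Qed.

Lemma dirichlet_energy_good : good_rate_function (@dirichlet_energy R n (drift U) T theta0).
Proof.
split=> [X|c c0]; first exact: dirichlet_energy_ge0.
rewrite compact_ultra => F FU FJ.
have [g Fg gE] : exists2 g : path, F --> g & forall N, noise_energy U N g <= c.
  apply: ultra_regular_cvg => // dl dl0; apply: filterS FJ => X.
  by move=> /(dirichlet_energy_leP T0 U_dyson) h; exact: finite_energy_regular.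
by exists g; split => //; apply/(dirichlet_energy_leP T0 U_dyson).
Qed.

(** Otherwise the sets of regular paths in A, as dl decreases, generate a proper filter; an
    ultrafilter containing it converges to a path of A all of whose discrete energies are at most
    c. *)
Lemma closed_not_regular (A : set path) c : closed A -> 0 <= c ->
  (forall X, A X -> exists N, c < noise_energy U N X) ->
  exists2 dl, 0 < dl & forall X, A X -> ~ regular U c dl X.
Proof.
move=> cA c0 H; apply: contrapT => nH.
have ne dl : 0 < dl -> exists X, A X /\ regular U c dl X.
  move=> dl0; apply: contrapT => nX; apply: nH; exists dl => // X AX rX.
  by apply: nX; exists X.
pose F := filter_from [set dl : R | 0 < dl] (fun dl => A `&` regular U c dl).
have FF : ProperFilter F.
  apply: filter_from_proper; last by move=> dl /ne[X HX]; exists X.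
  apply: filter_from_filter; first by exists 1 => /=.
  move=> a b /= a0 b0; exists (Num.min a b) => /=; first by rewrite lt_min a0.
  by move=> X [AX rX]; do 2!split => //; apply: regular_homo rX; rewrite ge_min lexx ?orbT.
have [G [GU FG]] := ultraFilterLemma FF.
have GA : G A by apply: FG; exists 1 => //= X [].
have [g Gg gE] : exists2 g : path, G --> g & forall N, noise_energy U N g <= c.
  by apply: ultra_regular_cvg => // dl dl0; apply: FG; exists dl => // X [].
have [N] : exists N, c < noise_energy U N g.
  apply: H; apply: (@closed_cvg _ _ G _ (fun X : path => X) A cA _ g Gg).
  exact: GA.
by rewrite ltNge gE.
Qed.

End compactness.

(** * Continuous dependence of the path on its noise *)

Section stability.
Context {R : realType} (n : nat) (T : R) (theta0 : 'rV[R]_n.+1) (U : 'rV[R]_n.+1 -> R).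
Hypothesis T0 : 0 < T.
Hypothesis U_dyson : dyson_type_potential U.
Local Notation path := (torus_path T theta0).

(* Gronwall's inequality in discrete form: over a time step tau with L tau <= 1/2,
   the distance of two solutions is at most tripled. *)
Lemma noise_stability (Y : path) (e : R) : 0 < e -> exists2 eta, 0 < eta &
  forall X : path, (forall j t, 0 <= t <= T -> `|noise U X j t - noise U Y j t| <= eta) ->
  path_dist X Y < e.
Proof.
move=> e0; have [M HM] := path_sublevel T0 U_dyson Y.
have [r [L [r0 L0 HL]]] := local_control U_dyson M.
pose rho := Num.min r (e / 2 / n.+1%:R).
have rho0 : 0 < rho by rewrite lt_min r0 !divr_gt0.
pose m := (Num.bound (2 * L * T)).+1; pose tau := T / m%:R.
have tau0 : 0 < tau by rewrite divr_gt0.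
have Ltau : L * tau <= 2^-1.
  rewrite /tau mulrA ler_pdivrMr// ler_pdivlMl// mulrA.
  apply: le_trans (ler_norm _) _; apply: le_trans (ltW (archi_boundP (normr_ge0 _))) _.
  rewrite ger0_norm ?mulr_ge0 ?(ltW L0) ?(ltW T0)//.
  by rewrite ler_nat.
(* That is 5 eta 3^i, with b m = rho. Since 5 eta <= b i, one step gives b i + 2 eta + b (i + 1) / 2
   <= 2.9 b i, strictly below b (i + 1) = 3 b i. *)
pose b i : R := 5 * (rho / (5 * 3 ^+ m)) * 3 ^+ i.
have b0 i : 0 < b i.
  by rewrite mulr_gt0 ?exprn_gt0// mulr_gt0// divr_gt0// mulr_gt0// exprn_gt0.
have bm i : (i <= m)%N -> b i <= rho.
  move=> im; rewrite /b (_ : 5 * _ * _ = rho * (3 ^+ i / 3 ^+ m)); last first.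
    by field; rewrite expf_neq0.
  by rewrite ler_piMr ?(ltW rho0)// ler_pdivrMr ?exprn_gt0// mul1r ler_weXn2l// ler1n.
have eta0 : 0 < rho / (5 * 3 ^+ m) by rewrite divr_gt0// mulr_gt0// exprn_gt0.
set eta := rho / (5 * 3 ^+ m) in b b0 bm eta0.
exists eta => // X HX.
have mtau : m%:R * tau = T by rewrite /tau mulrC mulfVK// pnatr_eq0.
have claim i : (i <= m)%N -> forall t, 0 <= t <= i%:R * tau -> `|X t - Y t| <= b i.
  elim: i => [_ t|i IH im t /andP[t0 ti]].
    by rewrite mul0r -eq_le => /eqP <-; rewrite !path_start subrr normr0 ltW.
  have bS : b i.+1 = 3 * b i by rewrite /b exprS; ring.
  have [ti'|ti'] := leP t (i%:R * tau).
    apply: le_trans (IH (ltnW im) t _) _; first by rewrite t0 ti'.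
    by rewrite bS; have := b0 i; lra.
  have i0 : 0 <= i%:R * tau by rewrite mulr_ge0 ?(ltW tau0).
  have iS : i.+1%:R * tau = i%:R * tau + tau by rewrite -natr1 mulrDl mul1r.
  have iT : i.+1%:R * tau <= T by rewrite -mtau ler_pM2r// ler_nat.
  have Xi : `|X (i%:R * tau) - Y (i%:R * tau)| <= b i.
    by apply: IH; [exact: ltnW|rewrite i0 lexx].
  (* The Lipschitz bound on the drift holds only while X is within r of Y, which is part of what is
     being proved; hence the bootstrap. *)
  apply: (@first_crossing R (fun t => `|X t - Y t|) (i%:R * tau) (i.+1%:R * tau)).
  - by move=> s; apply: cvg_norm; apply: cvgB; exact: path_continuous.
  - by apply: le_trans Xi _; rewrite bS; have := b0 i; lra.
  - move=> {ti t0 ti'}t /andP[it ti] H.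
    apply: (@le_lt_trans _ _ (b i + 2 * eta + 2^-1 * b i.+1)); last first.
      have : eta * 5 <= b i.
        have e3 : 1 <= 3 ^+ i :> R by apply: exprn_ege1; rewrite ler1n.
        have : 0 <= eta * (3 ^+ i - 1) by apply: mulr_ge0; [exact: ltW|rewrite subr_ge0].
        by rewrite /b; lra.
      by rewrite bS; have := b0 i; have := eta0; lra.
    apply: row_norm_le => [|j]; first by have := b0 i; have := b0 i.+1; have := eta0; lra.
    rewrite !mxE.
    have H1 := @noise_increment_dist R n T theta0 U U_dyson X Y j _ t (L * b i.+1) i0 it.
    have {}H1 : `|(X t 0 j - Y t 0 j) - (X (i%:R * tau) 0 j - Y (i%:R * tau) 0 j) -
        ((noise U X j t - noise U Y j t) -
         (noise U X j (i%:R * tau) - noise U Y j (i%:R * tau)))| <= 2^-1 * b i.+1.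
      apply: (le_trans (H1 _)).
        move=> s si; rewrite /drift -opprD normrN.
        have [|_ _ + _ _] := HL _ (HM s) (X s).
          apply: le_trans (H s si) _; apply: le_trans (bm _ im) _.
          by rewrite ge_min lexx.
        by move=> /(_ j)/le_trans; apply; rewrite ler_pM2l//; exact: H.
      rewrite mulrAC ler_pM2r//; apply: le_trans Ltau; rewrite ler_pM2l//.
      by move: ti; rewrite iS; lra.
    have H2 := HX j t; rewrite (le_trans i0 it) (le_trans ti iT) in H2; have {}H2 := H2 isT.
    have H3 := HX j (i%:R * tau); rewrite i0 (le_trans it (le_trans ti iT)) in H3.
    have {}H3 := H3 isT.
    have := le_trans (row_norm_coord (X (i%:R * tau) - Y (i%:R * tau)) j) Xi; rewrite !mxE.
    move: H1 H2 H3; move: (X t 0 j - Y t 0 j) (X (i%:R * tau) 0 j - Y (i%:R * tau) 0 j).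
    move: (noise U X j t - _) (noise U X j (i%:R * tau) - _) => p q x y H1 H2 H3 H4.
    have := ler_normD (x - y - (p - q)) (y + (p - q)); have := ler_normD y (p - q).
    have := ler_normB p q.
    by rewrite (_ : x - y - (p - q) + (y + (p - q)) = x); [lra|ring].
  - by rewrite (ltW ti') ti.
have := @path_dist_norm R n T theta0 X Y rho (ltW rho0).
move=> /(_ _)/le_lt_trans; apply.
  move=> t tT; apply: le_trans (bm m (leqnn m)); apply: claim => //.
  by rewrite mtau.
apply: (@le_lt_trans _ _ (e / 2)); last by rewrite ltr_pdivrMr// ltr_pMr// ltr1n.
by rewrite mulrC -ler_pdivlMr// ge_min lexx orbT.
Qed.

End stability.

(** * The large deviation principle *)

Section exponential_rates.
Context {R : realType}.
Implicit Types (p : R -> \bar R) (C a : R).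

Lemma limf_esup_le (F : set_system R) (f : R -> \bar R) (M : \bar R) :
  F [set x | (f x <= M)%E] -> (limf_esup f F <= M)%E.
Proof.
move=> FM; rewrite limf_esupE; apply: (@le_trans _ _ (ereal_sup (f @` [set x | (f x <= M)%E]))).
  by apply: ereal_inf_lbound; exists [set x | (f x <= M)%E].
by apply: ge_ereal_sup => _ [x Mx <-].
Qed.

Lemma le_limf_einf (F : set_system R) (f : R -> \bar R) (M : \bar R) :
  F [set x | (M <= f x)%E] -> (M <= limf_einf f F)%E.
Proof.
move=> FM; rewrite /limf_einf leeNr; apply: limf_esup_le.
by rewrite (_ : [set x | _] = [set x | (M <= f x)%E])//; apply/seteqP; split=> x /=;
  rewrite leeN2.
Qed.

Let ln_exp C a k : 0 < C -> k != 0 -> k * ln (C * expR (- (a / k))) = k * ln C - a.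
Proof.
move=> C0 k0; rewrite lnM ?posrE ?expR_gt0// expRK mulrDr mulrN; congr (_ - _).
by field.
Qed.

Let near_small C e : 0 < e -> \forall k \near (0 : R)^'+, 0 < k /\ `|k * ln C| <= e.
Proof.
move=> e0; near=> k; have k0 : 0 < k by near: k; exact: nbhs_right_gt.
split => //; rewrite normrM (gtr0_norm k0).
have kC : k < e / (`|ln C| + 1).
  by near: k; apply: nbhs_right_lt; rewrite divr_gt0// ltr_wpDl.
have := ltW kC; rewrite ler_pdivlMr ?ltr_wpDl// mulrDr mulr1; lra.
Unshelve. all: by end_near. Qed.

Lemma exponential_upper p C a : 0 < C ->
  (\forall k \near (0 : R)^'+, (p k <= (C * expR (- (a / k)))%:E)%E) ->
  (limf_esup (fun k : R => k%:E * lne (p k)) 0^'+ <= (- a)%:E)%E.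
Proof.
move=> C0 H; apply/lee_addgt0Pr => e e0; rewrite -EFinD; apply: limf_esup_le.
have := near_small C e0; apply: filterS2 H => k H [k0 kC] /=.
apply: (@le_trans _ _ (k%:E * lne (C * expR (- (a / k)))%:E)%E).
  rewrite lee_pmul2l ?lte_fin//.
  have [p0|p0] := leP (p k) 0%E; first by rewrite le0_lneNy// leNye.
  by rewrite lee_lne// in_itv/= leey andbT ?(ltW p0)// lee_fin mulr_ge0 ?expR_ge0// ltW.
rewrite lne_EFin; last by rewrite mulr_gt0 ?expR_gt0.
rewrite -EFinM lee_fin ln_exp ?gt_eqF//.
by have := ler_norm (k * ln C); lra.
Qed.

Lemma exponential_lower p C a : 0 < C ->
  (\forall k \near (0 : R)^'+, ((C * expR (- (a / k)))%:E <= p k)%E) ->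
  ((- a)%:E <= limf_einf (fun k : R => k%:E * lne (p k)) 0^'+)%E.
Proof.
move=> C0 H; rewrite -[leLHS]oppeK leeNl; apply/lee_addgt0Pr => e e0.
rewrite leeNl oppeD// -EFinN opprK -EFinD; apply: le_limf_einf.
have := near_small C e0; apply: filterS2 H => k H [k0 kC] /=.
apply: (@le_trans _ _ (k%:E * lne (C * expR (- (a / k)))%:E)%E).
  rewrite lne_EFin; last by rewrite mulr_gt0 ?expR_gt0.
  rewrite -EFinM lee_fin ln_exp ?gt_eqF//.
  by have := ler_norm (- (k * ln C)); rewrite normrN; lra.
rewrite lee_pmul2l ?lte_fin//.
have E0 : (0 <= (C * expR (- (a / k)))%:E)%E by rewrite lee_fin mulr_ge0 ?expR_ge0// ltW.
by rewrite lee_lne// in_itv/= leey andbT// (le_trans E0).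
Qed.

End exponential_rates.

(** * Upper and lower bounds for the laws of the solutions *)

Section large_deviations.
Context {R : realType} (n : nat) (T : R) (theta0 : 'rV[R]_n.+1) (U : 'rV[R]_n.+1 -> R).
Context (d : measure_display) (Omega : measurableType d) (P : probability Omega R)
  (W : 'I_n.+1 -> R -> Omega -> R).
Hypothesis T0 : 0 < T.
Hypothesis U_dyson : dyson_type_potential U.
Hypothesis W_brownian : independent_brownians P W.
Local Notation path := (torus_path T theta0).

Let driven (k : R) (w : Omega) (X : path) : Prop :=
  forall j t, 0 <= t <= T -> noise U X j t = Num.sqrt k * W j t w.

Lemma strong_solution_noise k (X : Omega -> path) : strong_solution P W (drift U) k X ->
  exists2 N, measurable N & P N = 0%E /\ forall w, ~ N w -> driven k w (X w).
Proof.
move=> [_ _ [N [mN PN HN]]]; exists N => //; split=> // w nNw j t tT.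
have : [set w | forall t : R, t \in `[0, T] -> forall j, X w t 0 j = theta0 0 j
   + (\int[lebesgue_measure]_(s in `[0, t]) drift U j (X w s)) + Num.sqrt k * W j t w] w.
  by apply: contrapT => H; apply: nNw; exact: HN.
move=> /(_ t); rewrite in_itv/= => /(_ tT j) E.
by rewrite /noise /residual E; ring.
Qed.

Lemma driven_energy k w (X : path) N : driven k w X ->
  noise_energy U N X = scaled_energy T W N k w.
Proof.
move=> E; rewrite /noise_energy /scaled_energy; congr (_ * _).
apply: eq_bigr => j _; apply: eq_bigr => i _.
by rewrite !E// dyad_ge0//= dyad_leT// ltnW.
Qed.

Lemma driven_osc k w (X : path) N dl : driven k w X -> 0 < dl -> ~ rough T W N dl k w ->
  forall j i t, (i < 2 ^ N)%N -> dyad T N i <= t <= dyad T N i.+1 ->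
    `|noise U X j t - noise U X j (dyad T N i)| <= dl.
Proof.
move=> E dl0 nr j; apply: dyadic_chaining_cell => //; first exact: noise_dyadic_continuous.
move=> m i im; apply: ltW; rewrite ltNge; apply/negP => H; apply: nr.
exists m => //; exists (j, Ordinal im) => //=; apply: le_trans H _.
by rewrite !E ?dyad_ge0 ?dyad_leT// 1?ltnW// /increment mulrBr.
Qed.

(** The second bound is on the exponent of [rough_tail]: on a fine grid, an oscillation dl inside
    the cells is unlikely at any prescribed rate a. *)
Lemma fine_level (dl a : R) : 0 < dl -> exists N0, forall N, (N0 <= N)%N ->
  T / 2 ^+ N <= dl /\ a <= dl ^+ 2 * 2 ^+ N / (18 * T).
Proof.
move=> dl0; have a0 : 0 < `|a| + 1 by rewrite ltr_wpDl.
have [|N0 H] := @dyad_step_cvg _ T T0 (Num.min dl (dl ^+ 2 / (18 * (`|a| + 1)))).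
  by rewrite lt_min dl0 divr_gt0 ?exprn_gt0 ?mulr_gt0.
exists N0 => N /H; rewrite lt_min => /andP[/ltW h1 h2]; split => //.
rewrite ler_pdivlMr ?mulr_gt0//; move: h2.
rewrite ltr_pdivrMr ?exprn_gt0// mulrAC ltr_pdivlMr ?mulr_gt0// => h2.
apply: le_trans (ltW h2); rewrite (_ : a * (18 * T) = T * (18 * a)); last by ring.
by rewrite ler_pM2l// ler_pM2l//; have := ler_norm a; lra.
Qed.

Let near_k (q : R) : 0 < q -> \forall k \near (0 : R)^'+, 0 < k /\ k < q.
Proof.
move=> q0; near=> k; split; near: k; [exact: nbhs_right_gt|exact: nbhs_right_lt].
Unshelve. all: by end_near. Qed.

Context (X : R -> Omega -> path).
Hypothesis X_sol : \forall k \near (0 : R)^'+, strong_solution P W (drift U) k (X k).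

Let measurable_event k (A : set path) : strong_solution P W (drift U) k (X k) ->
  open A \/ closed A -> measurable (X k @^-1` A).
Proof.
move=> [mX _ _] [oA|cA]; apply: mX; first exact: sub_sigma_algebra.
have [_ sC _] := @smallest_sigma_algebra path setT open.
rewrite -[A]setCK -setTD; apply: sC; apply: sub_sigma_algebra.
exact: closed_openC.
Qed.

(* If J > c on the closed set A, then a solution in A has a large discrete noise
   energy, unless its noise oscillates much below the grid scale. *)
Let upper_rate (A : set path) (c c2 : R) : closed A -> 0 <= c -> c < c2 ->
  (forall x, A x -> (c2%:E < dirichlet_energy (drift U) x)%E) ->
  (limf_esup (fun k : R => k%:E * lne (law P (X k) A)) 0^'+ <= (- c)%:E)%E.
Proof.
move=> cA c0 cc2 HA.
have [|dl dl0 Hdl] := closed_not_regular T0 U_dyson cA (le_trans c0 (ltW cc2)).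
  move=> x /HA Jx; apply: contrapT => nN.
  move: Jx; rewrite ltNge => /negP; apply; apply/dirichlet_energy_leP => // N.
  by rewrite leNgt; apply/negP => h; apply: nN; exists N.
(* Any grid of mesh at most dl can witness regularity, so N is taken fine enough for the rough event
   to have rate at least c. *)
have [N /(_ N (leqnn N))[hN qc]] := fine_level c dl0.
have [C C0 HC] := energy_tail T0 W_brownian N c0 cc2.
set q := dl ^+ 2 * 2 ^+ N / (18 * T) in qc.
have q0 : 0 < q by rewrite divr_gt0 ?mulr_gt0 ?exprn_gt0.
pose C2 : R := n.+1%:R * 2 ^+ N.+1; have C20 : 0 < C2 by rewrite mulr_gt0 ?exprn_gt0.
apply: (@exponential_upper _ _ (C + C2)); first exact: addr_gt0.
have q24 : 0 < q / 24 by rewrite divr_gt0.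
have := near_k q24; apply: filterS2 X_sol => k sol [k0 kq].
have [E mE [HE PE]] := HC k k0.
have [Z mZ [PZ HZ]] := strong_solution_noise sol.
have mr := measurable_rough T0 W_brownian N dl k0.
have mA := measurable_event sol (or_intror cA).
have sub : X k @^-1` A `<=` (E `|` rough T W N dl k) `|` Z.
  move=> w /= Aw; have [Zw|nZ] := pselect (Z w); [by right|left].
  have [rw|nr] := pselect (rough T W N dl k w); [by right|left].
  have Dw := HZ w nZ; apply: HE => /=; rewrite -(driven_energy N Dw).
  rewrite leNgt; apply/negP => h; apply: (Hdl _ Aw); exists N; split => //.
    exact: ltW.
  exact: driven_osc Dw dl0 nr.
have mEr : measurable (E `|` rough T W N dl k) by exact: measurableU.
apply: le_trans (le_measure P (mem_set mA) (mem_set (measurableU _ _ mEr mZ)) sub) _.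
apply: le_trans (measureU2 _ mEr mZ) _; rewrite [X in (_ + X)%E]PZ adde0.
apply: le_trans (measureU2 _ mE mr) _; rewrite mulrDl EFinD; apply: leeD => //.
apply: le_trans (rough_tail T0 W_brownian dl0 k0 _) _.
  by move: kq; rewrite ltr_pdivlMr// mulrC => /ltW.
by rewrite lee_fin ler_pM2l// ler_expR lerN2 ler_pM2r// invr_gt0.
Qed.

(** Every c below the infimum is a rate by [upper_rate] when c >= 0; for negative c it suffices that
    probabilities are at most 1. *)
Lemma ldp_upper (A : set path) : closed A ->
  (limf_esup (fun k : R => k%:E * lne (law P (X k) A)) 0^'+
   <= - ereal_inf [set dirichlet_energy (drift U) x | x in A])%E.
Proof.
move=> cA; set I := ereal_inf _; rewrite leeNr.
set L := limf_esup _ _.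
have Lneg : (0 <= - L)%E.
  rewrite leeNr oppe0; apply: limf_esup_le.
  have := near_k ltr01; apply: filterS2 X_sol => k sol [k0 _] /=.
  rewrite mule_ge0_le0 ?lee_fin ?(ltW k0)// lne_le0; apply: probability_le1.
  by apply: measurable_event sol _; right.
have Hc (c c2 : R) : c < c2 -> (c2%:E < I)%E -> (c%:E <= - L)%E.
  move=> cc2 cI; have [c0|c0] := ltP c 0.
    by apply: le_trans Lneg; rewrite lee_fin ltW.
  rewrite leeNr -EFinN; apply: (upper_rate cA c0 cc2) => x Ax.
  by apply: lt_le_trans cI _; apply: ereal_inf_lbound; exists x.
case EI : I => [r| |]; last by rewrite leNye.
- apply/lee_subgt0Pr => e e0; rewrite -EFinB; apply: (Hc _ (r - e / 2)); first lra.
  by rewrite EI lte_fin; lra.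
- rewrite leye_eq; apply/eqP/eqyP => c _.
  by apply: (Hc c (c + 1)); [rewrite ltrDl|rewrite EI ltry].
Qed.

(* Steer the increments of sqrt k W along those of the noise of x. *)
Let lower_rate (A : set path) (x : path) (c e : R) : open A -> A x -> 0 < e ->
  (dirichlet_energy (drift U) x <= c%:E)%E ->
  ((- (c + e))%:E <= limf_einf (fun k : R => k%:E * lne (law P (X k) A)) 0^'+)%E.
Proof.
move=> oA Ax e0 /(dirichlet_energy_leP T0 U_dyson) xE.
have /nbhs_ballP[r /= r0 Hr] : nbhs x A by exact: open_nbhs_nbhs.
have [eta eta0 Heta] := noise_stability T0 U_dyson x r0.
have eta3 : 0 < eta / 3 by rewrite divr_gt0.
have [N1 HN1] := finite_energy_osc T0 U_dyson xE eta3.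
(* The surplus 1 in the rate makes the rough event negligible against the event that the increments
   follow x. *)
have [N2 HN2] := fine_level (c + e + 1) eta3.
pose N := maxn N1 N2.
have [_ osc] := HN1 N (leq_maxl _ _); have [_ qc] := HN2 N (leq_maxr _ _).
set q := (eta / 3) ^+ 2 * 2 ^+ N / (18 * T) in qc.
have q0 : 0 < q by rewrite divr_gt0 ?mulr_gt0 ?exprn_gt0.
pose p j (i : 'I_(2 ^ N)) := noise U x j (dyad T N i.+1) - noise U x j (dyad T N i).
(* Errors of up to 2^N increments accumulate to eta / 3 at the grid points; the other two thirds are
   for the oscillations of the two noises inside a cell. *)
have etaN : 0 < eta / 3 / 2 ^+ N by rewrite divr_gt0// exprn_gt0.
have [C C0 HC] := increments_lower T0 W_brownian p etaN e0.
have pE : (\sum_j \sum_i p j i ^+ 2) / (2 * (T / 2 ^+ N)) = noise_energy U N x.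
  rewrite /noise_energy invfM mulrA mulrAC [RHS]mulrC; congr (_ * _).
  by rewrite mulr_suml; apply: eq_bigr => j _; rewrite /dyadic_energy mulr_suml.
pose C2 : R := n.+1%:R * 2 ^+ N.+1; have C20 : 0 < C2 by rewrite mulr_gt0 ?exprn_gt0.
apply: (@exponential_lower _ _ (C / 2)); first exact: divr_gt0.
(* The bounds q / 24 and 1 are for [rough_tail] and [increments_lower]. The third lets the surplus
   factor exp (- 1 / k) <= k turn C2 into C / 2, so that the rough event takes away at most half of
   the lower bound. *)
pose q' := Num.min (Num.min (q / 24) 1) (C / 2 / C2).
have q24 : 0 < q / 24 by rewrite divr_gt0.
have CC2 : 0 < C / 2 / C2 by rewrite divr_gt0// divr_gt0.
have q'0 : 0 < q' by rewrite !lt_min q24 ltr01.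
have := near_k q'0; apply: filterS2 X_sol => k sol [k0].
rewrite !lt_min -andbA => /and3P[kq k1 kC].
have [E mE [HE PE]] := HC k k0 (ltW k1).
have [Z mZ [PZ HZ]] := strong_solution_noise sol.
have mr := measurable_rough T0 W_brownian N (eta / 3) k0.
have mA := measurable_event sol (or_introl oA).
have sub : E `<=` (X k @^-1` A `|` rough T W N (eta / 3) k) `|` Z.
  move=> w /HE/= Ew; have [Zw|nZ] := pselect (Z w); [by right|left].
  have [rw|nr] := pselect (rough T W N (eta / 3) k w); [by right|left].
  have Dw := HZ w nZ; apply: Hr; rewrite /ball/= path_dist_sym.
  apply: Heta => j t /andP[t0 tT].
  have gT i : (i <= 2 ^ N)%N -> 0 <= dyad T N i <= T.
    by move=> iN; rewrite dyad_ge0//= dyad_leT.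
  have grid i : (i <= 2 ^ N)%N ->
      `|noise U (X k w) j (dyad T N i) - noise U x j (dyad T N i)| <= i%:R * (eta / 3 / 2 ^+ N).
    elim: i => [_|i IH iN]; first by rewrite dyad0 !noise0 subrr normr0 mul0r.
    rewrite -natr1 mulrDl mul1r; have := Ew j (Ordinal iN); rewrite /p /increment mulrBr.
    rewrite /= -(Dw j _ (gT _ iN)) -(Dw j _ (gT _ (ltnW iN))) => h1; have := IH (ltnW iN).
    move: h1; move: (noise U (X k w) j (dyad T N i.+1)) (noise U (X k w) j (dyad T N i)).
    move: (noise U x j (dyad T N i.+1)) (noise U x j (dyad T N i)) => a b a' b' h1 h2.
    have := ler_normD (a' - b' - (a - b)) (b' - b).
    by rewrite (_ : a' - b' - (a - b) + (b' - b) = a' - a); [lra|ring].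
  have [tTe|tlt] := eqVneq t T.
    have := grid _ (leqnn _); rewrite dyad_last natrX tTe [leRHS]mulrC.
    by rewrite divfK ?expf_neq0// => /le_trans; apply; lra.
  have {tlt} tlt : t < T by rewrite lt_neqAle tlt.
  have /andP[it ti] := dyad_floorP T0 N t0; set i := dyad_floor T N t in it ti.
  have iN : (i < 2 ^ N)%N.
    rewrite ltnNge; apply/negP => /(dyad_le T0 N); rewrite dyad_last.
    by move=> /le_trans/(_ it); rewrite leNgt tlt.
  have it' : dyad T N i <= t <= dyad T N i.+1 by rewrite it ltW.
  have h1 := osc j i t iN it'.
  have h2 := driven_osc Dw eta3 nr j iN it'.
  have h3 := grid i (ltnW iN).
  have h4 : i%:R * (eta / 3 / 2 ^+ N) <= eta / 3.
    rewrite mulrCA ger_pMr// ler_pdivrMr ?exprn_gt0// mul1r -natrX ler_nat.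
    exact: ltnW.
  move: h1 h2 h3; move: (noise U (X k w) j t) (noise U x j t).
  move: (noise U (X k w) j _) (noise U x j _) => a b a' b' h1 h2 h3.
  have := ler_normD (a' - a - (b' - b)) (a - b); have := ler_normB (a' - a) (b' - b).
  by rewrite (_ : a' - a - (b' - b) + (a - b) = a' - b'); [lra|ring].
have mAr : measurable (X k @^-1` A `|` rough T W N (eta / 3) k) by exact: measurableU.
have le1 : (P E <= P (X k @^-1` A) + P (rough T W N (eta / 3) k))%E.
  apply: le_trans (le_measure P (mem_set mE) (mem_set (measurableU _ _ mAr mZ)) sub) _.
  apply: le_trans (measureU2 _ mAr mZ) _; rewrite [X in (_ + X)%E]PZ adde0.
  exact: measureU2.
have le2 : (P (rough T W N (eta / 3) k) <= (C / 2 * expR (- ((c + e) / k)))%:E)%E.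
  apply: le_trans (rough_tail T0 W_brownian eta3 k0 _) _.
    by move: kq; rewrite ltr_pdivlMr// mulrC => /ltW.
  rewrite lee_fin -/q -/C2; apply: (@le_trans _ _ (C2 * (expR (- ((c + e) / k)) * expR (- k^-1)))).
    rewrite ler_pM2l// -expRD ler_expR -opprD lerN2 -[X in _ + X]mul1r -mulrDl.
    by rewrite ler_pM2r// invr_gt0.
  rewrite mulrCA [leRHS]mulrC ler_pM2l ?expR_gt0//.
  have kk : expR (- k^-1) <= k.
    rewrite expRN -[leRHS]invrK lef_pV2 ?posrE ?expR_gt0 ?invr_gt0//.
    by have := expR_ge1Dx k^-1; lra.
  by move: kC; rewrite ltr_pdivlMr// mulrC => /ltW; apply: le_trans; rewrite ler_pM2l.
have le3 : ((C * expR (- ((c + e) / k)))%:E <= P E)%E.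
  apply: le_trans PE; rewrite pE lee_fin ler_pM2l// ler_expR lerN2.
  by rewrite ler_pM2r ?invr_gt0// lerD2r.
have := le_trans le3 (le_trans le1 (leeD2l (P (X k @^-1` A)) le2)).
rewrite -leeBlDr// -EFinB; apply: le_trans.
by rewrite lee_fin -mulrBl; lra.
Qed.

Lemma ldp_lower (A : set path) : open A ->
  (- ereal_inf [set dirichlet_energy (drift U) x | x in A]
   <= limf_einf (fun k : R => k%:E * lne (law P (X k) A)) 0^'+)%E.
Proof.
move=> oA; set L := limf_einf _ _; rewrite leeNl; apply: le_ereal_inf_tmp => _ [x Ax <-].
case EJ : (dirichlet_energy (drift U) x) => [r| |]; last 2 first.
- by rewrite leey.
- by have := dirichlet_energy_ge0 U x; rewrite EJ.
rewrite leeNl; apply/lee_subgt0Pr => e e0.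
rewrite -EFinN -EFinB -opprD; apply: (lower_rate oA Ax e0).
by rewrite EJ.
Qed.

End large_deviations.

Theorem theorem1p8 (R : realType) (n : nat) (T : R) (T_gt0 : 0 < T)
    (theta0 : 'rV[R]_n.+1) (theta0_conf : torus_conf theta0)
    (U : 'rV[R]_n.+1 -> R) (U_dyson : dyson_type_potential U)
    (d : measure_display) (Omega : measurableType d) (P : probability Omega R)
    (W : 'I_n.+1 -> R -> Omega -> R) (W_brownian : independent_brownians P W)
    (X : R -> Omega -> torus_path T theta0)
    (X_sol : \forall kappa \near 0^'+,
       strong_solution P W (drift U) kappa (X kappa)) :
  large_deviation_principle (fun kappa => law P (X kappa))
    (@dirichlet_energy R n (drift U) T theta0).
Proof.
split; first exact: dirichlet_energy_good.
  by move=> F cF; exact: (ldp_upper T_gt0 U_dyson W_brownian X_sol cF).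
by move=> O oO; exact: (ldp_lower T_gt0 U_dyson W_brownian X_sol oO).
Qed.
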